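(* Let $T>0$ and let $D\subset\mathbb{R}^n$ be a strictly convex $\mathcal{C}^{1,1}$ domain. Then $D\in\mathcal{S}_Q$ if and only if there exist constants $c_1,c_2>0$ depending only on $D$ and $T$ such that, with $$h(t,x,y)=\left(1\wedge\frac{\delta_D(x)\delta_D(y)}{t}\right)+\left(1\wedge \frac{\delta_{D}(x)\delta_{D}\left(\frac{x+y}2\right)}{t}\right)\left(1\wedge \frac{\delta_{D}(y)\delta_{D}\left(\frac{x+y}{2}\right)}{t}\right),$$ one has $$c_1\,h(t,x,y)\,p(t,x,y)\leq p_D(t,x,y)\leq c_2\,h(t,x,y)\,p(t,x,y)\qquad\text{for all }x,y\in D,\ 0<t<T.$$
   Context: A domain is an open connected subset of $\mathbb{R}^n$. $a\wedge b=\min\{a,b\}$. $p(t,x,y)=(4\pi t)^{-n/2}e^{-|x-y|^2/(4t)}$ is the global heat kernel of the Laplacian $\Delta$ on $\mathbb{R}^n$. $p_D(t,x,y)$ is the Dirichlet heat kernel of $D$: the fundamental solution of the heat equation $\partial_t u=\Delta u$ in $D$ with Dirichlet condition on $\partial D$; equivalently, the transition density of Brownian motion (normalized to have transition density $p(t,x,y)$) killed upon leaving $D$. For an open set $E$ and $x\in E$, $\delta_E(x)$ is the distance from $x$ to $\partial E$. A $\mathcal{C}^{1,1}$ set is one whose boundary is locally the graph of a $\mathcal{C}^{1,1}$ function. For a convex $\mathcal{C}^{1,1}$ domain $D$ and $w\in\partial D$, $H_w$ is the open half-space containing $D$ whose boundary is the tangent hyperplane to $D$ at $w$. For a strictly convex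 $\mathcal{C}^{1,1}$ domain $D$ (with at least two boundary points) put $$Q_D:=\inf_{w,z\in\partial D,\ w\neq z}\frac{\delta_D\left(\frac{w+z}{2}\right)}{\delta_{H_{w}}\left(\frac{w+z}2\right)}\in[0,1],$$ and let $\mathcal{S}_Q$ be the class of strictly convex $\mathcal{C}^{1,1}$ domains $D\subset\mathbb{R}^n$ with $Q_D>0$. *)

(* Defs.v *)
From HB Require Import structures.
From mathcomp Require Import all_boot all_order all_algebra.
From mathcomp Require Import all_classical all_reals all_analysis.
Import Order.TTheory GRing.Theory Num.Theory.
Import numFieldNormedType.Exports.
Set Implicit Arguments.
Unset Strict Implicit.
Unset Printing Implicit Defensive.
Local Open Scope classical_set_scope.
Local Open Scope ring_scope.

(* The library norm on 'rV[R]_n is the sup norm: it gives the right topology,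
   but Euclidean lengths and distances must go through [enorm]. *)
Definition dot (R : realType) (n : nat) (x y : 'rV[R]_n) : R :=
  \sum_(i < n) x 0 i * y 0 i.

Definition enorm (R : realType) (n : nat) (x : 'rV[R]_n) : R :=
  Num.sqrt (dot x x).

Definition basis_vec (R : realType) (n : nat) (i : 'I_n) : 'rV[R]_n :=
  delta_mx 0 i.

Definition boundary (T : topologicalType) (A : set T) : set T :=
  closure A `\` interior A.

(* A real infimum, meaningful only when the boundary of E is nonempty. *)
Definition bdist (R : realType) (n : nat) (E : set 'rV[R]_n)
    (x : 'rV[R]_n) : R :=
  inf [set enorm (x - z) | z in boundary E].

Definition midpoint (R : realType) (n : nat) (x y : 'rV[R]_n) : 'rV[R]_n :=
  2^-1 *: (x + y).

Definition domain (R : realType) (n : nat) (D : set 'rV[R]_n) : Prop :=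
  open D /\ connected D.

Definition strictly_convex (R : realType) (n : nat) (D : set 'rV[R]_n) : Prop :=
  forall (x y : 'rV[R]_n) (l : R),
    closure D x -> closure D y -> x <> y -> 0 < l -> l < 1 ->
    interior D (l *: x + (1 - l) *: y).

Definition C11_function (R : realType) (n : nat) (phi : 'rV[R]_n -> R) : Prop :=
  (forall x, differentiable phi x) /\
  (forall i : 'I_n, [lipschitz 'D_(basis_vec R i) phi x | x in setT]).

(* Near each boundary point z, D lies above the graph of a C^{1,1} function
   over the hyperplane orthogonal to a unit vector e (which depends on z).  A
   function on that hyperplane is represented by one on R^n, of which only the
   values at the orthogonal projections x - <x, e> e matter. *)
Definition C11_set (R : realType) (n : nat) (D : set 'rV[R]_n) : Prop :=
  forall z, boundary D z ->
    exists (e : 'rV[R]_n) (phi : 'rV[R]_n -> R),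
      [/\ enorm e = 1, C11_function phi &
          \forall x \near z, D x <-> phi (x - dot x e *: e) < dot x e].

(* The hyperplane through w with unit normal nu is tangent to the boundary of D
   at w when the distance |<x - w, nu>| from x to it is o(|x - w|) as x tends
   to w along the boundary. *)
Definition tangent_normal (R : realType) (n : nat) (D : set 'rV[R]_n)
    (w nu : 'rV[R]_n) : Prop :=
  enorm nu = 1 /\
  `|dot (x - w) nu| / enorm (x - w) @[x --> within (boundary D) w^'] --> (0 : R).

(* H is H_w; it is unique when D is a convex C^{1,1} domain. *)
Definition tangent_half_space (R : realType) (n : nat) (D : set 'rV[R]_n)
    (w : 'rV[R]_n) (H : set 'rV[R]_n) : Prop :=
  exists nu : 'rV[R]_n,
    [/\ tangent_normal D w nu, H = [set x | 0 < dot (x - w) nu] & D `<=` H].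

Definition QD (R : realType) (n : nat) (D : set 'rV[R]_n) : R :=
  inf [set q | exists (w z : 'rV[R]_n) (H : set 'rV[R]_n),
    [/\ boundary D w, boundary D z, w <> z, tangent_half_space D w H &
        q = bdist D (midpoint w z) / bdist H (midpoint w z)]].

Definition class_SQ (R : realType) (n : nat) (D : set 'rV[R]_n) : Prop :=
  [/\ domain D, strictly_convex D, C11_set D & 0 < QD D].

Definition heat_kernel (R : realType) (n : nat) (t : R) (x y : 'rV[R]_n) : R :=
  (4 * pi * t) `^ (- (n%:R / 2)) * expR (- (enorm (x - y) ^+ 2 / (4 * t))).

(* Iterated one-dimensional Lebesgue integral; by Fubini it is the n-dimensional
   Lebesgue integral for continuous functions with compact support, the only
   ones to which it is applied below. *)
Fixpoint iter_integral (R : realType) (n : nat) : ('rV[R]_n -> R) -> R :=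
  match n with
  | 0 => fun f => f 0
  | m.+1 => fun f =>
      \int[@lebesgue_measure R]_s
        iter_integral (fun v : 'rV[R]_m => f (row_mx (const_mx s : 'rV[R]_1) v))
  end.

Definition laplacian (R : realType) (n : nat) (f : 'rV[R]_n -> R)
    (x : 'rV[R]_n) : R :=
  \sum_(i < n) 'D_(basis_vec R i) ('D_(basis_vec R i) f) x.

(* u is C^1 in time and C^2 in space on (0, +oo) x D. *)
Definition C12 (R : realType) (n : nat) (D : set 'rV[R]_n)
    (u : R -> 'rV[R]_n -> R) : Prop :=
  forall (t : R) (x : 'rV[R]_n), 0 < t -> D x ->
  [/\ derivable (fun s => u s x) t 1,
      forall i, derivable (u t) x (basis_vec R i),
      forall i j, derivable ('D_(basis_vec R i) (u t)) x (basis_vec R j),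
      {for (t, x), continuous (fun p : R * 'rV[R]_n => u p.1 p.2)} &
  [/\ {for (t, x), continuous
         (fun p : R * 'rV[R]_n => derive1 (fun s => u s p.2) p.1)},
      forall i, {for (t, x), continuous
         (fun p : R * 'rV[R]_n => 'D_(basis_vec R i) (u p.1) p.2)} &
      forall i j, {for (t, x), continuous
         (fun p : R * 'rV[R]_n =>
            'D_(basis_vec R j) ('D_(basis_vec R i) (u p.1)) p.2)}]].

Definition compactly_supported_in (R : realType) (n : nat) (D : set 'rV[R]_n)
    (f : 'rV[R]_n -> R) : Prop :=
  exists K : set 'rV[R]_n,
    [/\ compact K, K `<=` D & forall x, ~ K x -> f x = 0].

(* The fundamental solution of the heat equation in D with zero boundary values:
   for each y in D, (t, x) |-> pD t x y is a classical solution that vanishes on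
   the boundary and starts from the Dirac mass at y.  These three conditions
   alone do not determine the kernel: in the half-space x_n > 0 one may add
   x_n t^{-n/2-1} exp(-|x|^2/4t), which has zero boundary and initial values.
   The bounds 0 <= pD <= p, which hold for the transition density of the killed
   Brownian motion, select that density and make the kernel unique on
   (0, +oo) x D x D.  Values of pD elsewhere are unconstrained. *)
Definition dirichlet_heat_kernel (R : realType) (n : nat) (D : set 'rV[R]_n)
    (pD : R -> 'rV[R]_n -> 'rV[R]_n -> R) : Prop :=
  [/\ forall (t : R) (x y : 'rV[R]_n), 0 < t -> D x -> D y ->
        0 <= pD t x y <= heat_kernel t x y,
      forall y, D y -> C12 D (fun t x => pD t x y),
      forall (t : R) (x y : 'rV[R]_n), 0 < t -> D x -> D y ->
        derive1 (fun s => pD s x y) t = laplacian (fun x' => pD t x' y) x,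
      forall (t : R) (w y : 'rV[R]_n), 0 < t -> boundary D w -> D y ->
        pD q.1 q.2 y @[q --> within [set q : R * 'rV[R]_n | D q.2] (nbhs (t, w))]
          --> (0 : R) &
      forall (y : 'rV[R]_n) (f : 'rV[R]_n -> R),
        D y -> continuous f -> compactly_supported_in D f ->
        iter_integral (fun x => pD t x y * f x) @[t --> 0^'+] --> f y].

Definition hfun (R : realType) (n : nat) (D : set 'rV[R]_n) (t : R)
    (x y : 'rV[R]_n) : R :=
  Num.min 1 (bdist D x * bdist D y / t) +
  Num.min 1 (bdist D x * bdist D (midpoint x y) / t) *
  Num.min 1 (bdist D y * bdist D (midpoint x y) / t).

(* Main.v *)
(* Everything reduces to the maximum principle for u / p, where u(t, x) = p_D(t, x, y).

   Lower bounds.  In a ball moving along the segment from y to x, the function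
   p (1 - exp (- k F / t)), with F close to the distance to the sphere, is a
   subsolution; this gives p_D >= c (1 /\ d(x) d(y) / t) p when both points lie in
   balls of radius >> sqrt t contained in D.  Running it twice, through a ball of
   radius comparable to d(m) around the midpoint m, gives the product term of h.

   Upper bounds.  If Q_D > 0 then D is bounded, so its boundary is uniformly C^{1,1},
   and the distance from y to the supporting hyperplane at the boundary point nearest
   to x is at most (4 / Q_D) d(m).  Comparison with the half-space kernel bounds
   u / p by d(y) l(x) / t, l being the distance to the hyperplane near y; a barrier of
   the form p P (1 - exp (- 2 b l') + c (t - s)), with l' the distance to the
   hyperplane near x, then adds the missing factor d(x) (d(m) + sqrt t) / t.

   Conversely, for boundary points w, z, let x and y tend to w and z along the normals
   and then t tend to 0.  A three-phase lower bound for p_D, through small balls next to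
   z and w, is of order (a l_z / t) (a l_w / t) p with a = d(x) = d(y), and the assumed
   upper bound forces l_z l_w <= C d(m)^2.  As d(m) <= l_z / 2, this gives
   l_w <= C d(m), i.e. Q_D > 0. *)
Require Import Defs.
From mathcomp Require Import all_boot all_order all_algebra.
From mathcomp Require Import all_classical all_reals all_analysis.
From mathcomp Require Import ring lra.
Import Order.TTheory GRing.Theory Num.Theory.
Import numFieldNormedType.Exports.
Set Implicit Arguments.
Unset Strict Implicit.
Unset Printing Implicit Defensive.
Local Open Scope classical_set_scope.
Local Open Scope ring_scope.

(** * Euclidean geometry *)

Section Euclid.
Context {R : realType} {n : nat}.
Implicit Types x y z : 'rV[R]_n.

(** The kernel is known only through the heat equation, its boundary and initial values and $0\le
    p_D\le p$; neither the semigroup property nor symmetry in $(x,y)$ is among these data. Hence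
    every estimate is a comparison in $(t,x)$ with $y$ fixed, and lower bounds are chained not by
    integrating over intermediate points but by restarting a subsolution from a bound already proved
    on a ball. The quotient $f=u/p$ satisfies $f_t=\Delta f-\frac{x-y}{t}\cdot\nabla f$: the drift
    is that of a Brownian bridge to $y$, whose mean path is the segment from $x$ to $y$. This is why
    the balls follow segments and why the midpoint enters $h$. A second obstacle is the initial
    condition, which is weak, while comparison needs pointwise bounds at a small time. For lower
    bounds it is turned into $p-p_D\le\varepsilon\,p(2s,\cdot,y)$ at small times $s$, uniformly in
    $x$; for upper bounds $p_D\le p$ suffices once the image Gaussian is compensated. Only the
    constant of the lower bound depends on $T$, because the kernel of a bounded domain decays
    exponentially for large times. *)

Lemma dotC x y : dot x y = dot y x.
Proof. by apply: eq_bigr => i _; rewrite mulrC. Qed.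

Lemma dotDl x y z : dot (x + y) z = dot x z + dot y z.
Proof. by rewrite -big_split; apply: eq_bigr => i _; rewrite mxE mulrDl. Qed.

Lemma dotZl (a : R) x y : dot (a *: x) y = a * dot x y.
Proof. by rewrite /dot big_distrr /=; apply: eq_bigr => i _; rewrite mxE mulrA. Qed.

Lemma dotNl x y : dot (- x) y = - dot x y.
Proof. by rewrite -scaleN1r dotZl mulN1r. Qed.

Lemma dotBl x y z : dot (x - y) z = dot x z - dot y z.
Proof. by rewrite dotDl dotNl. Qed.

Lemma dotDr x y z : dot x (y + z) = dot x y + dot x z.
Proof. by rewrite !(dotC x) dotDl. Qed.

Lemma dotZr (a : R) x y : dot x (a *: y) = a * dot x y.
Proof. by rewrite !(dotC x) dotZl. Qed.

Lemma dotNr x y : dot x (- y) = - dot x y.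
Proof. by rewrite !(dotC x) dotNl. Qed.

Lemma dotBr x y z : dot x (y - z) = dot x y - dot x z.
Proof. by rewrite !(dotC x) dotBl. Qed.

Lemma dot0l x : dot 0 x = 0.
Proof. by rewrite -(scale0r 0) dotZl mul0r. Qed.

Lemma dot0r x : dot x 0 = 0.
Proof. by rewrite dotC dot0l. Qed.

Definition dotE := (dotDl, dotDr, dotNl, dotNr, dotZl, dotZr, dot0l, dot0r).

Lemma dot_ge0 x : 0 <= dot x x.
Proof. by apply: sumr_ge0 => i _; rewrite -expr2 sqr_ge0. Qed.

Lemma dot_eq0 x : dot x x = 0 -> x = 0.
Proof.
move=> /eqP; rewrite psumr_eq0; last by move=> i _; rewrite -expr2 sqr_ge0.
move=> /allP h; apply/rowP => i; rewrite mxE.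
by have /eqP/eqP := h i (mem_index_enum _); rewrite mulf_eq0 orbb => /eqP.
Qed.

Lemma enorm_ge0 x : 0 <= enorm x.
Proof. exact: sqrtr_ge0. Qed.

Lemma enorm_sqr x : enorm x ^+ 2 = dot x x.
Proof. by rewrite sqr_sqrtr // dot_ge0. Qed.

Lemma enorm0 : enorm (0 : 'rV[R]_n) = 0.
Proof. by rewrite /enorm dot0l sqrtr0. Qed.

Lemma enorm_eq0 x : enorm x = 0 -> x = 0.
Proof. by move=> h; apply: dot_eq0; rewrite -enorm_sqr h expr0n. Qed.

Lemma enorm_gt0 x : x != 0 -> 0 < enorm x.
Proof.
move=> x0; rewrite lt_neqAle enorm_ge0 andbT eq_sym.
by apply: contra x0 => /eqP /enorm_eq0 ->.
Qed.

Lemma enormN x : enorm (- x) = enorm x.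
Proof. by rewrite /enorm dotNl dotNr opprK. Qed.

Lemma enorm_distC x y : enorm (x - y) = enorm (y - x).
Proof. by rewrite -enormN opprB. Qed.

Lemma enormZ (a : R) x : enorm (a *: x) = `|a| * enorm x.
Proof. by rewrite /enorm dotZl dotZr mulrA -expr2 sqrtrM ?sqr_ge0 // sqrtr_sqr. Qed.

Lemma dot_le_enorm x y : dot x y <= enorm x * enorm y.
Proof.
have [->|x0] := eqVneq x 0; first by rewrite dot0l enorm0 mul0r.
have [->|y0] := eqVneq y 0; first by rewrite dot0r enorm0 mulr0.
have a0 := enorm_gt0 x0; have b0 := enorm_gt0 y0.
have := dot_ge0 (enorm y *: x - enorm x *: y).
rewrite !dotE (dotC y x) -!enorm_sqr => h.
have : 0 <= 2 * (enorm x * enorm y) * (enorm x * enorm y - dot x y) by nra.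
by rewrite pmulr_rge0 ?subr_ge0 // mulr_gt0 // mulr_gt0.
Qed.

Lemma normr_dot_le x y : `|dot x y| <= enorm x * enorm y.
Proof.
rewrite ler_norml dot_le_enorm andbT lerNl -dotNl.
by rewrite (le_trans (dot_le_enorm _ _)) // enormN.
Qed.

Lemma enormD x y : enorm (x + y) <= enorm x + enorm y.
Proof.
rewrite -(@ler_pXn2r _ 2) ?nnegrE ?addr_ge0 ?enorm_ge0 //.
rewrite enorm_sqr !dotE (dotC y x) sqrrD !enorm_sqr.
have := dot_le_enorm x y; lra.
Qed.

Lemma enorm_triangle z x y : enorm (x - y) <= enorm (x - z) + enorm (z - y).
Proof. by rewrite -[x - y](addrA_addBB) || (have -> : x - y = (x - z) + (z - y) by rewrite addrA subrK); exact: enormD. Qed.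

Lemma coord_le_norm x i : `|x 0 i| <= `|x|.
Proof.
rewrite [leRHS]mx_normrE.
exact: (le_bigmax_cond _ (fun i : 'I_1 * 'I_n => `|x i.1 i.2|) (isT : predT (0, i))).
Qed.

Lemma coord_le_enorm x i : `|x 0 i| <= enorm x.
Proof.
rewrite -sqrtr_sqr ler_wsqrtr // /dot (bigD1 i) //= -expr2 lerDl.
by apply: sumr_ge0 => j _; rewrite -expr2 sqr_ge0.
Qed.

Lemma norm_le_coord x (r : R) : 0 <= r -> (forall i, `|x 0 i| <= r) -> `|x| <= r.
Proof.
move=> r0 h; rewrite [leLHS]mx_normrE; apply: bigmax_le => // -[i j] _.
by rewrite ord1; exact: h.
Qed.

Lemma norm_le_enorm x : `|x| <= enorm x.
Proof. by apply: norm_le_coord => [|i]; [exact: enorm_ge0|exact: coord_le_enorm]. Qed.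

Lemma enorm_le_norm x : enorm x <= n%:R * `|x|.
Proof.
rewrite -(@ler_pXn2r _ 2) ?nnegrE ?mulr_ge0 ?enorm_ge0 // enorm_sqr.
apply: (@le_trans _ _ (\sum_(i < n) `|x| ^+ 2)).
  apply: ler_sum => i _; rewrite -expr2 -real_normK ?num_real //.
  by rewrite ler_pXn2r ?nnegrE // coord_le_norm.
rewrite sumr_const card_ord -[X in X <= _]mulr_natl exprMn.
rewrite ler_wpM2r ?sqr_ge0 // -natrX ler_nat; case: (n) => // m.
by rewrite expnS expn1 leq_pmulr.
Qed.

Lemma nbhs_enormP x (A : set 'rV[R]_n) :
  nbhs x A <-> exists2 r, 0 < r & forall z, enorm (z - x) < r -> A z.
Proof.
split=> [/nbhs_ballP [r /= r0 h]|[r r0 h]].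
  exists r => // z zr; apply: h; rewrite -ball_normE /= distrC.
  exact: le_lt_trans (norm_le_enorm _) zr.
(* The factor in [enorm_le_norm] is [n]; dividing by [n.+1] also makes sense in dimension 0. *)
apply/nbhs_ballP; exists (r / n.+1%:R) => /=; first by rewrite divr_gt0.
move=> z; rewrite -ball_normE /= distrC => zr; apply: h.
apply: le_lt_trans (enorm_le_norm _) _.
move: zr; rewrite ltr_pdivlMr // mulrC; apply: le_lt_trans.
by rewrite ler_wpM2r // ler_nat.
Qed.

Lemma enorm_continuous_at (f : 'rV[R]_n -> R) x :
  (forall e, 0 < e -> exists2 r, 0 < r & forall z, enorm (z - x) < r -> `|f z - f x| < e) ->
  {for x, continuous f}.
Proof.
move=> h; apply/(@cvgrPdist_lt _ _ _ _ (nbhs_filter x)) => e /h [r r0 hr].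
by apply/nbhs_enormP; exists r => // z /hr; rewrite distrC.
Qed.

Lemma enorm_continuous : continuous (@enorm R n).
Proof.
move=> x; apply: enorm_continuous_at => e e0; exists e => // z zr.
apply: le_lt_trans zr; rewrite ler_norml; apply/andP; split.
  have := enorm_triangle z x 0; rewrite !subr0 (enorm_distC x); lra.
have := enorm_triangle x z 0; rewrite !subr0; lra.
Qed.

Lemma dot_continuous (v : 'rV[R]_n) : continuous (fun x => dot x v).
Proof.
move=> x; apply: enorm_continuous_at => e e0.
have v1 : 0 < enorm v + 1 by rewrite ltr_wpDl ?enorm_ge0.
exists (e / (enorm v + 1)); first exact: divr_gt0.
move=> z; rewrite ltr_pdivlMr // => zr; rewrite -dotBl.
apply: le_lt_trans (normr_dot_le _ _) _.
by apply: le_lt_trans zr; rewrite ler_wpM2l ?enorm_ge0 // lerDl.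
Qed.

Lemma bounded_enorm_compact (A : set 'rV[R]_n) (r : R) :
  closed A -> (forall x, A x -> enorm x <= r) -> compact A.
Proof.
move=> cA h; apply: bounded_closed_compact => //.
rewrite /bounded_set; exists r; split; first exact: num_real.
by move=> s rs x /h xr; apply: le_trans (norm_le_enorm _) (le_trans xr (ltW rs)).
Qed.

Lemma continuous_dotxx : continuous (fun x : 'rV[R]_n => dot x x).
Proof.
move=> x; rewrite (_ : (fun x => _) = (fun x => enorm x ^+ 2)); last first.
  by apply/funext => z; rewrite enorm_sqr.
by apply: continuousM; exact: enorm_continuous.
Qed.

End Euclid.

(** * Jets and the maximum principle *)

Section OneVariable.
Context {R : realType}.
Implicit Types (f d : R -> R) (a l : R).

Lemma is_derive1_cvg f a l : is_derive a 1 f l ->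
  h^-1 * (f (a + h) - f a) @[h --> 0^'] --> l.
Proof.
move=> h; have := @ex_derive _ _ _ _ _ _ _ h; rewrite /derivable => /cvg_ex [l' hl].
have := @derive_val _ _ _ _ _ _ _ h; rewrite /derive => hl'.
have <- : l' = l by rewrite -hl'; exact/esym/(cvg_lim (@Rhausdorff R)).
move: hl; apply: cvg_trans; apply: near_eq_cvg; near=> k.
by rewrite /= [k *: 1]mulr1 [a + k]addrC.
Unshelve. all: end_near. Qed.

Lemma is_derive1_continuous f a l : is_derive a 1 f l -> {for a, continuous f}.
Proof. by move=> h; apply/differentiable_continuous/derivable1_diffP; exact: ex_derive. Qed.

(** One-sided, because [max_principle] compares its maximum only with earlier times. *)
Lemma left_max_derive_ge0 f a l : is_derive a 1 f l ->
  (exists2 r, 0 < r & forall s, a - r < s -> s <= a -> f s <= f a) -> 0 <= l.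
Proof.
move=> /is_derive1_cvg /cvgrPdist_lt h [r r0 hr]; rewrite leNgt; apply/negP => l0.
have := h _ (_ : 0 < - l); rewrite oppr_gt0 => /(_ l0).
move=> -[e /= e0 he].
pose s := - (Num.min e r / 2).
have m0 : 0 < Num.min e r by rewrite lt_min e0.
have [me mr] : Num.min e r <= e /\ Num.min e r <= r by rewrite !ge_min !lexx orbT.
have s0 : s < 0 by rewrite /s; lra.
have := he s; rewrite /= sub0r normrN ltr0_norm // => /(_ _ _).
have -> : - s < e by rewrite /s; lra.
move=> /(_ isT); rewrite lt_eqF // => /(_ isT).
rewrite ltr_norml => /andP [h2 _].
have h3 : s^-1 * (f (a + s) - f a) < 0 by lra.
have : f (a + s) <= f a by apply: hr; rewrite /s; lra.
rewrite -subr_le0 => h4.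
have : 0 <= s^-1 * (f (a + s) - f a) by rewrite mulr_le0 // invr_le0 ltW.
lra.
Qed.

Lemma max_derive_eq0 f a l : is_derive a 1 f l ->
  (exists2 r, 0 < r & forall s, `|s - a| < r -> f s <= f a) -> l = 0.
Proof.
move=> h [r r0 hr]; apply/eqP; rewrite eq_le; apply/andP; split; last first.
  apply: (left_max_derive_ge0 h); exists r => // s h1 h2; apply: hr.
  by rewrite ltr_norml; lra.
have h' : is_derive (- a) 1 (f \o -%R) (l * -1).
  have h2 : is_derive (- (- a)) 1 f l by rewrite opprK.
  exact: is_derive1_comp h2 (is_deriveNid _ _).
rewrite -oppr_ge0 -mulrN1; apply: (left_max_derive_ge0 h'); exists r => // s h1 h2.
by rewrite /= opprK; apply: hr; rewrite ltr_norml; lra.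
Qed.

(** [d] is only differentiable at 0, where it vanishes; a positive derivative there would make [d]
    positive just to the right of 0, and the mean value theorem would make [f] exceed [f 0]. *)
Lemma max_second_derive_le0 f d l : (\forall s \near (0 : R), is_derive s (1 : R) f (d s)) ->
  is_derive (0 : R) (1 : R) d l -> (exists2 r, 0 < r & forall s, `|s| < r -> f s <= f 0) -> l <= 0.
Proof.
move=> hd hl [r r0 hr]; rewrite leNgt; apply/negP => l0.
have d0 : d 0 = 0.
  apply: (max_derive_eq0 (nbhs_singleton hd)); exists r => // s; rewrite subr0; exact: hr.
move/is_derive1_cvg : hl => /cvgrPdist_lt /(_ _ l0) [e /= e0 he].
move: hd => /nbhs_ballP [e' /= e'0 he'].
pose m := Num.min r (Num.min e e').
have m0 : 0 < m by rewrite !lt_min r0 e0.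
have [mr me me'] : [/\ m <= r, m <= e & m <= e'] by rewrite !ge_min !lexx !orbT.
have der x : 0 <= x -> x < m -> is_derive x 1 f (d x).
  move=> x0 xm; apply: he'; rewrite -ball_normE /= sub0r normrN ger0_norm //; lra.
have m20 : 0 < m / 2 by lra.
have [||c] := @MVT R f d 0 (m / 2) m20.
- by move=> x; rewrite in_itv /= => /andP [x0 xm]; apply: der; lra.
- apply: derivable_within_continuous => x; rewrite in_itv /= => /andP [x0 xm].
  by apply: ex_derive; apply: der; lra.
rewrite in_itv /= subr0 => /andP [c0 cm] hc.
have := he c; rewrite /= sub0r normrN gtr0_norm // => /(_ _ _).
have -> : c < e by lra.
move=> /(_ isT); rewrite gt_eqF // => /(_ isT); rewrite add0r d0 subr0.
rewrite ltr_norml => /andP [_ h2].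
have cd : 0 < c^-1 * d c by lra.
have : 0 < d c by move: cd; rewrite pmulr_rgt0 // invr_gt0.
move=> dc; have : 0 < d c * (m / 2) by rewrite mulr_gt0.
rewrite -hc; have := hr (m / 2); rewrite gtr0_norm // => /(_ _); lra.
Qed.

End OneVariable.

(** * Calculus of jets and the parabolic maximum principle *)

Section Jets.
Context {R : realType} {n : nat}.
Implicit Types (f g : R -> 'rV[R]_n -> R) (t : R) (x : 'rV[R]_n).

(* The 1-jet in time and the 2-jet in space, of which only the gradient and the
   Laplacian are recorded; the pure second derivatives H i are enough for the
   maximum principle. *)
Record has_jet f t x (ft : R) (G : 'rV[R]_n) (L : R) : Prop := HasJet {
  jet_continuous : {for (t, x), continuous (fun p : R * 'rV[R]_n => f p.1 p.2)};
  jet_time : is_derive t (1 : R) (fun s => f s x) ft;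
  jet_space : exists H : 'I_n -> R, L = \sum_i H i /\
    forall i, exists d : R -> R,
      [/\ \forall s \near (0 : R),
            is_derive s (1 : R) (fun s => f t (x + s *: basis_vec R i)) (d s),
          d 0 = G 0 i & is_derive (0 : R) (1 : R) d (H i)] }.

Lemma jet_add f g t x ft Gf Lf gt Gg Lg :
  has_jet f t x ft Gf Lf -> has_jet g t x gt Gg Lg ->
  has_jet (fun t x => f t x + g t x) t x (ft + gt) (Gf + Gg) (Lf + Lg).
Proof.
case=> cf tf [Hf [-> hf]] [cg tg [Hg [-> hg]]]; split.
- exact: cvgD.
- exact: is_deriveD.
exists (fun i => Hf i + Hg i); split; first by rewrite big_split.
move=> i; have [df [f1 f2 f3]] := hf i; have [dg [g1 g2 g3]] := hg i.
exists (df + dg); split.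
- by near=> s; apply: is_deriveD; near: s.
- by rewrite mxE -f2 -g2.
- exact: is_deriveD.
Unshelve. all: end_near. Qed.

Lemma jet_mul f g t x ft Gf Lf gt Gg Lg :
  has_jet f t x ft Gf Lf -> has_jet g t x gt Gg Lg ->
  has_jet (fun t x => f t x * g t x) t x (ft * g t x + f t x * gt)
    (g t x *: Gf + f t x *: Gg) (Lf * g t x + 2 * dot Gf Gg + f t x * Lg).
Proof.
case=> cf tf [Hf [-> hf]] [cg tg [Hg [-> hg]]]; split.
- exact: cvgM.
- have := is_deriveM tf tg => h; apply: is_derive_eq h _.
  by rewrite /GRing.scale /=; ring.
exists (fun i => Hf i * g t x + 2 * (Gf 0 i * Gg 0 i) + f t x * Hg i); split.
  rewrite !big_split /= /dot big_distrl big_distrr big_distrr /=.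
  by congr (_ + _ + _).
move=> i; have [df [f1 f2 f3]] := hf i; have [dg [g1 g2 g3]] := hg i.
pose lf s := f t (x + s *: basis_vec R i); pose lg s := g t (x + s *: basis_vec R i).
have lf0 : lf 0 = f t x by rewrite /lf scale0r addr0.
have lg0 : lg 0 = g t x by rewrite /lg scale0r addr0.
exists (lf * dg + lg * df); split.
- near=> s.
  have h : is_derive s (1 : R) lf (df s) by near: s.
  have h' : is_derive s (1 : R) lg (dg s) by near: s.
  exact: is_deriveM h h'.
- by rewrite /= !mxE -f2 -g2 -lf0 -lg0 addrC.
- have h : is_derive (0 : R) (1 : R) lf (df 0) := nbhs_singleton f1.
  have h' : is_derive (0 : R) (1 : R) lg (dg 0) := nbhs_singleton g1.
  apply: is_derive_eq (is_deriveD (is_deriveM h g3) (is_deriveM h' f3)) _.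
  by rewrite /GRing.scale /= -lf0 -lg0 -f2 -g2; ring.
Unshelve. all: end_near. Qed.

Lemma jet_comp (F F1 : R -> R) (F2 : R) f t x ft G L :
  (\forall u \near f t x, is_derive u (1 : R) F (F1 u)) ->
  is_derive (f t x) (1 : R) F1 F2 -> has_jet f t x ft G L ->
  has_jet (fun t x => F (f t x)) t x (F1 (f t x) * ft) (F1 (f t x) *: G)
    (F2 * dot G G + F1 (f t x) * L).
Proof.
move=> hF hF1 [cf tf [H [-> hf]]]; have hF0 := nbhs_singleton hF; split.
- apply: (@continuous_comp _ _ _ (fun p => f p.1 p.2) F) => //=.
  exact: is_derive1_continuous hF0.
- exact: is_derive1_comp hF0 tf.
exists (fun i => F2 * (G 0 i * G 0 i) + F1 (f t x) * H i); split.
  by rewrite big_split /= /dot !big_distrr.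
move=> i; have [d [f1 f2 f3]] := hf i.
pose l s := f t (x + s *: basis_vec R i).
have l0 : l 0 = f t x by rewrite /l scale0r addr0.
have dl : is_derive (0 : R) (1 : R) l (d 0) := nbhs_singleton f1.
exists ((F1 \o l) * d); split.
- have cl : {for 0, continuous l} := is_derive1_continuous dl.
  have hF' : \forall s \near (0 : R), is_derive (l s) (1 : R) F (F1 (l s)).
    have hl : nbhs (l 0) [set u : R | is_derive u (1 : R) F (F1 u)] by rewrite l0.
    exact: (cl _ hl).
  near=> s.
  have h : is_derive s (1 : R) l (d s) by near: s.
  have h' : is_derive (l s) (1 : R) F (F1 (l s)) by near: s.
  exact: is_derive1_comp h' h.
- by rewrite /= mxE -f2 -l0.
- have h : is_derive (l 0) (1 : R) F1 F2 by rewrite l0.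
  apply: is_derive_eq (is_deriveM (is_derive1_comp h dl) f3) _.
  by rewrite /GRing.scale /= l0 f2; ring.
Unshelve. all: end_near. Qed.

Lemma jet_time_fun (a : R -> R) (a' : R) t x : is_derive t (1 : R) a a' ->
  has_jet (fun t _ => a t) t x a' 0 0.
Proof.
move=> h; split => //.
- apply: (@continuous_comp _ _ _ (fun p : R * 'rV[R]_n => p.1) a).
    exact: cvg_fst.
  exact: is_derive1_continuous h.
exists (fun=> 0); split; first by rewrite big1.
move=> i; exists (fun=> 0); split; rewrite ?mxE //.
- by near=> s; exact: is_derive_cst.
- exact: is_derive_cst.
Unshelve. all: end_near. Qed.

Lemma jet_cst (a : R) t x : has_jet (fun _ _ => a) t x 0 0 0.
Proof. by apply: (jet_time_fun (a := fun=> a)); exact: is_derive_cst. Qed.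

Lemma jet_eq f t x ft G L ft' G' L' : has_jet f t x ft G L ->
  ft = ft' -> G = G' -> L = L' -> has_jet f t x ft' G' L'.
Proof. by move=> h <- <- <-. Qed.

Lemma jet_fun_eq g f t x ft G L : has_jet f t x ft G L -> f = g ->
  has_jet g t x ft G L.
Proof. by move=> h <-. Qed.

Lemma jet_scale (a : R) f t x ft G L : has_jet f t x ft G L ->
  has_jet (fun t x => a * f t x) t x (a * ft) (a *: G) (a * L).
Proof.
move=> h; apply: jet_eq (jet_mul (jet_cst a t x) h) _ _ _.
- by rewrite mul0r add0r.
- by rewrite scaler0 add0r.
- by rewrite mul0r dot0l mulr0 !add0r.
Qed.

Lemma jet_opp f t x ft G L : has_jet f t x ft G L ->
  has_jet (fun t x => - f t x) t x (- ft) (- G) (- L).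
Proof.
move=> h; have := jet_scale (-1) h; rewrite !mulN1r scaleN1r => h'.
by apply: jet_fun_eq h' _; do 2 apply/funext => ?; rewrite mulN1r.
Qed.

Lemma jet_sub f g t x ft Gf Lf gt Gg Lg :
  has_jet f t x ft Gf Lf -> has_jet g t x gt Gg Lg ->
  has_jet (fun t x => f t x - g t x) t x (ft - gt) (Gf - Gg) (Lf - Lg).
Proof. by move=> hf hg; exact: jet_add hf (jet_opp hg). Qed.

Lemma is_derive_line (a b s : R) : is_derive s (1 : R) (fun s => a + s * b) b.
Proof.
have h := is_deriveD (is_derive_cst a s 1) (is_deriveM (is_derive_id s (1 : R)) (is_derive_cst b s 1)).
by apply: is_derive_eq h _; rewrite /GRing.scale /=; ring.
Qed.

Lemma dot_basis_vec x i : dot (basis_vec R i) x = x 0 i.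
Proof.
rewrite /dot (bigD1 i) //= mxE !eqxx mul1r big1 ?addr0 // => j ji.
by rewrite mxE eqxx (negbTE ji) mul0r.
Qed.

Lemma jet_dot (v : 'rV[R]_n) t x : has_jet (fun _ x => dot x v) t x 0 v 0.
Proof.
split.
- apply: (@continuous_comp _ _ _ (fun p : R * 'rV[R]_n => p.2) (fun x => dot x v)).
    exact: cvg_snd.
  exact: dot_continuous.
- exact: is_derive_cst.
exists (fun=> 0); split; first by rewrite big1.
move=> i; exists (fun=> v 0 i); split => //; last exact: is_derive_cst.
near=> s; rewrite (_ : (fun s => _) = fun s => dot x v + s * v 0 i) //.
  exact: is_derive_line.
by apply/funext => u; rewrite !dotE dot_basis_vec.
Unshelve. all: end_near. Qed.

Lemma jet_sqr t x : has_jet (fun _ x => dot x x) t x 0 (2 *: x) (2 * n%:R).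
Proof.
split.
- apply: (@continuous_comp _ _ _ (fun p : R * 'rV[R]_n => p.2) (fun x => dot x x)).
    exact: cvg_snd.
  exact: continuous_dotxx.
- exact: is_derive_cst.
exists (fun=> 2); split; first by rewrite sumr_const card_ord mulr_natr.
move=> i; exists (fun s => 2 * x 0 i + s * 2); split.
- near=> s; rewrite (_ : (fun s => _) = fun s => dot x x + s * (2 * x 0 i) + s * s); last first.
    apply/funext => u; rewrite !dotE dot_basis_vec (dotC x) dot_basis_vec dot_basis_vec.
    by rewrite [X in u * (u * X)]mxE !eqxx /=; ring.
  have h := is_deriveD (is_derive_line (dot x x) (2 * x 0 i) s)
    (is_deriveM (is_derive_id s (1 : R)) (is_derive_id s (1 : R))).
  by apply: is_derive_eq h _; rewrite /GRing.scale /=; ring.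
- by rewrite mul0r addr0 mxE.
- exact: is_derive_line.
Unshelve. all: end_near. Qed.

Lemma jet_shift (c : R) f t x ft G L : has_jet f (t + c) x ft G L ->
  has_jet (fun t x => f (t + c) x) t x ft G L.
Proof.
case=> cf tf hf; split => //.
- apply: (@continuous_comp _ _ _ (fun p : R * 'rV[R]_n => (p.1 + c, p.2))
    (fun p => f p.1 p.2)) => //.
  have h1 : p.1 + c @[p --> nbhs (t, x)] --> t + c.
    by apply: cvgD; [exact: cvg_fst|exact: cvg_cst].
  have h2 : p.2 @[p --> nbhs (t, x)] --> x by exact: cvg_snd.
  exact: cvg_pair h1 h2.
- have h : is_derive t (1 : R) (fun s => s + c) 1.
    have h := is_deriveD (is_derive_id t (1 : R)) (is_derive_cst c t 1).
    by apply: is_derive_eq h _; rewrite addr0.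
  have := @is_derive1_comp _ (fun s => f s x) (fun s => s + c) t _ _ tf h.
  by rewrite mulr1.
Qed.

(** Compactness of the superlevel sets at positive levels stands for the condition [w <= 0] on the
    lateral boundary, so that no values of [w] there have to be defined. Subtracting [e * (t - a)]
    makes the inequality strict: at a maximum the time derivative of [w] is at least [e > 0] while
    its Laplacian is at most 0. *)
Lemma max_principle (Om : set (R * 'rV[R]_n)) (w : R -> 'rV[R]_n -> R) (a b : R) :
  open Om ->
  (forall e, 0 < e -> compact [set p | [/\ a <= p.1 <= b, Om p & e <= w p.1 p.2]]) ->
  (forall x, Om (a, x) -> w a x <= 0) ->
  (forall t x, a <= t <= b -> Om (t, x) -> 0 < w t x ->
     exists wt G L, has_jet w t x wt G L /\ wt <= L) ->
  forall t x, a <= t <= b -> Om (t, x) -> w t x <= 0.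
Proof.
move=> oOm cK w0 hw t0 x0 t0ab O0; rewrite leNgt; apply/negP => W0.
set W := w t0 x0 in W0.
have ab : a <= b by case/andP: t0ab => h1 h2; exact: le_trans h2.
(* Small enough that the penalised function still exceeds [W / 2] at [(t0, x0)]; its maximum over
   the compact set [K] is then a maximum over all points of [Om] up to time [t1]. *)
pose e := W / (2 * (b - a + 1)).
have e0 : 0 < e by rewrite divr_gt0 //; lra.
have eW : e * (2 * (b - a + 1)) = W by rewrite divfK // gt_eqF //; lra.
have W2 : 0 < W / 2 by lra.
pose K := [set p : R * 'rV[R]_n | [/\ a <= p.1 <= b, Om p & W / 2 <= w p.1 p.2]].
have cw t x : a <= t <= b -> Om (t, x) -> 0 < w t x ->
    {for (t, x), continuous (fun p : R * 'rV[R]_n => w p.1 p.2)}.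
  by move=> tab Ox wp; have [wt [G [L [hj _]]]] := hw t x tab Ox wp; exact: jet_continuous hj.
pose f (p : R * 'rV[R]_n) := w p.1 p.2 - e * (p.1 - a).
have Kne : K !=set0 by exists (t0, x0); split => //=; rewrite -/W; lra.
have [|[t1 x1]] := compact_EVT_max (f := f) Kne (cK _ W2).
  apply: continuous_in_subspaceT => -[t x]; rewrite inE => -[/= tab Ox wx].
  apply: cvgB; first by apply: cw => //; lra.
  by apply: cvgMr; apply: cvgB; [exact: cvg_fst|exact: cvg_cst].
rewrite inE => -[/= t1ab O1 w1] hmax.
have f10 : W / 2 < f (t1, x1).
  have : f (t0, x0) <= f (t1, x1).
    by apply: hmax; rewrite inE; split => //=; rewrite -/W; lra.
  rewrite {1}/f /= -/W => h; apply: lt_le_trans h.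
  by case/andP: t0ab => h1 h2; nra.
have at1 : a < t1.
  rewrite lt_neqAle; case/andP: (t1ab) => -> _; rewrite andbT; apply/eqP => at1.
  by have := w0 x1; rewrite at1 => /(_ O1); lra.
have hall t x : a <= t <= t1 -> Om (t, x) -> f (t, x) <= f (t1, x1).
  move=> tab Ox; have [h|h] := leP (W / 2) (w t x).
    by apply: hmax; rewrite inE; split => //=; case/andP: tab t1ab => -> /= + /andP [_]; exact: le_trans.
  apply/ltW/(le_lt_trans _ f10); rewrite /f /= (le_trans _ (ltW h)) // lerBlDr lerDl.
  by rewrite mulr_ge0 ?(ltW e0) // subr_ge0; case/andP: tab.
have [r r0 hr] : exists2 r, 0 < r & forall t x, `|t - t1| < r -> enorm (x - x1) < r -> Om (t, x).
  have [[A B] [/= /nbhs_ballP [r /= r0 hA] /nbhs_enormP [r' r'0 hB]] hAB] : nbhs (t1, x1) Om by exact: open_nbhs_nbhs.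
  exists (Num.min r r'); first by rewrite lt_min r0.
  move=> t x; rewrite !lt_min => /andP [h1 _] /andP [_ h2]; apply: (hAB (t, x)); split => /=.
    by apply: hA; rewrite -ball_normE /= distrC.
  exact: hB.
have [wt [G [L [[_ jt [H [LH jx]]] wtL]]]] := hw _ _ t1ab O1 (lt_le_trans W2 w1).
have ewt : e <= wt.
  have hd : is_derive t1 (1 : R) (fun s => w s x1 - (- e * a + s * e)) (wt - e).
    exact: is_deriveB jt (is_derive_line _ _ _).
  rewrite -subr_ge0; apply: (left_max_derive_ge0 hd).
  exists (Num.min r (t1 - a)); first by rewrite lt_min r0 subr_gt0.
  move=> s s1 s2.
  have [m1 m2] : Num.min r (t1 - a) <= r /\ Num.min r (t1 - a) <= t1 - a by rewrite !ge_min !lexx orbT.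
  have := hall s x1; rewrite /f /= => /(_ _ _).
  have -> : a <= s <= t1 by rewrite s2 andbT; lra.
  move=> /(_ isT (hr s x1 _ _)); rewrite subrr enorm0 => h.
  have := h _ r0; rewrite ltr_norml => /(_ _); have -> : - r < s - t1 < r by lra.
  by move=> /(_ isT); lra.
have L0 : L <= 0.
  rewrite LH; apply: sumr_le0 => i _; have [d [d1 _ d3]] := jx i.
  apply: (max_second_derive_le0 d1 d3); exists r => // s sr; rewrite scale0r addr0.
  have := hall t1 (x1 + s *: basis_vec R i); rewrite /f /= lerD2r; apply.
    by rewrite lexx andbT ltW.
  apply: hr; rewrite ?subrr ?normr0 // addrC addKr enormZ /enorm dot_basis_vec mxE !eqxx sqrtr1 mulr1 //.
lra.
Qed.

End Jets.

(** * The Gaussian kernel and the Dirichlet kernel *)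

Section Gauss.
Context {R : realType} {n : nat}.
Implicit Types (t : R) (x y : 'rV[R]_n).

(** The heat kernel as a single exponential, so that its jet comes from the chain rule and products
    of kernels become sums of exponents. *)
Definition gauss t x y : R :=
  expR (- (n%:R / 2) * ln (4 * pi * t) - dot (x - y) (x - y) * (4 * t)^-1).

Lemma heat_kernelE t x y : 0 < t -> heat_kernel t x y = gauss t x y.
Proof.
move=> t0; rewrite /heat_kernel /gauss /powR gt_eqF; last first.
  by rewrite !mulr_gt0 ?pi_gt0.
by rewrite -expRD enorm_sqr.
Qed.

Lemma gauss_gt0 t x y : 0 < gauss t x y.
Proof. exact: expR_gt0. Qed.

Lemma is_derive_inv4 t : 0 < t -> is_derive t (1 : R) (fun t : R => (4 * t)^-1) (- (4 * t ^+ 2)^-1).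
Proof.
move=> t0.
have h : is_derive t (1 : R) (fun t : R => 4 * t) 4.
  have h := is_deriveM (is_derive_cst (4 : R) t 1) (is_derive_id t (1 : R)).
  by apply: is_derive_eq h _; rewrite /GRing.scale /=; ring.
apply: is_derive_eq (is_deriveV _ h) _; first by rewrite gt_eqF // mulr_gt0.
by rewrite /GRing.scale /=; field; rewrite gt_eqF.
Qed.

Lemma is_derive_ln4pi t : 0 < t ->
  is_derive t (1 : R) (fun t : R => - (n%:R / 2) * ln (4 * pi * t)) (- (n%:R / 2) / t).
Proof.
move=> t0.
have h : is_derive t (1 : R) (fun t : R => 4 * pi * t) (4 * pi).
  have h := is_deriveM (is_derive_cst (4 * pi : R) t 1) (is_derive_id t (1 : R)).
  by apply: is_derive_eq h _; rewrite /GRing.scale /=; ring.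
have p0 : 0 < 4 * pi * t by rewrite !mulr_gt0 ?pi_gt0.
have h2 := is_derive1_comp (is_derive1_ln p0) h.
have h3 := is_deriveM (is_derive_cst (- (n%:R / 2) : R) t 1) h2.
apply: is_derive_eq h3 _; rewrite /GRing.scale /=.
have := @pi_gt0 R; set p := (pi : R); clearbody p => pi0.
by field; rewrite !gt_eqF.
Qed.

Lemma jet_sqdist (b U : 'rV[R]_n) t x :
  has_jet (fun t x => dot (x - (b + t *: U)) (x - (b + t *: U))) t x
    (- 2 * dot (x - (b + t *: U)) U) (2 *: (x - (b + t *: U))) (2 * n%:R).
Proof.
have hid := jet_time_fun x (is_derive_id t (1 : R)).
have h1 := jet_sub (jet_sqr t x) (jet_scale 2 (jet_add (jet_dot b t x) (jet_mul hid (jet_dot U t x)))).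
have h2 := jet_add h1 (jet_cst (dot b b) t x).
have h3 := jet_add h2 (jet_scale (2 * dot b U) hid).
have h4 := jet_add h3 (jet_scale (dot U U) (jet_mul hid hid)).
apply: jet_eq (jet_fun_eq h4 _) _ _ _.
- apply/funext => s; apply/funext => z.
  by rewrite !dotE (dotC b z) (dotC U b) (dotC U z); ring.
- rewrite !dotE (dotC b); ring.
- by apply/rowP => i; rewrite !mxE; ring.
- rewrite !dotE; ring.
Qed.

Lemma jet_gauss t x y : 0 < t ->
  let L := gauss t x y * (dot (x - y) (x - y) / (4 * t ^+ 2) - n%:R / (2 * t)) in
  has_jet (fun t x => gauss t x y) t x L ((- gauss t x y / (2 * t)) *: (x - y)) L.
Proof.
move=> t0 L.
have h1 := jet_time_fun x (is_derive_ln4pi t0).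
have h2 := jet_time_fun x (is_derive_inv4 t0).
have h3 := jet_sub h1 (jet_mul (jet_sqdist y 0 t x) h2).
have hE : \forall u \near (- (n%:R / 2) * ln (4 * pi * t) - dot (x - (y + t *: 0)) (x - (y + t *: 0)) * (4 * t)^-1),
  is_derive u (1 : R) expR (expR u).
  by near=> u; exact: is_derive_expR.
have h4 := jet_comp hE (is_derive_expR _) h3.
have e0 : t *: 0 = 0 :> 'rV[R]_n by rewrite scaler0.
rewrite !e0 !addr0 in h4.
apply: jet_eq (jet_fun_eq h4 _) _ _ _.
- by do 2 apply/funext => ?; rewrite /gauss scaler0 addr0.
- by rewrite /L /gauss dot0r; field; rewrite gt_eqF.
- rewrite -/(gauss t x y) !scaler0 !addr0 add0r -scalerN scalerA -scaleNr scalerA.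
  by congr (_ *: _); field; rewrite gt_eqF.
- rewrite -/(gauss t x y) !scaler0 !addr0 !dotE /L !dotE; field; rewrite gt_eqF //.
Unshelve. all: end_near. Qed.

(** The Gaussian solves the heat equation and has logarithmic gradient [- (x - y) / (2 t)], so that
    the mixed term of the product rule becomes the drift [(x - y) / t]. All barriers below are
    tested against this operator. *)
Lemma jet_gauss_mul f t x y ft G L : 0 < t -> has_jet f t x ft G L ->
  exists wt G' L', has_jet (fun t x => gauss t x y * f t x) t x wt G' L' /\
    wt - L' = gauss t x y * (ft - L + dot (x - y) G / t).
Proof.
move=> t0 h; have := jet_mul (jet_gauss x y t0) h.
set wt := (X in has_jet _ _ _ X); set G' := (X in has_jet _ _ _ _ X _).
set L' := (X in has_jet _ _ _ _ _ X) => hj.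
exists wt, G', L'; split => //; rewrite /wt /L' dotZl; field; rewrite gt_eqF //.
Qed.

End Gauss.

(** * Jets and elementary bounds of the Dirichlet kernel *)

Section Kernel.
Context {R : realType} {n : nat} (D : set 'rV[R]_n) (pD : R -> 'rV[R]_n -> 'rV[R]_n -> R).
Hypothesis oD : open D.
Hypothesis hpD : dirichlet_heat_kernel D pD.

Lemma is_derive_along (f : 'rV[R]_n -> R) (x v : 'rV[R]_n) (s : R) :
  derivable f (x + s *: v) v ->
  is_derive s (1 : R) (fun s => f (x + s *: v)) ('D_v f (x + s *: v)).
Proof.
move=> h.
have e : (fun h : R => h^-1 *: (((fun s => f (x + s *: v)) \o shift s) (h *: 1) - f (x + s *: v)))
   = (fun h => h^-1 *: ((f \o shift (x + s *: v)) (h *: v) - f (x + s *: v))).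
  apply/funext => k /=; congr (_ *: (f _ - _)).
  by rewrite [k *: 1]mulr1 scalerDl addrCA.
by apply: DeriveDef; rewrite ?/derivable ?/derive e.
Qed.

Lemma open_line (x v : 'rV[R]_n) : D x -> \forall s \near (0 : R), D (x + s *: v).
Proof.
move=> Dx.
have c : {for (0 : R), continuous (fun s : R => x + s *: v)}.
  by apply: cvgD; [exact: cvg_cst|apply: cvgZ; [exact: cvg_id|exact: cvg_cst]].
by apply: c; rewrite /= scale0r addr0; apply: open_nbhs_nbhs.
Qed.

Lemma jet_pD t x y : 0 < t -> D x -> D y ->
  exists G L, has_jet (fun t x => pD t x y) t x L G L.
Proof.
move=> t0 Dx Dy; case: hpD => _ hC hH _ _.
have [h1 h2 h3 h4 _] := hC y Dy t x t0 Dx.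
exists (\row_i 'D_(basis_vec R i) (fun x => pD t x y) x), (laplacian (fun x => pD t x y) x).
split => //.
- apply: DeriveDef => //; rewrite -(hH t x y t0 Dx Dy) derive1E //.
exists (fun i => 'D_(basis_vec R i) ('D_(basis_vec R i) (fun x => pD t x y)) x); split => //.
move=> i; exists (fun s => 'D_(basis_vec R i) (fun x => pD t x y) (x + s *: basis_vec R i)); split.
- near=> s; apply: is_derive_along; have Ds : D (x + s *: basis_vec R i).
    by near: s; exact: open_line.
  by have [_ h _ _ _] := hC y Dy t _ t0 Ds.
- by rewrite mxE scale0r addr0.
- have := @is_derive_along ('D_(basis_vec R i) (fun x => pD t x y)) x (basis_vec R i) 0.
  by rewrite scale0r addr0; apply.
Unshelve. all: end_near. Qed.

Lemma pD_ge0 t x y : 0 < t -> D x -> D y -> 0 <= pD t x y.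
Proof. by move=> t0 Dx Dy; case: hpD => /(_ t x y t0 Dx Dy) /andP []. Qed.

Lemma pD_le_gauss t x y : 0 < t -> D x -> D y -> pD t x y <= gauss t x y.
Proof. by move=> t0 Dx Dy; rewrite -heat_kernelE //; case: hpD => /(_ t x y t0 Dx Dy) /andP []. Qed.

End Kernel.

(** * Subsolutions in moving balls *)

Section BallBarrier.
Context {R : realType} {n : nat}.
Implicit Types (t : R) (x y b U : 'rV[R]_n).

Lemma expRN_le1 (s : R) : 0 <= s -> expR (- s) <= 1.
Proof. by move=> s0; rewrite -expR0 ler_expR oppr_le0. Qed.

Lemma expRN_ge (s : R) : 1 - s <= expR (- s).
Proof. exact: expR_ge1Dx. Qed.

(** The scalar core of [jet_ball_barrier]: [sg] is sqrt t, [g] the depth, [s = g / sg],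
    [E = exp (- s)], [q] the squared relative distance to the centre, [N] the dimension. As
    [F >= g / 2], the first term is at most [- 2 s N / rho], and it remains to see that
    [1 - 2 E q - 2 s <= 0]; for [s <= 1] this follows from [E q >= (1 - s) (1 - s / 2)]. *)
Lemma ball_barrier_ineq (N rho sg g E q m s F : R) :
  0 <= N -> 0 < rho -> 0 < sg -> 4 * sg <= rho -> 4 * N * sg <= rho -> 0 <= s ->
  g = s * sg -> 0 <= q -> q = 1 - 2 * g / rho -> 1 - s <= E -> 0 <= E <= 1 ->
  F = g - (2 * N / rho) * sg ^+ 2 * (1 - E) -> m <= 1 ->
  - (4 * N / (rho * sg)) * F - (2 * N / rho) * E * s / 2 + m * N / rho - (2 * N / rho) * E * q <= 0.
Proof.
move=> N0 r0 sg0 h1 h2 s0 hg q0 hq hE /andP [E0 E1] hF m1.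
have hF2 : g / 2 <= F.
  have e : (2 * N / rho) * sg ^+ 2 * (1 - E) <= g / 2.
    apply: (@le_trans _ _ ((2 * N / rho) * sg ^+ 2 * s)).
      by rewrite ler_wpM2l ?mulr_ge0 ?invr_ge0 ?sqr_ge0 // ?(ltW r0) //; lra.
    have -> : 2 * N / rho * sg ^+ 2 * s = ((4 * N * sg) / rho) * (s * sg / 2) by field; rewrite gt_eqF.
    rewrite hg -{2}[s * sg / 2]mul1r ler_wpM2r //; first by rewrite divr_ge0 // mulr_ge0 // ltW.
    by rewrite ler_pdivrMr // mul1r.
  by rewrite hF; lra.
have a0 : 0 <= 4 * N / (rho * sg) by rewrite divr_ge0 ?mulr_ge0 // ltW // mulr_gt0.
have e1 : 4 * N / (rho * sg) * (g / 2) <= 4 * N / (rho * sg) * F by rewrite ler_wpM2l.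
have e2 : 4 * N / (rho * sg) * (g / 2) = (N / rho) * (2 * s).
  by rewrite hg; field; rewrite !gt_eqF.
have Nr : 0 <= N / rho by rewrite divr_ge0 // ltW.
have e3 : m * N / rho <= N / rho by rewrite -mulrA ler_piMl.
have q1 : 1 - s / 2 <= q.
  rewrite hq hg; have -> : 2 * (s * sg) / rho = (4 * sg / rho) * (s / 2) by field; rewrite gt_eqF.
  have : 4 * sg / rho <= 1 by rewrite ler_pdivrMr // mul1r.
  by move=> h; have := ler_wpM2r (_ : 0 <= s / 2) h; rewrite mul1r divr_ge0 // => /(_ isT); lra.
have e4 : 1 - 2 * (E * q) - 2 * s <= 0.
  have [s1|s1] := leP s 1.
    have : (1 - s) * (1 - s / 2) <= E * q by apply: ler_pM => //; lra.
    nra.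
  have : 0 <= E * q by rewrite mulr_ge0.
  lra.
have e5 : (N / rho) * (1 - 2 * (E * q) - 2 * s) <= 0 by rewrite mulr_ge0_le0.
have e6 : 0 <= (2 * N / rho) * E * s / 2 by rewrite !mulr_ge0 ?invr_ge0 // ltW.
have -> : 2 * N / rho * E * q = (N / rho) * (2 * (E * q)) by ring.
move: e5; rewrite !mulrBr mulr1 -e2; lra.
Qed.

(* [ball_depth] and [depth] below are smooth substitutes for the distance to the sphere:
   they lie between half of it and all of it inside the ball. *)
Definition ball_depth (rho : R) b U t x : R :=
  (rho ^+ 2 - dot (x - (b + t *: U)) (x - (b + t *: U))) * (2 * rho)^-1.

(* [1 - exp (- ball_depth / sqrt t)] is a boundary-layer correction: its Laplacian
   compensates the negative Laplacian of [ball_depth]. *)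
Definition ball_phase (rho k0 : R) b U t x : R :=
  (k0 * expR (- (8 * n%:R / rho) * Num.sqrt t) * t^-1) *
  (ball_depth rho b U t x - (2 * n%:R / rho) *
     (t * (1 - expR (- (ball_depth rho b U t x * (Num.sqrt t)^-1))))).

Definition ball_barrier (rho k0 : R) b U t x : R := 1 - expR (- ball_phase rho k0 b U t x).

Lemma jet_ball_depth (rho : R) b U t x : 0 < rho ->
  has_jet (ball_depth rho b U) t x (dot (x - (b + t *: U)) U / rho)
    (- rho^-1 *: (x - (b + t *: U))) (- (n%:R / rho)).
Proof.
move=> r0; have h := jet_mul (jet_sub (jet_cst (rho ^+ 2) t x) (jet_sqdist b U t x)) (jet_cst (2 * rho)^-1 t x).
apply: jet_eq h _ _ _.
- by field; rewrite gt_eqF.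
- by apply/rowP => i; rewrite !mxE; field; rewrite gt_eqF.
- by rewrite !dotE; field; rewrite gt_eqF.
Qed.

Lemma jet_expR f t x ft G L : @has_jet R n f t x ft G L ->
  has_jet (fun t x => expR (f t x)) t x (expR (f t x) * ft) (expR (f t x) *: G)
    (expR (f t x) * (dot G G + L)).
Proof.
move=> h; have hE : \forall u \near f t x, is_derive u (1 : R) expR (expR u).
  by near=> u; exact: is_derive_expR.
by rewrite mulrDr; exact: (jet_comp hE (is_derive_expR _) h).
Unshelve. all: end_near. Qed.

Lemma is_derive_inv (a : R -> R) (a' : R) t : a t != 0 -> is_derive t (1 : R) a a' ->
  is_derive t (1 : R) (fun t => (a t)^-1) (- a' / (a t) ^+ 2).
Proof.
move=> a0 h; apply: is_derive_eq (is_deriveV a0 h) _.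
by rewrite /GRing.scale /=; field.
Qed.

(** Two errors have to be paid for. The squared gradient of the phase is absorbed by the drift,
    provided [k0] is at most the depth of [y] in the initial ball. The curvature terms, of relative
    order [n / (rho sqrt t)], are absorbed by the factor [exp (- 8 n sqrt t / rho)] of the phase,
    whose logarithmic derivative is [- 4 n / (rho sqrt t)]. *)
Lemma jet_ball_barrier (rho k0 : R) b U y t x : 0 < rho -> 0 < t ->
  exists ft G L, has_jet (ball_barrier rho k0 b U) t x ft G L /\
   (4 * n.+1%:R * Num.sqrt t <= rho -> 0 <= k0 ->
    k0 <= ball_depth rho b U 0 y -> 0 <= ball_depth rho b U t x ->
    ft - L + dot (x - y) G / t <= 0).
Proof.
move=> r0 t0; pose sg := Num.sqrt t.
have sg0 : 0 < sg by rewrite sqrtr_gt0.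
have sgt : t = sg ^+ 2 by rewrite sqr_sqrtr // ltW.
have dsg := is_derive1_sqrt t0; rewrite -[Num.ExtraDef.sqrtr t]/sg in dsg.
pose X := x - (b + t *: U); pose N : R := n%:R.
pose g := ball_depth rho b U t x; pose gt := dot X U / rho.
have jg : has_jet (ball_depth rho b U) t x gt (- rho^-1 *: X) (- (N / rho)).
  exact: jet_ball_depth.
pose s := g / sg; pose st := gt / sg - g / (2 * sg ^+ 3).
have js : has_jet (fun t x => ball_depth rho b U t x * (Num.sqrt t)^-1) t x st
    (- (rho * sg)^-1 *: X) (- (N / (rho * sg))).
  have jisg := jet_time_fun x (is_derive_inv (lt0r_neq0 sg0) dsg).
  apply: jet_eq (jet_mul jg jisg) _ _ _; rewrite -/g -[Num.sqrt t]/sg.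
  - by rewrite /st; field; rewrite gt_eqF.
  - by apply/rowP => i; rewrite !mxE; field; rewrite !gt_eqF.
  - by rewrite dot0r; field; rewrite !gt_eqF.
pose E := expR (- s); pose q := dot X X / rho ^+ 2.
pose LE := E * (q / sg ^+ 2 + N / (rho * sg)).
have jE : has_jet (fun t x => expR (- (ball_depth rho b U t x * (Num.sqrt t)^-1))) t x
    (- E * st) ((E / (rho * sg)) *: X) LE.
  apply: jet_eq (jet_expR (jet_opp js)) _ _ _; rewrite -/g -[Num.sqrt t]/sg -/s -/E.
  - ring.
  - by apply/rowP => i; rewrite !mxE; field; rewrite !gt_eqF.
  - by rewrite /LE /q !dotE; field; rewrite !gt_eqF.
pose c := 2 * N / rho; pose m := 1 - c * sg * E.
pose F := g - c * (t * (1 - E)).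
pose Ft := gt - c * (1 - E) - c * t * E * st; pose LF := - (N / rho) + c * t * LE.
have jid := jet_time_fun x (is_derive_id t (1 : R)).
have jF : has_jet (fun t x => ball_depth rho b U t x - (2 * n%:R / rho) *
     (t * (1 - expR (- (ball_depth rho b U t x * (Num.sqrt t)^-1))))) t x Ft (- (m / rho) *: X) LF.
  apply: jet_eq (jet_sub jg (jet_scale c (jet_mul jid (jet_sub (jet_cst 1 t x) jE)))) _ _ _;
    rewrite -/g -[Num.sqrt t]/sg -/s -/E.
  - rewrite /Ft; ring.
  - by apply/rowP => i; rewrite !mxE /m sgt; field; rewrite !gt_eqF.
  - by rewrite /LF !dotE; ring.
pose kap := k0 * expR (- (8 * N / rho) * sg); pose a := kap * t^-1.
pose a' := a * (- (4 * N / (rho * sg)) - t^-1).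
have jk : has_jet (fun t (_ : 'rV[R]_n) => k0 * expR (- (8 * n%:R / rho) * Num.sqrt t) * t^-1) t x a' 0 0.
  have jit := jet_time_fun x (is_derive_inv (lt0r_neq0 t0) (is_derive_id t (1 : R))).
  apply: jet_eq (jet_mul (jet_scale k0 (jet_expR (jet_scale (- (8 * n%:R / rho)) (jet_time_fun x dsg)))) jit) _ _ _;
    rewrite -[Num.ExtraDef.sqrtr t]/sg -/N.
  - by rewrite /a' /a /kap; field; rewrite !gt_eqF.
  - by rewrite !scaler0 addr0.
  - by rewrite !dotE; ring.
pose S := ball_phase rho k0 b U t x.
have jS : has_jet (ball_phase rho k0 b U) t x (a' * F + a * Ft) (- (a * m / rho) *: X) (a * LF).
  apply: jet_eq (jet_mul jk jF) _ _ _; rewrite -/g -[Num.sqrt t]/sg -/N -/c -/s -/E -/F -/kap -/a.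
  - by [].
  - by rewrite scaler0 add0r scalerA; congr (_ *: _); ring.
  - by rewrite !dotE; ring.
have jf := jet_sub (jet_cst 1 t x) (jet_expR (jet_opp jS)); rewrite -/S !sub0r in jf.
do 3 eexists; split; first exact: jf.
rewrite -[Num.sqrt t]/sg -/g => hsg hk0 hk gp.
pose d := dot (x - y) X; pose dr := - d / (rho * t).
rewrite !(dotNl, dotNr, dotZl, dotZr).
set lhs := (X in X <= _).
have -> : lhs = expR (- S) * (a * ((- (4 * N / (rho * sg)) - t^-1) * F +
   m * (gt + dr + N / rho) - c * (1 - E) + c * E * s / 2 - c * E * q + a * m ^+ 2 * q)).
  rewrite /lhs /a' /dr -/d /LF /LE /Ft /F /m /st /q /s sgt; field; rewrite !gt_eqF //.
rewrite mulr_ge0_le0 ?expR_ge0 //.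
have kap0 : 0 <= kap by rewrite mulr_ge0 ?expR_ge0.
have sgr : 4 * sg <= rho.
  apply: le_trans hsg; rewrite ler_wpM2r ?(ltW sg0) // ler_peMr //.
  by rewrite ler1n.
have sgN : 4 * N * sg <= rho.
  apply: le_trans hsg; rewrite ler_wpM2r ?(ltW sg0) // ler_wpM2l //.
  by rewrite ler_nat.
have s0 : 0 <= s by rewrite divr_ge0 // ltW.
have E01 : 0 <= E <= 1 by rewrite expR_ge0 expRN_le1.
have hq : q = 1 - 2 * g / rho.
  by rewrite /q /g /ball_depth -/X; field; rewrite gt_eqF.
have q0 : 0 <= q by rewrite divr_ge0 ?dot_ge0 ?sqr_ge0.
have N0 : 0 <= N by rewrite ler0n.
have c0 : 0 <= c by rewrite divr_ge0 ?mulr_ge0 // ltW.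
have cs : c * sg <= 1.
  by rewrite /c mulrAC ler_pdivrMr // mul1r; apply: le_trans sgN; rewrite ler_wpM2r ?(ltW sg0) // ler_wpM2r //; lra.
have [E0 E1] := andP E01.
have cE : 0 <= c * sg * E <= 1.
  have h : 0 <= c * sg by rewrite mulr_ge0 // ltW.
  by rewrite mulr_ge0 //= -[leRHS]mulr1 ler_pM.
have [m0 m1] : 0 <= m /\ m <= 1 by rewrite /m; lra.
have q1 : q <= 1.
  have : 0 <= 2 * g / rho by apply: divr_ge0; [exact: mulr_ge0|exact: ltW].
  by rewrite hq; lra.
(* Along the drift the depth changes at rate [(g - NN) / t], where [NN] is the depth of [y] at time
   0 plus a square; the term [- NN / t] is what absorbs the squared gradient. *)
pose y0 := y - b; pose NN := (rho ^+ 2 - dot y0 y0) / (2 * rho) + dot (X - y0) (X - y0) / (2 * rho).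
have drE : gt + dr = (g - NN) / t.
  rewrite /gt /dr /g /NN /d /ball_depth -/X.
  have -> : x - y = X - y0 + t *: U by apply/rowP => i; rewrite !mxE; ring.
  have gen (A B : 'rV[R]_n) : dot A U / rho + - dot (A - B + t *: U) A / (rho * t) =
    ((rho ^+ 2 - dot A A) / (2 * rho) - ((rho ^+ 2 - dot B B) / (2 * rho) +
     dot (A - B) (A - B) / (2 * rho))) / t.
    by rewrite !dotE (dotC B A) (dotC U A); field; rewrite !gt_eqF.
  exact: gen.
have kN : kap <= NN.
  apply: (@le_trans _ _ k0).
    rewrite /kap; apply: ler_piMr => //; rewrite mulNr expRN_le1 //.
    apply: mulr_ge0; last exact: ltW.
    by apply: divr_ge0; [exact: mulr_ge0|exact: ltW].
  apply: (le_trans hk); rewrite /ball_depth scale0r addr0 /NN lerDl.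
  by rewrite divr_ge0 ?dot_ge0 // mulr_ge0 // ltW.
have e1 : a * m ^+ 2 * q <= m * (NN / t).
  rewrite /a; have -> : kap * t^-1 * m ^+ 2 * q = m * ((kap * t^-1) * (m * q)) by ring.
  have ti0 : 0 <= t^-1 by rewrite invr_ge0 ltW.
  apply: ler_wpM2l => //; rewrite -[leRHS]mulr1; apply: ler_pM.
  - exact: mulr_ge0.
  - exact: mulr_ge0.
  - exact: ler_wpM2r.
  - exact: mulr_ile1.
have := ball_barrier_ineq (m := m) (F := F) N0 r0 sg0 sgr sgN s0 (_ : g = s * sg) q0 hq (expRN_ge s) E01 _ m1.
move=> /(_ _ _) h; rewrite mulr_ge0_le0 ?(mulr_ge0 kap0) ?invr_ge0 ?(ltW t0) //.
apply: le_trans (h _ _); last 2 first.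
- by rewrite /s divfK // gt_eqF.
- by rewrite /F sgt mulrA.
rewrite drE -/c.
have -> : (- (4 * N / (rho * sg)) - t^-1) * F = - (4 * N / (rho * sg)) * F - g / t + c * (1 - E).
  by rewrite /F; field; rewrite !gt_eqF.
have e2 : m * (g / t) = g / t - c * E * s.
  by rewrite /m /s sgt; field; rewrite gt_eqF.
have -> : m * ((g - NN) / t + N / rho) = m * (g / t) - m * (NN / t) + m * N / rho by ring.
rewrite e2 -/E; clearbody E m F c a; lra.
Qed.

(** The factor [exp (- 2)] bounds [exp (- 8 n sqrt t / rho)] from below; one factor 1/2 is lost
    between the corrected depth and the depth, another in passing from the phase [S] to
    [1 - exp (- S)]. *)
Lemma ball_barrier_ge (rho k0 : R) b U t x : 0 < rho -> 0 < t ->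
  4 * n.+1%:R * Num.sqrt t <= rho -> 0 <= k0 -> 0 <= ball_depth rho b U t x ->
  expR (- 2) / 4 * Num.min 1 (k0 * ball_depth rho b U t x / t) <= ball_barrier rho k0 b U t x.
Proof.
move=> r0 t0 hsg k00; rewrite /ball_barrier /ball_phase; set g := ball_depth _ _ _ _ _ => g0.
set sg := Num.sqrt t in hsg *; pose N : R := n%:R; rewrite -/N.
have sg0 : 0 < sg by rewrite sqrtr_gt0.
have sgt : t = sg ^+ 2 by rewrite sqr_sqrtr // ltW.
have N0 : 0 <= N by rewrite ler0n.
have sgN : 4 * N * sg <= rho.
  apply: le_trans hsg; rewrite ler_wpM2r ?(ltW sg0) // ler_wpM2l //.
  by rewrite ler_nat.
have hF : g / 2 <= g - 2 * N / rho * (t * (1 - expR (- (g * sg^-1)))).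
  have : 2 * N / rho * (t * (1 - expR (- (g * sg^-1)))) <= 2 * N / rho * (t * (g / sg)).
    rewrite ler_wpM2l ?divr_ge0 ?mulr_ge0 ?(ltW r0) // ler_wpM2l ?(ltW t0) //.
    by have := expRN_ge (g / sg); lra.
  have -> : 2 * N / rho * (t * (g / sg)) = (4 * N * sg / rho) * (g / 2).
    by rewrite sgt; field; rewrite !gt_eqF.
  have : 4 * N * sg / rho * (g / 2) <= 1 * (g / 2).
    by apply: ler_wpM2r; [rewrite divr_ge0|rewrite ler_pdivrMr // mul1r].
  lra.
have hk : expR (- 2) <= expR (- (8 * N / rho) * sg).
  rewrite ler_expR mulNr lerN2; have -> : 8 * N / rho * sg = (4 * N * sg / rho) * 2 by field; rewrite gt_eqF.
  by rewrite ler_piMl // ler_pdivrMr // mul1r.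
set S := k0 * _ * _ * _.
have hS : expR (- 2) / 2 * (k0 * g / t) <= S.
  have -> : expR (- 2) / 2 * (k0 * g / t) = (k0 * expR (- 2) / t) * (g / 2) by ring.
  rewrite /S; apply: ler_pM => //.
  - by rewrite divr_ge0 ?mulr_ge0 ?expR_ge0 // ltW.
  - exact: divr_ge0.
  - by apply: ler_wpM2r; [rewrite invr_ge0 ltW|apply: ler_wpM2l].
set Z := k0 * g / t in hS *.
have Z0 : 0 <= Z by apply: divr_ge0; [exact: mulr_ge0|exact: ltW].
have e0 : 0 < expR (- 2) :> R by exact: expR_gt0.
have e1 : expR (- 2) <= 1 :> R by rewrite expRN_le1.
have S0 : 0 <= S by apply: le_trans hS; rewrite mulr_ge0 // divr_ge0 // ltW.
have h1 : expR (- S) * (1 + S) <= 1.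
  rewrite expRN mulrC ler_pdivrMr ?expR_gt0 // mul1r; exact: expR_ge1Dx.
have h2 : expR (- S) <= 1 by rewrite expRN_le1.
have h3 : 0 < expR (- S) by exact: expR_gt0.
have [mZ m1] : Num.min 1 Z <= Z /\ Num.min 1 Z <= 1 by rewrite !ge_min !lexx orbT.
have m0 : 0 <= Num.min 1 Z by rewrite le_min ler01.
have h4 : expR (- 2) / 2 * Num.min 1 Z <= S.
  by apply: le_trans hS; rewrite ler_wpM2l // divr_ge0 // ltW.
have h5 : expR (- 2) / 2 * Num.min 1 Z <= 1 by nra.
set M := expR (- 2) / 2 * Num.min 1 Z in h4 h5.
have -> : expR (- 2) / 4 * Num.min 1 Z = M / 2 by rewrite /M; field.
have M0 : 0 <= M by rewrite mulr_ge0 // divr_ge0 // ltW.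
nra.
Qed.

End BallBarrier.

(** Continuity is asked only at points of [A], the only ones where the compared functions are
    controlled. A cluster point of the filter lies in the superlevel set, since otherwise [f < e] in
    a whole neighbourhood of it. *)
Lemma compact_superlevel (R : realType) (T : topologicalType) (A : set T) (f : T -> R) (e : R) :
  compact A -> (forall p, A p -> {for p, continuous f}) -> compact (A `&` [set p | e <= f p]).
Proof.
move=> cA cf F PF FA.
have FA1 : F A by apply: filterS FA => p [].
have [p [Ap clp]] := cA F PF FA1; exists p; split => //; split => //=.
rewrite leNgt; apply/negP => fpe.
have hn : nbhs p [set q | f q < e] by exact: (cf p Ap _ (lt_nbhsl fpe)).
by have [q [[_ /= h1] /= h2]] := clp _ _ FA hn; move: (le_lt_trans h1 h2); rewrite ltxx.
Qed.

(** * Comparison of the kernel with the moving subsolutions *)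

Section Comparison.
Context {R : realType} {n : nat}.
Implicit Types (t : R) (x y b U : 'rV[R]_n).

Lemma jet_continuous_at f t x ft G L : @has_jet R n f t x ft G L ->
  {for (t, x), continuous (fun p : R * 'rV[R]_n => f p.1 p.2)}.
Proof. by case. Qed.

Lemma compact_enorm_le (r : R) : compact [set x : 'rV[R]_n | enorm x <= r].
Proof.
apply: (@bounded_enorm_compact _ _ _ r) => //.
have -> : [set x : 'rV[R]_n | enorm x <= r] = @enorm R n @^-1` [set s | s <= r] by [].
apply: preimage_closed; last exact: closed_le.
by move=> x _; exact: enorm_continuous.
Qed.

Lemma compact_slab (A : set 'rV[R]_n) (s1 s2 : R) : compact A ->
  compact [set p : R * 'rV[R]_n | s1 <= p.1 <= s2 /\ A p.2].
Proof.
move=> cA.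
have -> : [set p : R * 'rV[R]_n | s1 <= p.1 <= s2 /\ A p.2] = `[s1, s2] `*` A.
  by apply/seteqP; split => p /=; rewrite in_itv.
by apply: compact_setX => //; exact: segment_compact.
Qed.

Lemma compact_moving_ball (rho s1 s2 : R) b U : 0 < rho ->
  compact [set p : R * 'rV[R]_n | s1 <= p.1 <= s2 /\ 0 <= ball_depth rho b U p.1 p.2].
Proof.
move=> r0.
pose C := rho + enorm b + (`|s1| + `|s2|) * enorm U.
have h := compact_superlevel (e := 0) (f := fun p : R * 'rV[R]_n => ball_depth rho b U p.1 p.2)
  (compact_slab (s1 := s1) (s2 := s2) (@compact_enorm_le C)).
rewrite (_ : mkset _ = [set p : R * 'rV[R]_n | s1 <= p.1 <= s2 /\ [set x | enorm x <= C] p.2] `&`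
  [set p | 0 <= ball_depth rho b U p.1 p.2]).
  apply: h => -[s x] _; exact: jet_continuous_at (jet_ball_depth b U s x r0).
apply/seteqP; split => -[s x] /=; last by move=> [[? _] ?].
move=> [hs h0]; do 2 (split => //).
have h1 : enorm (x - (b + s *: U)) <= rho.
  rewrite -(@ler_pXn2r _ 2) ?nnegrE ?enorm_ge0 ?(ltW r0) // enorm_sqr.
  by move: h0; rewrite /ball_depth pmulr_lge0 ?subr_ge0 // invr_gt0 mulr_gt0.
have -> : x = (x - (b + s *: U)) + (b + s *: U) by rewrite subrK.
apply: (le_trans (enormD _ _)); rewrite /C -addrA lerD //.
apply: (le_trans (enormD _ _)); rewrite lerD2l enormZ ler_wpM2r ?enorm_ge0 //.
case/andP: hs => hs1 hs2; have := ler_norm s2; have := ler_norm (- s1); rewrite normrN => h2 h3.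
by rewrite ler_norml; have := normr_ge0 s1; have := normr_ge0 s2; lra.
Qed.

Lemma ball_depth_gt0 (rho : R) b U t x : 0 < rho ->
  (0 < ball_depth rho b U t x) = (enorm (x - (b + t *: U)) < rho).
Proof.
move=> r0; rewrite /ball_depth pmulr_lgt0 ?subr_gt0; last by rewrite invr_gt0 mulr_gt0.
by rewrite -enorm_sqr ltr_pXn2r // ?nnegrE ?enorm_ge0 // ltW.
Qed.

Lemma ball_barrier_le1 (rho k0 : R) b U t x : ball_barrier rho k0 b U t x <= 1.
Proof. by rewrite /ball_barrier gerBl expR_ge0. Qed.

Lemma ball_barrier_eq0 (rho k0 : R) b U t x : ball_depth rho b U t x = 0 ->
  ball_barrier rho k0 b U t x = 0.
Proof.
by move=> h; rewrite /ball_barrier /ball_phase h mul0r oppr0 expR0 subrr !mulr0 subr0 mulr0 oppr0 expR0 subrr.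
Qed.

Lemma open_moving_ball (rho : R) b U : 0 < rho ->
  open [set p : R * 'rV[R]_n | 0 < ball_depth rho b U p.1 p.2].
Proof.
move=> r0; rewrite openE => -[s x] /= h.
have c := jet_continuous_at (jet_ball_depth b U s x r0).
exact: (c _ (lt_nbhsr h)).
Qed.

(* A multiple of [gauss * ball_barrier], supported in a moving ball inside D, stays
   below the kernel (up to a Gaussian error) once it is below it at one time. *)
Lemma ball_barrier_le_pD (D : set 'rV[R]_n) pD y (rho k0 A e c s1 s2 : R) b U z :
  open D -> dirichlet_heat_kernel D pD -> D y ->
  0 < rho -> 0 <= k0 -> k0 <= ball_depth rho b U 0 z -> 0 <= A -> 0 <= e ->
  0 < s1 -> s1 <= s2 -> 0 < s1 + c -> 4 * n.+1%:R * Num.sqrt s2 <= rho ->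
  (forall s x, s1 <= s <= s2 -> 0 < ball_depth rho b U s x -> D x) ->
  (forall x, 0 < ball_depth rho b U s1 x ->
     A * (gauss s1 x z * ball_barrier rho k0 b U s1 x) <= pD (s1 + c) x y + e * gauss (s1 + s1) x z) ->
  forall x, 0 < ball_depth rho b U s2 x ->
    A * (gauss s2 x z * ball_barrier rho k0 b U s2 x) <= pD (s2 + c) x y + e * gauss (s2 + s1) x z.
Proof.
move=> oD hpD Dy r0 k00 hk0 A0 e0 s10 s12 s1c hs2 hD h0 x hx.
pose v s x := A * (gauss s x z * ball_barrier rho k0 b U s x).
pose w s x := v s x - (pD (s + c) x y + e * gauss (s + s1) x z).
rewrite -subr_le0 -/(w s2 x).
pose Om := [set p : R * 'rV[R]_n | 0 < ball_depth rho b U p.1 p.2].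
have jv s x' : 0 < s -> exists vt G L, has_jet v s x' vt G L /\
    (s <= s2 -> 0 <= ball_depth rho b U s x' -> vt <= L).
  move=> ss; have [ft [G [L [jf hf]]]] := jet_ball_barrier k0 b U z x' r0 ss.
  have [wt [G' [L' [jw hw]]]] := jet_gauss_mul z ss jf.
  exists (A * wt), (A *: G'), (A * L'); split; first exact: jet_scale.
  move=> hs hd; rewrite ler_wpM2l // -subr_le0 hw mulr_ge0_le0 ?expR_ge0 //.
  apply: hf => //; apply: le_trans hs2; rewrite ler_wpM2l ?mulr_ge0 ?ler0n //.
  by rewrite ler_wsqrtr.
suff hs : forall s x, s1 <= s <= s2 -> Om (s, x) -> w s x <= 0 by apply: hs => //; rewrite lexx s12.
apply: max_principle; first exact: open_moving_ball.
- move=> e' e'0.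
  (* As [w <= v] and [v] vanishes on the moving sphere, a superlevel set of [w] stays strictly
     inside the ball, hence inside [D], where the kernel is continuous. *)
  pose K1 := [set p : R * 'rV[R]_n | s1 <= p.1 <= s2 /\ 0 <= ball_depth rho b U p.1 p.2]
    `&` [set p | e' <= v p.1 p.2].
  have cK1 : compact K1.
    apply: compact_superlevel; first exact: compact_moving_ball.
    move=> -[s x'] [/= /andP [hs _] _].
    have [vt [G [L [j _]]]] := jv s x' (lt_le_trans s10 hs); exact: jet_continuous_at j.
  have K1Om p : K1 p -> [/\ s1 <= p.1 <= s2, Om p & D p.2].
    move=> [[hs hd] hv]; have hd' : 0 < ball_depth rho b U p.1 p.2.
      rewrite lt_neqAle hd andbT; apply/eqP => h; move: hv.
      by rewrite /= /v ball_barrier_eq0 // !mulr0; move/(lt_le_trans e'0); rewrite ltxx.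
    by split => //; exact: hD hs hd'.
  rewrite (_ : mkset _ = K1 `&` [set p | e' <= w p.1 p.2]).
    apply: compact_superlevel => // -[s x'] /K1Om [/= hs hO Dx].
    have s0 : 0 < s by case/andP: hs => + _; exact: lt_le_trans.
    have sc : 0 < s + c by case/andP: hs => h _; lra.
    have [vt [G [L [j _]]]] := jv s x' s0.
    have [Gp [Lp jp]] := jet_pD oD hpD sc Dx Dy.
    have ss1 : 0 < s + s1 by rewrite addr_gt0.
    exact: jet_continuous_at (jet_sub j (jet_add (jet_shift jp) (jet_scale e (jet_shift (jet_gauss x' z ss1))))).
  apply/seteqP; split => -[s x'] /=.
    move=> [hs hO hw]; do 2 (split => //=); last first.
      apply: (le_trans hw); rewrite /w gerBl addr_ge0 ?mulr_ge0 ?expR_ge0 //.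
      apply: (pD_ge0 hpD) => //; last exact: hD hs hO.
      by case/andP: hs => h _; lra.
    by split => //; exact: ltW.
  by move=> [h1 h2]; have [h3 h4 _] := K1Om _ h1.
- by move=> x' hx'; rewrite subr_le0; exact: h0.
- move=> s x' hs hO _.
  have s0 : 0 < s by case/andP: hs => + _; exact: lt_le_trans.
  have sc : 0 < s + c by case/andP: hs => h _; lra.
  have ss1 : 0 < s + s1 by rewrite addr_gt0.
  have [vt [G [L [j hv]]]] := jv s x' s0.
  have [Gp [Lp jp]] := jet_pD oD hpD sc (hD _ _ hs hO) Dy.
  do 3 eexists; split.
    exact: (jet_sub j (jet_add (jet_shift jp) (jet_scale e (jet_shift (jet_gauss x' z ss1))))).
  by rewrite lerD2r hv //; [case/andP: hs|exact: ltW].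
Qed.

End Comparison.

(** * Initial mass of the kernel *)

Section IterIntegral.
Context {R : realType}.
Local Notation mu := (@lebesgue_measure R).

(** Measurability of [f] is not at hand for partial integrals of the kernel. For nonnegative
    functions the integral is a supremum over simple functions below, hence monotone, and the finite
    bound makes [fine] harmless. *)
Lemma Rintegral_between (f g : R -> R) : (forall x, 0 <= f x <= g x) ->
  mu.-integrable setT (EFin \o g) ->
  0 <= \int[mu]_x f x <= \int[mu]_x g x.
Proof.
move=> fg ig.
have f0 x : (0 <= (f x)%:E)%E by rewrite lee_fin; case/andP: (fg x).
have g0 x : (0 <= (g x)%:E)%E by rewrite lee_fin; case/andP: (fg x) => h1 h2; exact: le_trans h2.
have If : (0 <= \int[mu]_x (f x)%:E)%E by apply: integral_ge0.
have Ifg : (\int[mu]_x (f x)%:E <= \int[mu]_x (g x)%:E)%E.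
  rewrite !ge0_integralTE //; apply: ereal_sup_le => _ [h /= hf <-]; exists h => // x.
  by apply: le_trans (hf x) _; rewrite lee_fin; case/andP: (fg x).
have Ig : (\int[mu]_x (g x)%:E)%E \is a fin_num by exact: integrable_fin_num.
have If' : (\int[mu]_x (f x)%:E)%E \is a fin_num.
  rewrite ge0_fin_numE //; apply: le_lt_trans Ifg _.
  by move: Ig; rewrite ge0_fin_numE //; apply: integral_ge0.
by rewrite /Rintegral fine_ge0 //= fine_le.
Qed.

Lemma row_mx_ord0 n (s : R) (v : 'rV[R]_n) :
  (row_mx (const_mx s : 'rV[R]_1) v : 'rV[R]_n.+1) 0 ord0 = s.
Proof.
have h := row_mxEl (const_mx s : 'rV[R]_1) v 0 0; rewrite [RHS]mxE in h.
by rewrite -[RHS]h; congr (row_mx _ _ _ _); exact: val_inj.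
Qed.

Lemma row_mx_lift n (s : R) (v : 'rV[R]_n) i :
  (row_mx (const_mx s : 'rV[R]_1) v : 'rV[R]_n.+1) 0 (lift ord0 i) = v 0 i.
Proof.
have h := row_mxEr (const_mx s : 'rV[R]_1) v 0 i.
by rewrite -[RHS]h; congr (row_mx _ _ _ _); exact: val_inj.
Qed.

(** A difference of two products keeps its form when all coordinates but one are integrated out,
    only the scalars [al] and [be] change; this is what the induction on [n] propagates. *)
Lemma iter_integral_between n (al be : R) (a b : 'I_n -> R -> R) (f : 'rV[R]_n -> R) :
  (forall i, mu.-integrable setT (EFin \o a i)) ->
  (forall i, mu.-integrable setT (EFin \o b i)) ->
  (forall v, 0 <= f v <= al * \prod_i a i (v 0 i) - be * \prod_i b i (v 0 i)) ->
  0 <= iter_integral f <= al * \prod_i (\int[mu]_s a i s) - be * \prod_i (\int[mu]_s b i s).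
Proof.
elim: n al be a b f => [|n IH] al be a b f ia ib hf.
  by have := hf 0; rewrite !big_ord0.
rewrite !big_ord_recl /=.
pose A := \prod_(i < n) (\int[mu]_s a (lift ord0 i) s).
pose B := \prod_(i < n) (\int[mu]_s b (lift ord0 i) s).
have hs s : 0 <= iter_integral (fun v : 'rV[R]_n => f (row_mx (const_mx s : 'rV[R]_1) v))
    <= (al * A) * a ord0 s - (be * B) * b ord0 s.
  have := IH (al * a ord0 s) (be * b ord0 s) (fun i => a (lift ord0 i)) (fun i => b (lift ord0 i))
    (fun v : 'rV[R]_n => f (row_mx (const_mx s : 'rV[R]_1) v)).
  rewrite -/A -/B (mulrAC al) (mulrAC be); apply => // v.
  have := hf (row_mx (const_mx s : 'rV[R]_1) v); rewrite !big_ord_recl !row_mx_ord0.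
  rewrite (eq_bigr (fun i => a (lift ord0 i) (v 0 i))); last by move=> i _; congr (a _ _); exact: row_mx_lift.
  rewrite [X in be * (_ * X)](eq_bigr (fun i => b (lift ord0 i) (v 0 i))); last by move=> i _; congr (b _ _); exact: row_mx_lift.
  by rewrite !mulrA.
have i1 : mu.-integrable setT (EFin \o (fun s => (al * A) * a ord0 s)).
  exact: (integrableZl measurableT (al * A) (ia ord0)).
have i2 : mu.-integrable setT (EFin \o (fun s => (be * B) * b ord0 s)).
  exact: (integrableZl measurableT (be * B) (ib ord0)).
have := Rintegral_between hs _; rewrite RintegralB // !RintegralZl //.
have -> : al * (\int[mu]_s a ord0 s * A) = al * A * \int[mu]_s a ord0 s by ring.
have -> : be * (\int[mu]_s b ord0 s * B) = be * B * \int[mu]_s b ord0 s by ring.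
apply; exact: (integrableB measurableT i1 i2).
Qed.

Lemma gauss_prod n (t : R) (x y : 'rV[R]_n) : 0 < t ->
  gauss t x y = \prod_i normal_pdf (y 0 i) (Num.sqrt (2 * t)) (x 0 i).
Proof.
move=> t0; have s0 : 0 < Num.sqrt (2 * t) by rewrite sqrtr_gt0 mulr_gt0.
have p0 : 0 < 4 * pi * t by rewrite !mulr_gt0 ?pi_gt0.
have e i : normal_pdf (y 0 i) (Num.sqrt (2 * t)) (x 0 i) =
    expR (- (2^-1 * ln (4 * pi * t)) + - ((x - y) 0 i * (x - y) 0 i * (4 * t)^-1)).
  rewrite normal_pdfE ?gt_eqF // /normal_peak /normal_fun sqr_sqrtr ?mulr_ge0 ?(ltW t0) //.
  rewrite expRD; congr (_ * expR _).
    rewrite expRN -powR12_sqrt; last first.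
      by rewrite -mulr_natl mulr_ge0 // !mulr_ge0 ?pi_ge0 ?(ltW t0).
    rewrite /powR gt_eqF; last by rewrite -mulr_natl mulr_gt0 // !mulr_gt0 ?pi_gt0.
    by congr ((expR (_ * ln _))^-1); rewrite -mulr_natl; ring.
  by rewrite !mxE expr2; field; rewrite gt_eqF.
under eq_bigr do rewrite e.
rewrite -expR_sum /gauss big_split /=; congr expR; congr (_ + _).
  by rewrite sumr_const card_ord -mulr_natl; field.
by rewrite sumrN /dot big_distrl.
Qed.

(** The Gaussian has mass 1, and a deficit [be] on a cube costs [be] times its volume. A cube rather
    than a ball, because its indicator is a product of indicators of intervals, as
    [iter_integral_between] requires. *)
Lemma iter_integral_gauss_minus_cube n (t be k : R) (x y : 'rV[R]_n) (f : 'rV[R]_n -> R) :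
  0 < t -> 0 < k -> (forall v, 0 <= f v <= gauss t v y) ->
  (forall v : 'rV[R]_n, (forall i, `|v 0 i - x 0 i| <= k) -> f v <= gauss t v y - be) ->
  iter_integral f <= 1 - be * (2 * k) ^+ n.
Proof.
move=> t0 k0 f1 f2.
have := @iter_integral_between n 1 be (fun i => normal_pdf (y 0 i) (Num.sqrt (2 * t)))
  (fun i => \1_`[x 0 i - k, x 0 i + k]) f _ _ _.
have -> : \prod_(i < n) (\int[mu]_s normal_pdf (y 0 i) (Num.sqrt (2 * t)) s) = 1.
  by rewrite big1 // => i _; rewrite /Rintegral integral_normal_pdf.
have -> : \prod_(i < n) (\int[mu]_s \1_`[x 0 i - k, x 0 i + k] s) = (2 * k) ^+ n.
  rewrite (eq_bigr (fun=> 2 * k)); first by rewrite prodr_const card_ord.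
  move=> i _; rewrite /Rintegral integral_indic // setIT.
  have h := @lebesgue_measure_itv R `[x 0 i - k, x 0 i + k].
  rewrite [X in fine X](_ : _ = (2 * k)%:E) //; apply: etrans h _.
  rewrite /= lte_fin ifT; last by lra.
  by rewrite -EFinB; congr EFin; ring.
move=> h; suff /andP [_] : 0 <= iter_integral f <= 1 * 1 - be * (2 * k) ^+ n by rewrite mul1r.
apply: h.
- by move=> i; exact: integrable_normal_pdf.
- by move=> i; exact: integrable_indic_itv.
- move=> v; rewrite mul1r -gauss_prod //; have /andP [v1 v2] := f1 v; rewrite v1 /=.
  have [hv|hv] := pselect (forall i, `|v 0 i - x 0 i| <= k).
    rewrite big1 ?mulr1; first exact: f2.
    move=> i _; rewrite indicE mem_set //= in_itv /=.
    by have := hv i; rewrite ler_norml; lra.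
  suff -> : \prod_(i < n) (\1_`[x 0 i - k, x 0 i + k] (v 0 i)) = 0 :> R by rewrite mulr0 subr0.
  move/existsNP: hv => [i hi]; rewrite (bigD1 i) //= indicE memNset ?mul0r //=.
  by rewrite in_itv /=; move=> hi'; apply: hi; rewrite ler_norml; lra.
Qed.

End IterIntegral.

(** * Interior Lipschitz estimate by reflection *)

Section Reflection.
Context {R : realType} {n : nat}.
Implicit Types (t : R) (x : 'rV[R]_n).

Definition reflect_coord (i : 'I_n) (x0 x : 'rV[R]_n) : 'rV[R]_n :=
  x - (2 * (x - x0) 0 i) *: basis_vec R i.

Lemma jet_reflect (f : R -> 'rV[R]_n -> R) i x0 t x ft G L :
  has_jet f t (reflect_coord i x0 x) ft G L ->
  exists G', has_jet (fun t x => f t (reflect_coord i x0 x)) t x ft G' L.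
Proof.
case=> cf tf [H [-> hf]].
pose sg (j : 'I_n) : R := if j == i then -1 else 1.
have sg2 j : sg j * sg j = 1 by rewrite /sg; case: ifP; rewrite ?mulrNN mulr1.
have line j s : reflect_coord i x0 (x + s *: basis_vec R j) =
    reflect_coord i x0 x + (sg j * s) *: basis_vec R j.
  apply/rowP => k; rewrite /reflect_coord /sg !mxE eqxx /=.
  have [->|ji] := eqVneq j i; last by rewrite ?(eq_sym i j) ?(negbTE ji) /=; ring.
  by case: (k == i) => /=; ring.
exists (\row_j (sg j * G 0 j)); split => //.
- apply: (@continuous_comp _ _ _ (fun p : R * 'rV[R]_n => (p.1, reflect_coord i x0 p.2))
    (fun p => f p.1 p.2)) => //.
  have h1 : p.1 @[p --> nbhs (t, x)] --> t by exact: cvg_fst.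
  have h2 : p.2 @[p --> nbhs (t, x)] --> x by exact: cvg_snd.
  suff h3 : reflect_coord i x0 p.2 @[p --> nbhs (t, x)] --> reflect_coord i x0 x by exact: cvg_pair h1 h3.
  apply: (cvgB h2); apply: cvgZ; last exact: cvg_cst.
  apply: cvgMr; have -> : (x - x0) 0 i = dot (x - x0) (basis_vec R i) by rewrite dotC dot_basis_vec.
  rewrite (_ : (fun p => _) = fun p : R * 'rV[R]_n => dot p.2 (basis_vec R i) - dot x0 (basis_vec R i)); last first.
    by apply/funext => p; rewrite -dotBl dotC dot_basis_vec.
  rewrite dotBl; apply: cvgB; last exact: cvg_cst.
  apply: (@cvg_comp _ _ _ (fun p : R * 'rV[R]_n => p.2) (fun x => dot x (basis_vec R i)) _ _ _ h2).
  exact: dot_continuous.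
exists H; split => // j; have [d [f1 f2 f3]] := hf j.
have lin s : is_derive s (1 : R) (fun s : R => sg j * s) (sg j).
  have h := is_derive_line 0 (sg j) s.
  by move: h; rewrite (_ : (fun s => _) = fun s => sg j * s) //; apply/funext => u; rewrite add0r mulrC.
exists (fun s => sg j * d (sg j * s)); split.
- have c : {for 0, continuous (fun s : R => sg j * s)} := is_derive1_continuous (lin 0).
  have f1' : \forall s \near (0 : R), is_derive (sg j * s) (1 : R)
      (fun s => f t (reflect_coord i x0 x + s *: basis_vec R j)) (d (sg j * s)).
    have e0 : sg j * 0 = 0 by rewrite mulr0.
    by rewrite -e0 in f1; exact: (c _ f1).
  near=> s; have h : is_derive (sg j * s) (1 : R)
      (fun s => f t (reflect_coord i x0 x + s *: basis_vec R j)) (d (sg j * s)) by near: s.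
  have := is_derive1_comp h (lin s); rewrite mulrC.
  by congr is_derive; apply/funext => u /=; rewrite line.
- by rewrite !mulr0 mxE f2.
- have h : is_derive (sg j * 0) (1 : R) d (H j) by rewrite mulr0.
  have := is_deriveM (is_derive_cst (sg j) (0 : R) (1 : R)) (is_derive1_comp h (lin 0)).
  by move=> h'; apply: is_derive_eq h' _; rewrite /GRing.scale /= mulr0 addr0 mulrCA sg2 mulr1.
Unshelve. all: end_near. Qed.

Lemma reflect_coord_id i x0 x : (x - x0) 0 i = 0 -> reflect_coord i x0 x = x.
Proof. by rewrite /reflect_coord => ->; rewrite mulr0 scale0r subr0. Qed.

Lemma enorm_reflect i x0 x : enorm (reflect_coord i x0 x - x0) = enorm (x - x0).
Proof.
rewrite /enorm; congr Num.sqrt.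
have -> : reflect_coord i x0 x - x0 = (x - x0) - (2 * (x - x0) 0 i) *: basis_vec R i.
  by rewrite /reflect_coord addrAC.
move: (x - x0) => z; rewrite !dotBl !dotBr !dotZl !dotZr (dotC z) !dot_basis_vec.
by rewrite [basis_vec R i 0 i]mxE !eqxx /=; ring.
Qed.

Lemma barrier_quadratic_ge (rho z N X2 tt : R) : 0 < rho -> 0 <= z <= rho -> 0 <= N ->
  0 <= X2 -> 0 <= tt -> 0 <= N * (2 * z / rho - z ^+ 2 / rho ^+ 2) /\
  (rho ^+ 2 <= X2 + tt -> 1 <= N * (2 * z / rho - z ^+ 2 / rho ^+ 2) + X2 / rho ^+ 2 + tt / rho ^+ 2).
Proof.
move=> r0 /andP [z0 zr] N0 X0 t0.
have h : 0 <= 2 * z / rho - z ^+ 2 / rho ^+ 2.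
  have -> : 2 * z / rho - z ^+ 2 / rho ^+ 2 = (z * (2 * rho - z)) / rho ^+ 2 by field; rewrite gt_eqF.
  by rewrite divr_ge0 ?sqr_ge0 // mulr_ge0 //; lra.
split; first exact: mulr_ge0.
move=> h1; rewrite -addrA -mulrDl; apply: ler_wpDl; first exact: mulr_ge0.
by rewrite ler_pdivlMr ?mul1r // exprn_gt0.
Qed.

(* Reflecting in a coordinate makes u(x) - u(x') a solution vanishing on the
   hyperplane of symmetry, where a quadratic barrier controls it linearly. *)
Lemma reflect_lipschitz (r : R -> 'rV[R]_n -> R) (A rho s : R) x0 i :
  0 < rho ->
  (forall t x, s - rho ^+ 2 <= t <= s -> enorm (x - x0) <= rho -> 0 <= r t x <= A /\
     exists G L, has_jet r t x L G L) ->
  forall h, 0 < h < rho ->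
  r s (x0 + h *: basis_vec R i) - r s (x0 - h *: basis_vec R i) <= A * (2 * n.+1%:R * h / rho).
Proof.
move=> r0 hr h /andP [h0 hrho].
have A0 : 0 <= A.
  have [] := hr s x0; rewrite ?subrr ?enorm0 ?(ltW r0) //.
    by rewrite lexx andbT gerBl sqr_ge0.
  by case/andP => h1 h2 _; exact: le_trans h2.
pose N : R := n.+1%:R; have N0 : 0 <= N by rewrite ler0n.
pose ei := basis_vec R i; pose z x := dot x ei - dot x0 ei.
have zE x : z x = (x - x0) 0 i by rewrite /z -dotBl dotC dot_basis_vec.
pose X2 t x := dot (x - (x0 + t *: 0)) (x - (x0 + t *: 0)).
have X2E t x : X2 t x = enorm (x - x0) ^+ 2 by rewrite /X2 scaler0 addr0 enorm_sqr.
(* With [N = n + 1] the concave term in [z] contributes [- 2 (n + 1) / rho ^ 2] to the Laplacian,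
   against [2 n / rho ^ 2] from [X2], while the time derivative is [- 1 / rho ^ 2]; so [B] is a
   strict supersolution, up to the factor [A]. The last two terms make [B >= A] on the sphere and at
   the initial time. *)
pose B t x := A * (N * (2 / rho * z x - (rho ^+ 2)^-1 * (z x * z x)) + (rho ^+ 2)^-1 * X2 t x + (rho ^+ 2)^-1 * (s - t)).
pose w t x := r t x - r t (reflect_coord i x0 x) - B t x.
pose a := s - rho ^+ 2.
have depthE t x : 0 <= ball_depth rho x0 0 t x -> enorm (x - x0) <= rho.
  rewrite /ball_depth scaler0 addr0 pmulr_lge0 ?subr_ge0; last by rewrite invr_gt0 mulr_gt0.
  by rewrite -enorm_sqr ler_pXn2r // ?nnegrE ?enorm_ge0 // ltW.
have bound t x : a <= t <= s -> 0 <= ball_depth rho x0 0 t x -> 0 <= z x ->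
   (z x = 0 \/ ball_depth rho x0 0 t x = 0 \/ t = a) -> w t x <= 0.
  move=> ts /depthE hx zx hc.
  have zr : 0 <= z x <= rho.
    rewrite zx /= (le_trans _ hx) //; apply: le_trans (coord_le_enorm (x - x0) i).
    by rewrite zE ler_norm.
  have st : 0 <= s - t by rewrite subr_ge0; case/andP: ts.
  have [b1 b2] := barrier_quadratic_ge r0 zr N0 (sqr_ge0 (enorm (x - x0))) st.
  have BE : B t x = A * (N * (2 * z x / rho - z x ^+ 2 / rho ^+ 2) + enorm (x - x0) ^+ 2 / rho ^+ 2 + (s - t) / rho ^+ 2).
    by rewrite /B X2E; field; rewrite gt_eqF.
  have B0 : 0 <= B t x.
    rewrite BE mulr_ge0 // !addr_ge0 // divr_ge0 ?sqr_ge0 //.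
  case: hc => [hz|hc].
    by rewrite /w reflect_coord_id -?zE // subrr sub0r oppr_le0.
  have hB : A <= B t x.
    rewrite BE -[leLHS]mulr1 ler_wpM2l // b2 //.
    case: hc => [hd|->]; last by have := sqr_ge0 (enorm (x - x0)); rewrite /a; lra.
    move: hd; rewrite /ball_depth scaler0 addr0 -enorm_sqr => /eqP; rewrite mulf_eq0 invr_eq0.
    rewrite [2 * rho == 0]gt_eqF ?mulr_gt0 // orbF subr_eq0 => /eqP <-; rewrite lerDl //.
  have [/andP [_ h1] _] := hr t x ts hx.
  have hx' : enorm (reflect_coord i x0 x - x0) <= rho by rewrite enorm_reflect.
  have [/andP [h2 _] _] := hr t _ ts hx'.
  by rewrite /w; lra.
have jw t x : a <= t <= s -> enorm (x - x0) <= rho ->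
   exists wt G L, has_jet w t x wt G L /\ wt <= L.
  move=> ts hx; have [_ [G [L j1]]] := hr t x ts hx.
  have hx' : enorm (reflect_coord i x0 x - x0) <= rho by rewrite enorm_reflect.
  have [_ [G' [L' /(@jet_reflect _ _ _ _ _) j2]]] := hr t _ ts hx'; case: j2 => G'' j2.
  have jz := jet_sub (jet_dot ei t x) (jet_cst (dot x0 ei) t x).
  have jq := jet_sub (jet_scale (2 / rho) jz) (jet_scale (rho ^+ 2)^-1 (jet_mul jz jz)).
  have jt := jet_sub (jet_cst s t x) (jet_time_fun x (is_derive_id t (1 : R))).
  have jB := jet_scale A (jet_add (jet_add (jet_scale N jq) (jet_scale (rho ^+ 2)^-1 (jet_sqdist x0 0 t x)))
    (jet_scale (rho ^+ 2)^-1 jt)).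
  have jj := jet_sub (jet_sub j1 j2) jB.
  do 3 eexists; split; first exact: jj.
  rewrite -subr_ge0 !subr0 !dot0r.
  have e1 : dot ei ei = 1 by rewrite dot_basis_vec mxE !eqxx.
  rewrite e1.
  set lhs := (X in 0 <= X); have -> : lhs = A / rho ^+ 2.
    by rewrite /lhs /N -natr1; field; rewrite gt_eqF.
  by rewrite divr_ge0 // sqr_ge0.
pose Om := [set p : R * 'rV[R]_n | 0 < ball_depth rho x0 0 p.1 p.2] `&` [set p | 0 < z p.2].
have oOm : open Om.
  apply: openI; first exact: open_moving_ball.
  rewrite openE => -[t x] /= hz.
  have c := jet_continuous_at (jet_sub (jet_dot ei t x) (jet_cst (dot x0 ei) t x)).
  exact: (c _ (lt_nbhsr hz)).
have main : forall t x, a <= t <= s -> Om (t, x) -> w t x <= 0.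
  apply: (max_principle oOm) => [e e0|x [hd hz]|t x ts [hd hz] _].
  - have cK : compact ([set p : R * 'rV[R]_n | a <= p.1 <= s /\ 0 <= ball_depth rho x0 0 p.1 p.2] `&` [set p | 0 <= z p.2]).
      apply: compact_superlevel; first exact: compact_moving_ball.
      move=> [t x] _; exact: jet_continuous_at (jet_sub (jet_dot ei t x) (jet_cst (dot x0 ei) t x)).
    rewrite (_ : mkset _ = ([set p : R * 'rV[R]_n | a <= p.1 <= s /\ 0 <= ball_depth rho x0 0 p.1 p.2] `&` [set p | 0 <= z p.2])
      `&` [set p | e <= w p.1 p.2]).
      apply: compact_superlevel => // -[t x] [[/= ts hd] _].
      by have [? [? [? [j _]]]] := jw t x ts (depthE _ _ hd); exact: jet_continuous_at j.
    apply/seteqP; split => -[t x] /=.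
      by move=> [ts [hd hz] hw]; split => //; split; [split => //|]; exact: ltW.
    move=> [[[ts hd] hz] hw]; split => //; split => /=; rewrite lt_neqAle ?hd ?hz andbT; apply/eqP => e1.
      by have := bound t x ts hd hz (or_intror (or_introl (esym e1))); lra.
    by have := bound t x ts hd hz (or_introl (esym e1)); lra.
  - apply: bound; rewrite ?(ltW hd) ?(ltW hz) //; last by right; right.
    by rewrite lexx /= /a gerBl sqr_ge0.
  - by apply: jw => //; apply: depthE (ltW hd).
pose x := x0 + h *: ei.
have zx : z x = h by rewrite zE /x addrC addKr mxE [basis_vec R i 0 i]mxE !eqxx mulr1.
have nx : enorm (x - x0) = h.
  by rewrite /x addrC addKr enormZ /enorm dot_basis_vec mxE !eqxx sqrtr1 mulr1 gtr0_norm.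
have hd : 0 < ball_depth rho x0 0 s x by rewrite ball_depth_gt0 // scaler0 addr0 nx.
have xr : reflect_coord i x0 x = x0 - h *: ei.
  rewrite /reflect_coord -zE zx /x -/ei -addrA -scalerBl; congr (_ + _).
  by apply/rowP => k; rewrite !mxE; ring.
have Bx : B s x <= A * (2 * N * h / rho).
  rewrite /B X2E nx zx subrr mulr0 addr0 ler_wpM2l //.
  have -> : N * (2 / rho * h - (rho ^+ 2)^-1 * (h * h)) + (rho ^+ 2)^-1 * h ^+ 2 = 2 * N * h / rho - (N - 1) * (h ^+ 2 / rho ^+ 2).
    by field; rewrite gt_eqF.
  rewrite gerBl mulr_ge0 ?divr_ge0 ?sqr_ge0 // subr_ge0 /N ler1n //.
have as' : a <= s <= s by rewrite lexx andbT /a gerBl sqr_ge0.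
have Os : Om (s, x) by split => //=; rewrite zx.
by have := main s x as' Os; rewrite /w xr -/x -/ei; lra.
Qed.

Lemma coord_step (r : R -> 'rV[R]_n -> R) (A rho s : R) (p q : 'rV[R]_n) i :
  0 < rho ->
  (forall t x, s - rho ^+ 2 <= t <= s -> enorm (x - 2^-1 *: (p + q)) <= rho -> 0 <= r t x <= A /\
     exists G L, has_jet r t x L G L) ->
  (forall j, j != i -> p 0 j = q 0 j) -> `|p 0 i - q 0 i| < 2 * rho ->
  r s p - r s q <= A * (n.+1%:R * `|p 0 i - q 0 i| / rho).
Proof.
move=> r0 hr hpq hd.
have A0 : 0 <= A.
  have [] := hr s (2^-1 *: (p + q)); rewrite ?subrr ?enorm0 ?(ltW r0) //.
    by rewrite lexx andbT gerBl sqr_ge0.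
  by case/andP => h1 h2 _; exact: le_trans h2.
have eqn (h : R) : h = (p 0 i - q 0 i) / 2 ->
    p = 2^-1 *: (p + q) + h *: basis_vec R i /\ q = 2^-1 *: (p + q) - h *: basis_vec R i.
  move=> hE; split; apply/rowP => j; rewrite !mxE eqxx /=;
    (have [->|ji] := eqVneq j i; [by rewrite hE /=; field|by rewrite (hpq j ji) /=; field]).
have [e|ne] := eqVneq (p 0 i) (q 0 i).
  rewrite e subrr normr0 mulr0 mul0r mulr0 (_ : p = q) ?subrr //.
  by apply/rowP => j; have [->|/hpq] := eqVneq j i.
have [h0|h0] := ltP 0 (p 0 i - q 0 i).
  have [e1 e2] := eqn _ erefl; rewrite gtr0_norm // in hd *.
  have := reflect_lipschitz i r0 hr (h := (p 0 i - q 0 i) / 2).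
  rewrite -e1 -e2; have -> : 0 < (p 0 i - q 0 i) / 2 < rho by lra.
  by move=> /(_ isT); congr (_ <= A * (_ / _)); field.
have {}h0 : p 0 i - q 0 i < 0 by rewrite lt_neqAle h0 subr_eq0 ne.
have [e1 e2] := eqn _ erefl; rewrite ltr0_norm // in hd *.
(* In the opposite direction the estimate is applied to [A - r], which satisfies the same
   hypotheses. *)
have hr' t x : s - rho ^+ 2 <= t <= s -> enorm (x - 2^-1 *: (p + q)) <= rho -> 0 <= A - r t x <= A /\
     exists G L, has_jet (fun t x => A - r t x) t x L G L.
  move=> ts hx; have [/andP [h1 h2] [G [L j]]] := hr t x ts hx; split; first by lra.
  by exists (0 - G), (0 - L); exact: jet_sub (jet_cst A t x) j.
have := reflect_lipschitz i r0 hr' (h := - ((p 0 i - q 0 i) / 2)).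
rewrite scaleNr opprK -e1 -e2; have -> : 0 < - ((p 0 i - q 0 i) / 2) < rho by lra.
move=> /(_ isT); have -> : A - r s q - (A - r s p) = r s p - r s q by ring.
by congr (_ <= A * (_ / _)); field.
Qed.

Lemma enorm_le_coord (x : 'rV[R]_n) (k : R) : 0 <= k -> (forall i, `|x 0 i| <= k) ->
  enorm x <= n%:R * k.
Proof.
by move=> k0 h; apply: (le_trans (enorm_le_norm x)); rewrite ler_wpM2l // norm_le_coord.
Qed.

(** Coordinates are changed one at a time, since the reflection argument only compares points that
    are symmetric in a coordinate direction. *)
Lemma cube_lipschitz (r : R -> 'rV[R]_n -> R) (A rho s k : R) (x v : 'rV[R]_n) :
  0 < rho -> 0 <= k < 2 * rho ->
  (forall t z, s - rho ^+ 2 <= t <= s -> enorm (z - x) <= rho + n%:R * k -> 0 <= r t z <= A /\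
     exists G L, has_jet r t z L G L) ->
  (forall i, `|v 0 i - x 0 i| <= k) ->
  r s x - r s v <= n%:R * (A * (n.+1%:R * k / rho)).
Proof.
move=> r0 /andP [k0 kr] hr hv.
have A0 : 0 <= A.
  have [] := hr s x; rewrite ?subrr ?enorm0 ?addr_ge0 ?mulr_ge0 ?ler0n ?(ltW r0) //.
    by rewrite lexx andbT gerBl sqr_ge0.
  by case/andP => h1 h2 _; exact: le_trans h2.
pose P m : 'rV[R]_n := \row_j (if (j < m)%N then v 0 j else x 0 j).
have P0 : P 0%N = x by apply/rowP => j; rewrite mxE.
have Pn : P n = v by apply/rowP => j; rewrite mxE ltn_ord.
suff : forall m, (m <= n)%N -> r s x - r s (P m) <= m%:R * (A * (n.+1%:R * k / rho)).
  by move=> /(_ n (leqnn n)); rewrite Pn.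
elim=> [|m IH] mn; first by rewrite P0 subrr mul0r.
have {}IH := IH (ltnW mn).
suff : r s (P m) - r s (P m.+1) <= A * (n.+1%:R * k / rho).
  by rewrite -natr1 mulrDl mul1r; lra.
pose i := Ordinal mn.
have Pmi : P m 0 i = x 0 i by rewrite mxE ltnn.
have Pmi' : P m.+1 0 i = v 0 i by rewrite mxE ltnSn.
have hk : `|P m 0 i - P m.+1 0 i| <= k by rewrite Pmi Pmi' distrC.
apply: (@le_trans _ _ (A * (n.+1%:R * `|P m 0 i - P m.+1 0 i| / rho))); last first.
  apply: ler_wpM2l => //; apply: ler_wpM2r; first by rewrite invr_ge0 ltW.
  exact: ler_wpM2l.
apply: coord_step => //; last exact: le_lt_trans kr.
- move=> t z ts hz; apply: hr => //.
  apply: (le_trans (enorm_triangle (2^-1 *: (P m + P m.+1)) _ _)); rewrite lerD //.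
  apply: enorm_le_coord => // j; rewrite !mxE.
  have := hv j; rewrite !ler_norml => /andP [h1 h2].
  by case: ifP => _; case: ifP => _; lra.
- move=> j ji; rewrite !mxE ltnS [(j <= m)%N]leq_eqVlt.
  have -> : (val j == m) = false by apply/negbTE; apply: contra ji => /eqP jm; apply/eqP/val_inj.
  by [].
Qed.

End Reflection.

Lemma clamp_lipschitz (R : realType) (a b : R) :
  `|Num.max 0 (Num.min 1 a) - Num.max 0 (Num.min 1 b)| <= `|a - b|.
Proof.
rewrite !minElt !maxElt ler_norml; have := ler_norm (a - b); have := ler_norm (b - a).
rewrite (distrC b); case: (ltP 1 a); case: (ltP 1 b) => h1 h2;
  rewrite ?ltr01; do ?[case: ifP]; lra.
Qed.

(** * Pointwise comparison with the Gaussian at small times *)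

Section InitialMass.
Context {R : realType} {n : nat} (D : set 'rV[R]_n) (pD : R -> 'rV[R]_n -> 'rV[R]_n -> R).
Hypotheses (oD : open D) (hpD : dirichlet_heat_kernel D pD).
Implicit Types (t s : R) (x y : 'rV[R]_n).

Definition peak t : R := expR (- (n%:R / 2) * ln (4 * pi * t)).

Lemma gaussE t x y : gauss t x y = peak t * expR (- (dot (x - y) (x - y) * (4 * t)^-1)).
Proof. by rewrite /gauss expRD. Qed.

Lemma peak_gt0 t : 0 < peak t. Proof. exact: expR_gt0. Qed.

Lemma peakM (a t : R) : 0 < a -> 0 < t -> peak (a * t) = expR (- (n%:R / 2) * ln a) * peak t.
Proof.
move=> a0 t0; have p0 := @pi_gt0 R; rewrite /peak -expRD -mulrDr; congr (expR (_ * _)).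
by rewrite -lnM ?posrE ?mulr_gt0 //; congr ln; ring.
Qed.

Lemma le_peak s t : 0 < s -> s <= t -> peak t <= peak s.
Proof.
move=> s0 st; have t0 := lt_le_trans s0 st.
rewrite ler_expR !mulNr lerN2 ler_wpM2l ?divr_ge0 // ler_ln ?posrE ?mulr_gt0 ?pi_gt0 //.
by rewrite ler_wpM2l // mulr_ge0 // pi_ge0.
Qed.

Lemma gauss_le_peak t x y : 0 < t -> gauss t x y <= peak t.
Proof.
move=> t0; rewrite gaussE ler_piMr ?(ltW (peak_gt0 _)) //.
by rewrite expRN_le1 // mulr_ge0 ?dot_ge0 // invr_ge0 mulr_ge0 // ltW.
Qed.

(** The reason why the mass missing on a cube of side proportional to [sqrt s] can be bounded below
    independently of [s]. *)
Lemma peak_sqrt s : 0 < s -> peak s * Num.sqrt s ^+ n = peak 1.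
Proof.
move=> s0; have -> : s = s * 1 by rewrite mulr1.
rewrite peakM // mulr1 mulrAC; have -> : Num.sqrt s = expR (2^-1 * ln s).
  by rewrite -powR12_sqrt ?(ltW s0) // /powR gt_eqF.
rewrite -expRM_natl -expRD (_ : _ + _ = 0) ?expR0 ?mul1r //.
by ring.
Qed.

(* If mass were missing at x, [reflect_lipschitz] would make it missing on a cube of side
   comparable to [sqrt s] around x, so that the integral of the kernel near y would stay
   bounded away from 1. *)
Lemma pD_initial_mass y (e : R) : D y -> 0 < e ->
  exists2 s0, 0 < s0 & forall s x, 0 < s < s0 -> D x ->
    gauss s x y - pD s x y <= e * gauss (2 * s) x y.
Proof.
move=> Dy e0.
have [eta eta0 heta] : exists2 eta, 0 < eta & forall z, enorm (z - y) < 3 * eta -> D z.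
  have [r r0 hr] := (nbhs_enormP y D).1 (open_nbhs_nbhs (conj oD Dy)).
  exists (r / 3); first by rewrite divr_gt0.
  by move=> z; rewrite mulrC divfK //; exact: hr.
pose phi (v : 'rV[R]_n) := Num.max 0 (Num.min 1 (2 - enorm (v - y) / eta)).
have phi01 v : 0 <= phi v <= 1 by rewrite le_max lexx /= ge_max ler01 ge_min lexx.
have phi1 v : enorm (v - y) <= eta -> phi v = 1.
  move=> h; have : enorm (v - y) / eta <= 1 by rewrite ler_pdivrMr // mul1r.
  by move=> h'; rewrite /phi min_l ?max_r //; lra.
have phi0 v : 2 * eta <= enorm (v - y) -> phi v = 0.
  move=> h; have : 2 <= enorm (v - y) / eta by rewrite ler_pdivlMr.
  by move=> h'; rewrite /phi max_l // ge_min; apply/orP; right; lra.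
have cphi : continuous phi.
  move=> x; apply: enorm_continuous_at => d d0; exists (d * eta); first exact: mulr_gt0.
  move=> z zr; apply: le_lt_trans (clamp_lipschitz _ _) _.
  have -> : 2 - enorm (z - y) / eta - (2 - enorm (x - y) / eta) = (enorm (x - y) - enorm (z - y)) / eta.
    by field; rewrite gt_eqF.
  rewrite normrM (gtr0_norm (x := eta^-1)) ?invr_gt0 // ltr_pdivrMr //.
  apply: le_lt_trans zr; rewrite ler_norml (enorm_distC z); apply/andP; split.
    by have := enorm_triangle x z y; rewrite (enorm_distC z x); lra.
  by have := enorm_triangle z x y; lra.
have sphi : compactly_supported_in D phi.
  exists [set v | enorm (v - y) <= 2 * eta]; split.
  - rewrite (_ : mkset _ = [set v | enorm v <= enorm y + 2 * eta] `&` [set v | - (2 * eta) <= - enorm (v - y)]).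
      apply: compact_superlevel; first exact: compact_enorm_le.
      move=> x _; apply: enorm_continuous_at => d d0; exists d => // z zr.
      apply: le_lt_trans zr; rewrite opprK ler_norml (enorm_distC z x); apply/andP; split.
        by have := enorm_triangle x z y; rewrite (enorm_distC z x); lra.
      by have := enorm_triangle z x y; lra.
    apply/seteqP; split => v /=; rewrite lerN2; last by case.
    move=> h; split => //; have := enormD (v - y) y; rewrite subrK; lra.
  - by move=> v /= h; apply: heta; lra.
  - by move=> v /= /negP; rewrite -ltNge => /ltW; exact: phi0.
have [_ _ _ _ /(_ y phi Dy cphi sphi) lim] := hpD.
rewrite phi1 ?subrr ?enorm0 ?(ltW eta0) // in lim.
pose ka := expR (- (n%:R / 2) * ln 2) : R.
have ka0 : 0 < ka by exact: expR_gt0.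
(* With [E = exp (- |x - y| ^ 2 / (8 s))], the Gaussian is [peak s * E ^ 2] at time [s] and
   [ka * peak s * E] at time [2 s]. A deficit above [e] times the latter forces [E > e * ka], hence
   a deficit above [e1 * peak s] and [|x - y| = O(sqrt s)]. *)
pose e1 := (e * ka) ^+ 2; have e10 : 0 < e1 by rewrite exprn_gt0 // mulr_gt0.
pose N : R := n.+1%:R; have N0 : 0 < N by rewrite ltr0n.
(* Makes the oscillation allowed by [cube_lipschitz] on the cube of half-side [k1 * sqrt s] at most
   half of the deficit [e1 * peak s]. *)
pose k1 := Num.min (2^-1) (e1 * ka / (4 * N ^+ 2)).
have k10 : 0 < k1 by rewrite lt_min invr_gt0 ltr0n /= divr_gt0 ?mulr_gt0 // exprn_gt0.
pose c1 := e1 / 2 * (peak 1 * (2 * k1) ^+ n).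
have c10 : 0 < c1.
  apply: mulr_gt0; first exact: divr_gt0.
  by apply: mulr_gt0; [exact: peak_gt0|apply: exprn_gt0; exact: mulr_gt0].
move/cvgrPdist_lt: lim => /(_ _ c10); rewrite near_withinE => /nbhs_ballP [s1 /= s10 hs1].
(* Times [sqrt s], the three terms bound the reflection radius, the size of the cube and the
   distance from [x] to [y]; for [C * sqrt s < eta] everything happens where the test function is
   1. *)
pose C := 2^-1 + n%:R * k1 + (1 + 8 / (e * ka)).
have C0 : 0 < C.
  have h1 : 0 < 8 / (e * ka) by apply: divr_gt0 => //; exact: mulr_gt0.
  have h2 : 0 <= n%:R * k1 by rewrite mulr_ge0 // ltW.
  by rewrite /C; lra.
exists (Num.min s1 ((eta / C) ^+ 2)); first by rewrite lt_min s10 exprn_gt0 // divr_gt0.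
move=> s x /andP [s0]; rewrite lt_min => /andP [ss1 ssC] Dx.
have s2 : 0 < 2 * s by rewrite mulr_gt0.
rewrite leNgt; apply/negP => hbig.
pose sg := Num.sqrt s; have sg0 : 0 < sg by rewrite sqrtr_gt0.
have sgs : sg ^+ 2 = s by rewrite sqr_sqrtr // ltW.
have sgC : sg * C < eta.
  rewrite -ltr_pdivlMr // -(@ltr_pXn2r _ 2) ?nnegrE ?(ltW sg0) ?divr_ge0 ?(ltW eta0) ?(ltW C0) //.
  by rewrite sgs.
pose Z := dot (x - y) (x - y) / (8 * s).
have Z0 : 0 <= Z by rewrite divr_ge0 ?dot_ge0 // mulr_ge0 // ltW.
pose E := expR (- Z); have E0 : 0 < E by exact: expR_gt0.
have g1 : gauss s x y = peak s * E ^+ 2.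
  rewrite gaussE /E -expRM_natl; congr (_ * expR _).
  by rewrite /Z; field; rewrite gt_eqF.
have g2 : gauss (2 * s) x y = ka * peak s * E.
  rewrite gaussE peakM // /E; congr (_ * expR _).
  by rewrite /Z; field; rewrite gt_eqF.
have pk0 := peak_gt0 s.
have pDx := pD_ge0 hpD s0 Dx Dy.
have eka0 : 0 < e * ka by exact: mulr_gt0.
have Ebig : e * ka < E.
  have : 0 < peak s * E * (E - e * ka) by move: hbig; rewrite g1 g2; lra.
  by rewrite pmulr_rgt0 ?subr_gt0 //; exact: mulr_gt0.
have rbig : e1 * peak s < gauss s x y - pD s x y.
  apply: le_lt_trans hbig; rewrite g2 /e1.
  have -> : e * (ka * peak s * E) = (e * ka * peak s) * E by ring.
  have -> : (e * ka) ^+ 2 * peak s = (e * ka * peak s) * (e * ka) by ring.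
  by apply: ler_wpM2l; [apply: mulr_ge0; exact: ltW|exact: ltW].
have Zs : Z < (e * ka)^-1.
  have h1 : E * (1 + Z) <= 1.
    by rewrite /E expRN mulrC ler_pdivrMr ?expR_gt0 // mul1r; exact: expR_ge1Dx.
  rewrite -[ltRHS]mul1r ltr_pdivlMr //; nra.
have xy : enorm (x - y) <= sg * (1 + 8 / (e * ka)).
  have h : 0 <= 8 / (e * ka) by rewrite divr_ge0 // ltW.
  rewrite -(@ler_pXn2r _ 2) ?nnegrE ?enorm_ge0 ?mulr_ge0 ?(ltW sg0) //; last by lra.
  rewrite enorm_sqr exprMn sgs; have -> : dot (x - y) (x - y) = s * (8 * Z) by rewrite /Z; field; rewrite gt_eqF.
  rewrite ler_wpM2l ?(ltW s0) //.
  by apply: (@le_trans _ _ (8 / (e * ka))); [rewrite ler_wpM2l // ltW|nra].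
pose rho := sg / 2; have rho0 : 0 < rho by rewrite divr_gt0.
have rho2 : rho ^+ 2 = s / 4 by rewrite /rho expr_div_n sgs; field.
pose k := k1 * sg; have k0 : 0 < k by rewrite mulr_gt0.
have k1h : k1 <= 2^-1 by rewrite ge_min lexx.
have krho : 0 <= k < 2 * rho by rewrite (ltW k0) /= /k /rho; nra.
(* This is [peak (s / 2)], a bound for the Gaussian during the last quarter of the time interval. *)
pose A := ka^-1 * peak s.
have hreg z : enorm (z - x) <= rho + n%:R * k -> enorm (z - y) <= eta.
  move=> h; apply: (le_trans (enorm_triangle x _ _)).
  apply: (le_trans (lerD h xy)); apply/ltW; apply: le_lt_trans sgC.
  by rewrite /C /rho /k; lra.
have hr t z : s - rho ^+ 2 <= t <= s -> enorm (z - x) <= rho + n%:R * k ->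
   0 <= gauss t z y - pD t z y <= A /\
   exists G L, has_jet (fun t z => gauss t z y - pD t z y) t z L G L.
  move=> /andP [t1 _] hz.
  have Dz : D z by apply: heta; apply: (le_lt_trans (hreg z hz)); rewrite ltr_pMl // ltr1n.
  rewrite rho2 in t1; have t0 : 0 < t.
    by apply: lt_le_trans t1; rewrite subr_gt0 ltr_pdivrMr // ltr_pMr // ltr1n.
  have h1 := pD_le_gauss hpD t0 Dz Dy; have h2 := pD_ge0 hpD t0 Dz Dy.
  split.
    rewrite subr_ge0 h1 /=; apply: (@le_trans _ _ (peak t)).
      by apply: le_trans (gauss_le_peak z y t0); rewrite gerBl.
    have hs2 : 0 < s / 2 by rewrite divr_gt0.
    apply: (@le_trans _ _ (peak (s / 2))); first by apply: le_peak => //; lra.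
    have e2 : peak s = ka * peak (s / 2) by rewrite /ka -peakM //; congr peak; field.
    by rewrite /A e2 mulKf ?gt_eqF.
  have [G [L j]] := jet_pD oD hpD t0 Dz Dy.
  by do 2 eexists; exact: jet_sub (jet_gauss z y t0) j.
have hfar (v : 'rV[R]_n) : (forall i, `|v 0 i - x 0 i| <= k) -> e1 * peak s / 2 <= gauss s v y - pD s v y.
  move=> hv; have := cube_lipschitz rho0 krho hr hv.
  have : n%:R * (A * (n.+1%:R * k / rho)) <= e1 * peak s / 2.
    have -> : n%:R * (A * (n.+1%:R * k / rho)) = (n%:R * N * 2 * k1 / ka) * peak s.
      by rewrite /A /k /rho /N; field; rewrite !gt_eqF.
    rewrite [leRHS]mulrAC; apply: ler_wpM2r; first exact: ltW.
    apply: (@le_trans _ _ (N * N * 2 * (e1 * ka / (4 * N ^+ 2)) / ka)).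
      rewrite ler_wpM2r ?invr_ge0 ?(ltW ka0) //; apply: ler_pM.
      - by rewrite mulr_ge0 // mulr_ge0 ?ler0n // ltW.
      - exact: ltW.
      - by rewrite ler_wpM2r // ler_wpM2r ?(ltW N0) // ler_nat.
      - by rewrite ge_min lexx orbT.
    have -> : N * N * 2 * (e1 * ka / (4 * N ^+ 2)) / ka = e1 / 2 by field; rewrite !gt_eqF.
    by [].
  lra.
have := hs1 s; rewrite -ball_normE /= sub0r normrN gtr0_norm // => /(_ ss1 s0).
have hI : iter_integral (fun v => pD s v y * phi v) <= 1 - e1 * peak s / 2 * (2 * k) ^+ n.
  apply: (@iter_integral_gauss_minus_cube _ _ s _ k x y) => //.
    move=> v; have /andP [p1 p2] := phi01 v.
    have [Dv|nDv] := pselect (D v).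
      have h1 := pD_le_gauss hpD s0 Dv Dy; have h2 := pD_ge0 hpD s0 Dv Dy.
      by rewrite mulr_ge0 //=; apply: le_trans h1; rewrite ler_piMr.
    rewrite phi0 ?mulr0 ?lexx ?(ltW (gauss_gt0 _ _ _)) //.
    rewrite leNgt; apply/negP => h; apply: nDv; apply: heta.
    by apply: (lt_trans h); rewrite ltr_pM2r // ltr_nat.
  move=> v hv.
  have vx : enorm (v - x) <= rho + n%:R * k.
    apply: (@le_trans _ _ (n%:R * k)); last by rewrite lerDr ltW.
    by apply: enorm_le_coord; [exact: ltW|move=> i; rewrite !mxE].
  by rewrite phi1 ?mulr1; [rewrite lerBrDr -lerBrDl; exact: hfar|exact: hreg].
have ee : e1 * peak s / 2 * (2 * k) ^+ n = c1.
  by rewrite /c1 -(peak_sqrt s0) /k mulrA exprMn -/sg; ring.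
rewrite ee in hI; rewrite ltr_norml => /andP [_]; lra.
Qed.

End InitialMass.

(** * Lower bounds *)

Section LowerBounds.
Context {R : realType} {n : nat} (D : set 'rV[R]_n) (pD : R -> 'rV[R]_n -> 'rV[R]_n -> R).
Hypotheses (oD : open D) (hpD : dirichlet_heat_kernel D pD).
Hypothesis cD : forall x y (l : R), D x -> D y -> 0 <= l <= 1 -> D (l *: x + (1 - l) *: y).
Implicit Types (t s : R) (x y : 'rV[R]_n).
Local Notation peak := (@peak R n).

Definition depth (rho : R) (b x : 'rV[R]_n) : R :=
  (rho ^+ 2 - dot (x - b) (x - b)) * (2 * rho)^-1.

Definition ball_in (a : 'rV[R]_n) (rho : R) := forall z, enorm (z - a) < rho -> D z.

Lemma moving_ball_in (a b : 'rV[R]_n) rho (l : R) : ball_in a rho -> ball_in b rho -> 0 <= l <= 1 ->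
  ball_in (l *: a + (1 - l) *: b) rho.
Proof.
move=> ha hb hl z hz; pose Z := z - (l *: a + (1 - l) *: b).
have -> : z = l *: (a + Z) + (1 - l) *: (b + Z).
  by apply/rowP => i; rewrite !mxE; ring.
by apply: cD => //; [apply: ha|apply: hb]; rewrite addrC addKr.
Qed.

Lemma depth_gt0 rho b x : 0 < rho -> (0 < depth rho b x) = (enorm (x - b) < rho).
Proof.
move=> r0; have := @ball_depth_gt0 R n rho b 0 0 x r0.
by rewrite /ball_depth scaler0 addr0.
Qed.

(** The ball travels from [b] to [a] during time [t], and the subsolution is issued from [y] itself,
    with [k0] the depth of [y]. It is compared from a small time [s1] on, where the kernel dominates
    the Gaussian up to the error of [pD_initial_mass]. *)
Lemma pD_lower_ball (a b x y : 'rV[R]_n) (rho t : R) : 0 < rho -> 0 < t ->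
  ball_in a rho -> ball_in b rho -> enorm (y - b) < rho -> enorm (x - a) < rho ->
  4 * n.+1%:R * Num.sqrt t <= rho ->
  expR (- 2) / 4 * Num.min 1 (depth rho b y * depth rho a x / t) * gauss t x y <= pD t x y.
Proof.
move=> r0 t0 ha hb hy hx hrt.
have Dy : D y by exact: hb.
pose U := t^-1 *: (a - b).
have bU s : b + s *: U = (s / t) *: a + (1 - s / t) *: b.
  by apply/rowP => i; rewrite !mxE; ring.
have bUt : b + t *: U = a by rewrite bU divff ?gt_eqF // subrr scale1r scale0r addr0.
pose k0 := depth rho b y; have k00 : 0 < k0 by rewrite depth_gt0.
have hdx : 0 < ball_depth rho b U t x by rewrite ball_depth_gt0 // bUt.
suff h : gauss t x y * ball_barrier rho k0 b U t x <= pD t x y.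
  apply: le_trans h; rewrite mulrC ler_wpM2l ?(ltW (gauss_gt0 _ _ _)) //.
  have := ball_barrier_ge r0 t0 hrt (ltW k00) (ltW hdx).
  by rewrite /k0 /ball_depth bUt.
rewrite leNgt; apply/negP; rewrite -subr_gt0; set d := _ - _ => d0.
(* With this tolerance the error carried to time [t] is at most half of the supposed gap [d]. *)
pose e := d / (2 * peak t); have pk0 : 0 < peak t by exact: peak_gt0.
have e0 : 0 < e by rewrite divr_gt0 // mulr_gt0.
have [s0 s00 hs0] := pD_initial_mass oD hpD Dy e0.
pose s1 := Num.min (s0 / 2) t.
have s10 : 0 < s1 by rewrite lt_min t0 divr_gt0.
have s1t : s1 <= t by rewrite ge_min lexx orbT.
have s1s0 : 0 < s1 < s0.
  rewrite s10 /=; apply: (@le_lt_trans _ _ (s0 / 2)); first by rewrite ge_min lexx.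
  by rewrite ltr_pdivrMr // ltr_pMr // ltr1n.
have hD s z : s1 <= s <= t -> 0 < ball_depth rho b U s z -> D z.
  move=> /andP [hs1 hs2]; rewrite ball_depth_gt0 // bU.
  apply: moving_ball_in => //; have s00' := lt_le_trans s10 hs1.
  by rewrite divr_ge0 ?(ltW s00') ?(ltW t0) //= ler_pdivrMr // mul1r.
have := @ball_barrier_le_pD R n D pD y rho k0 1 e 0 s1 t b U y oD hpD Dy r0 (ltW k00) _ ler01 (ltW e0) s10 s1t.
rewrite addr0 => /(_ _ s10 hrt hD); rewrite {1}/ball_depth scale0r addr0 => /(_ (lexx _)) h.
have {}h := h _ x hdx; move: h; rewrite (addr0 t).
have h2 : e * gauss (t + s1) x y <= d / 2.
  apply: (@le_trans _ _ (e * peak t)).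
    rewrite ler_wpM2l ?(ltW e0) //; apply: (le_trans (gauss_le_peak _ _ _)); first by rewrite addr_gt0.
    by apply: le_peak => //; rewrite lerDl ltW.
  by rewrite /e le_eqVlt; apply/orP; left; apply/eqP; field; rewrite gt_eqF.
move=> h; suff : 1 * (gauss t x y * ball_barrier rho k0 b U t x) <= pD t x y + e * gauss (t + s1) x y.
  by rewrite /d in d0 h2 *; lra.
apply: h => z hz; rewrite mul1r.
have Dz : D z by apply: (hD s1) => //; rewrite lexx s1t.
have := hs0 s1 z s1s0 Dz; have -> : 2 * s1 = s1 + s1 by ring.
rewrite lerBlDl; apply: le_trans.
by rewrite ler_piMr ?(ltW (gauss_gt0 _ _ _)) // ball_barrier_le1.
Qed.

Lemma peakM2_le (a b c d : R) : 0 < a -> 0 < b -> 0 < c -> 0 < d -> a * b <= 5 * (c * d) ->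
  expR (- (n%:R / 2) * ln 5) * (peak c * peak d) <= peak a * peak b.
Proof.
move=> a0 b0 c0 d0 h; have p0 := @pi_gt0 R; rewrite /peak -!expRD ler_expR -!mulrDr.
rewrite !mulNr lerN2 ler_wpM2l ?divr_ge0 // -!lnM ?posrE ?mulr_gt0 //.
rewrite ler_ln ?posrE ?mulr_gt0 //.
have -> : 4 * pi * a * (4 * pi * b) = (4 * pi) ^+ 2 * (a * b) by ring.
have -> : 5 * (4 * pi * c * (4 * pi * d)) = (4 * pi) ^+ 2 * (5 * (c * d)) by ring.
by rewrite ler_wpM2l ?sqr_ge0.
Qed.

(** The loss of one restart: [exp (- 2) / 4] from [ball_barrier_ge], [5 ^ (- n / 2)] from the
    Gaussian peaks in [peakM2_le], and [1 / 5 = (1 / 4) / (5 / 4)] from an initial depth [rho / 4]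
    and a final time at most 5/4 of the duration. *)
Definition phase_const : R := expR (- 2) / 4 * expR (- (n%:R / 2) * ln 5) / 5.

Lemma gauss_along (s : R) (V x y : 'rV[R]_n) : 0 < s -> x - y = s *: V ->
  gauss s x y = peak s * expR (- (s * dot V V / 4)).
Proof.
by move=> s0 h; rewrite gaussE h !dotE; congr (_ * expR _); field; rewrite gt_eqF.
Qed.

(* Near q, at time [t1], [gauss t1 v y] dominates a multiple of the Gaussian issued at a
   later time [t1 - s0] from the point z of the segment, so the subsolution can be started
   from z. *)
Lemma pD_lower_phase (a q x y : 'rV[R]_n) (rho A t1 t2 : R) : 0 < rho -> 0 < t1 -> t1 < t2 -> D y ->
  0 <= A -> ball_in q rho -> ball_in a rho -> enorm (x - a) < rho ->
  q = y + (t1 / t2) *: (x - y) -> 8 * n.+1%:R * Num.sqrt (t2 - t1) <= rho ->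
  (forall z, enorm (z - q) < rho -> A * gauss t1 z y <= pD t1 z y) ->
  phase_const * A * Num.min 1 (depth rho a x * rho / (t2 - t1)) * gauss t2 x y <= pD t2 x y.
Proof.
move=> r0 t10 t12 Dy A0 hq ha hx qE hrt hA.
pose De := t2 - t1; have De0 : 0 < De by rewrite subr_gt0.
have t20 : 0 < t2 by exact: lt_trans t12.
(* Equivalently [1 / s0 = 1 / t1 + 4 / De]: [s0] is below [t1] and [De / 4], yet large enough for
   [t1 * (s0 + De) <= 5 * (s0 * t2)], which bounds the loss in the peaks. *)
pose s0 := t1 * De / (De + 4 * t1).
have den0 : 0 < De + 4 * t1 by rewrite addr_gt0 // mulr_gt0.
have s00 : 0 < s0 by rewrite divr_gt0 // mulr_gt0.
have s0t1 : s0 <= t1.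
  by rewrite /s0 ler_pdivrMr // ler_pM2l // lerDl mulr_ge0 // ltW.
have s0D : s0 <= De / 4.
  rewrite /s0 ler_pdivrMr //; have -> : De / 4 * (De + 4 * t1) = t1 * De + De * De / 4 by field.
  by rewrite lerDl divr_ge0 // mulr_ge0 // ltW.
pose V := t2^-1 *: (x - y); pose z := y + (t1 - s0) *: V.
pose U := De^-1 *: (a - q); pose b := q - s0 *: U.
pose K := peak t1 / peak s0 * expR (- ((t1 - s0) * dot V V / 4)).
have K0 : 0 < K by rewrite mulr_gt0 ?expR_gt0 // divr_gt0 // peak_gt0.
have bs0 : b + s0 *: U = q by rewrite subrK.
have bU s : b + s *: U = ((s - s0) / De) *: a + (1 - (s - s0) / De) *: q.
  by apply/rowP => i; rewrite !mxE; field; rewrite gt_eqF.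
have bUe : b + (s0 + De) *: U = a.
  by rewrite bU addrAC subrr add0r divff ?gt_eqF // subrr scale1r scale0r addr0.
have qV : q = y + t1 *: V by rewrite qE /V scalerA.
have xV : x = y + t2 *: V by rewrite /V scalerA divff ?gt_eqF // scale1r addrC subrK.
(* The motion of the ball is extrapolated back to the virtual time 0; there [z] is offset from the
   centre by at most [rho / 4], because [s0 <= De / 4]. *)
have zb : z - b = (- (s0 / De)) *: (x - a).
  have gen (W : 'rV[R]_n) (d u v : R) : d != 0 ->
      y + (v - u) *: W - (y + v *: W - u *: (d^-1 *: (a - (y + v *: W)))) =
      (- (u / d)) *: (y + (d + v) *: W - a).
    by move=> d0; apply/rowP => i; rewrite !mxE; field.
  have -> : x = y + (De + t1) *: V by rewrite {1}xV /De subrK.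
  by rewrite /z /b /U qV; apply: gen; rewrite gt_eqF.
have k0 : rho / 4 <= ball_depth rho b U 0 z.
  rewrite /ball_depth scale0r addr0 zb dotZl dotZr ler_pdivlMr ?mulr_gt0 //.
  have h : dot (x - a) (x - a) <= rho ^+ 2.
    by rewrite -enorm_sqr ler_pXn2r ?nnegrE ?enorm_ge0 ?(ltW r0) // ltW.
  have h2 : 0 <= s0 / De <= 1 / 4.
    by rewrite divr_ge0 ?(ltW s00) ?(ltW De0) //= ler_pdivrMr // mulrC mulrA mulr1.
  have := dot_ge0 (x - a); move: h h2; set w := dot _ _; set l := s0 / De => h /andP [l0 l1] w0.
  have : l * (l * w) <= 1 / 4 * (1 / 4 * rho ^+ 2).
    by apply: ler_pM => //; [exact: mulr_ge0|exact: ler_pM].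
  by have := sqr_ge0 rho; nra.
have hrt' : 4 * n.+1%:R * Num.sqrt (s0 + De) <= rho.
  apply: le_trans hrt; have -> : 8 * n.+1%:R * Num.sqrt (t2 - t1) = 4 * n.+1%:R * (2 * Num.sqrt De).
    by rewrite -/De; ring.
  rewrite ler_wpM2l ?mulr_ge0 ?ler0n //.
  have -> : 2 * Num.sqrt De = Num.sqrt (4 * De).
    rewrite sqrtrM // (_ : 4 = 2 ^+ 2); last by ring.
    by rewrite sqrtr_sqr ger0_norm.
  by rewrite ler_wsqrtr //; lra.
have hD s w : s0 <= s <= s0 + De -> 0 < ball_depth rho b U s w -> D w.
  move=> /andP [hs1 hs2]; rewrite ball_depth_gt0 // bU; apply: moving_ball_in => //.
  have hs3 : 0 <= s - s0 by rewrite subr_ge0.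
  by apply/andP; split; [exact: divr_ge0 hs3 (ltW De0)|rewrite ler_pdivrMr // mul1r lerBlDl].
have hdx : 0 < ball_depth rho b U (s0 + De) x by rewrite ball_depth_gt0 // bUe.
have s0e : s0 <= s0 + De by rewrite lerDl ltW.
have rho4 : 0 <= rho / 4 by rewrite divr_ge0 // ltW.
have AK0 : 0 <= A * K by rewrite mulr_ge0 // ltW.
have sc : 0 < s0 + (t1 - s0) by rewrite addrC subrK.
have := @ball_barrier_le_pD R n D pD y rho (rho / 4) (A * K) 0 (t1 - s0) s0 (s0 + De) b U z oD hpD Dy r0
  rho4 k0 AK0 (lexx _) s00 s0e sc hrt' hD.
have -> : s0 + (t1 - s0) = t1 by ring.
have -> : s0 + De + (t1 - s0) = t2 by rewrite /De; ring.
move=> h0; have h : forall w, 0 < ball_depth rho b U (s0 + De) w ->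
    A * K * (gauss (s0 + De) w z * ball_barrier rho (rho / 4) b U (s0 + De) w) <= pD t2 w y.
  move=> w0 hw0; have e0 := mul0r (gauss (s0 + De + s0) w0 z).
  have -> : pD t2 w0 y = pD t2 w0 y + 0 * gauss (s0 + De + s0) w0 z by rewrite e0 addr0.
  apply: h0 hw0.
  move=> w hw; rewrite mul0r addr0; have hw' : enorm (w - q) < rho by rewrite -bs0 -ball_depth_gt0.
  apply: le_trans (hA w hw'); rewrite -mulrA ler_wpM2l //.
  apply: (@le_trans _ _ (K * gauss s0 w z)).
    by rewrite ler_wpM2l ?(ltW K0) // ler_piMr ?(ltW (gauss_gt0 _ _ _)) // ball_barrier_le1.
  rewrite !gaussE /K.
  have -> : peak t1 / peak s0 * expR (- ((t1 - s0) * dot V V / 4)) * (peak s0 * expR (- (dot (w - z) (w - z) / (4 * s0))))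
    = peak t1 * expR (- ((t1 - s0) * dot V V / 4) - dot (w - z) (w - z) / (4 * s0)).
    by rewrite expRD; field; rewrite gt_eqF // peak_gt0.
  rewrite ler_wpM2l ?(ltW (peak_gt0 _)) // ler_expR.
  have -> : w - z = (w - y) - (t1 - s0) *: V by rewrite /z opprD addrA.
  move: (w - y) => Y.
  (* Completing the square: the exponent of [K * gauss s0 w z] lies below that of [gauss t1 w y],
     with equality at [w = q]. *)
  have e1 : dot (Y - (t1 - s0) *: V) (Y - (t1 - s0) *: V) / (4 * s0) - dot Y Y / (4 * t1) + (t1 - s0) * dot V V / 4
    = (t1 - s0) / (4 * s0 * t1) * dot (Y - t1 *: V) (Y - t1 *: V).
    have gen (W : 'rV[R]_n) (u v : R) : u != 0 -> v != 0 ->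
        dot (Y - (v - u) *: W) (Y - (v - u) *: W) / (4 * u) - dot Y Y / (4 * v) + (v - u) * dot W W / 4
        = (v - u) / (4 * u * v) * dot (Y - v *: W) (Y - v *: W).
      by move=> u0 v0; rewrite !dotE (dotC W Y); field; rewrite ?u0 ?v0.
    by apply: gen; rewrite gt_eqF.
  have : 0 <= (t1 - s0) / (4 * s0 * t1) * dot (Y - t1 *: V) (Y - t1 *: V).
    rewrite mulr_ge0 ?dot_ge0 // divr_ge0 ?subr_ge0 //; apply: mulr_ge0; last exact: ltW.
    by apply: mulr_ge0 => //; exact: ltW.
  by rewrite -e1; lra.
apply: le_trans (h x hdx).
have hb := ball_barrier_ge r0 (addr_gt0 s00 De0) hrt' rho4 (ltW hdx).
have hm : Num.min 1 (depth rho a x * rho / De) / 5 <=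
    Num.min 1 (rho / 4 * ball_depth rho b U (s0 + De) x / (s0 + De)).
  have -> : ball_depth rho b U (s0 + De) x = depth rho a x by rewrite /ball_depth bUe.
  have d0 : 0 < depth rho a x by rewrite depth_gt0.
  set m := Num.min 1 _; have m1 : m <= 1 by rewrite ge_min lexx.
  have m2 : m <= depth rho a x * rho / De by rewrite ge_min lexx orbT.
  rewrite le_min; apply/andP; split; first by lra.
  rewrite ler_pdivlMr ?(addr_gt0 s00 De0) //; move: m2; rewrite ler_pdivlMr // => m2.
  have m0 : 0 <= m.
    rewrite le_min ler01 /=; apply: divr_ge0; last exact: ltW.
    by apply: mulr_ge0; exact: ltW.
  have : m * (s0 + De) <= m * (5 / 4 * De) by rewrite ler_wpM2l //; lra.
  by lra.
have gx : K * gauss (s0 + De) x z = peak t1 * peak (s0 + De) / peak s0 * expR (- (t2 * dot V V / 4)).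
  rewrite (@gauss_along _ V) ?(addr_gt0 s00 De0) //; last first.
    by rewrite {1}xV /z /De; apply/rowP => i; rewrite !mxE; ring.
  rewrite /K (_ : - (t2 * dot V V / 4) = - ((t1 - s0) * dot V V / 4) - ((s0 + De) * dot V V / 4)); last first.
    by rewrite /De; field.
  by rewrite expRD; field; rewrite gt_eqF // peak_gt0.
have gy : gauss t2 x y = peak t2 * expR (- (t2 * dot V V / 4)).
  by apply: gauss_along => //; rewrite {1}xV addrAC subrr add0r.
have hp : expR (- (n%:R / 2) * ln 5) * gauss t2 x y <= K * gauss (s0 + De) x z.
  rewrite gx gy mulrA ler_wpM2r ?expR_ge0 // ler_pdivlMr ?peak_gt0 //.
  rewrite -mulrA [peak t2 * _]mulrC; apply: peakM2_le => //; first exact: addr_gt0.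
  have -> : t1 * (s0 + De) = t1 * De * (De + 5 * t1) / (De + 4 * t1).
    by rewrite /s0; field; rewrite gt_eqF.
  rewrite /s0 ler_pdivrMr //.
  have -> : 5 * (t1 * De / (De + 4 * t1) * t2) * (De + 4 * t1) = t1 * De * (5 * t2).
    by field; rewrite gt_eqF.
  rewrite ler_wpM2l ?mulr_ge0 ?(ltW t10) ?(ltW De0) // /De; lra.
set m := Num.min 1 (depth rho a x * rho / De) in hm *.
have m0 : 0 <= m.
  have d0 : 0 < depth rho a x by rewrite depth_gt0.
  rewrite le_min ler01 /=; apply: divr_ge0; last exact: ltW.
  by apply: mulr_ge0; exact: ltW.
have e20 : 0 <= expR (- 2) / 4 :> R by rewrite divr_ge0 ?expR_ge0.
have hb2 : expR (- 2) / 4 * (m / 5) <= ball_barrier rho (rho / 4) b U (s0 + De) x.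
  by apply: le_trans hb; rewrite ler_wpM2l.
rewrite -/De -/m; have -> : phase_const * A * m * gauss t2 x y = A * ((expR (- (n%:R / 2) * ln 5) * gauss t2 x y) * (expR (- 2) / 4 * (m / 5))).
  by rewrite /phase_const; field.
set f := ball_barrier _ _ _ _ _ _ in hb2 *.
have -> : A * K * (gauss (s0 + De) x z * f) = A * ((K * gauss (s0 + De) x z) * f) by ring.
apply: ler_wpM2l => //; apply: ler_pM => //.
- by apply: mulr_ge0; [exact: expR_ge0|exact: ltW (gauss_gt0 _ _ _)].
- by apply: mulr_ge0 => //; exact: divr_ge0.
Qed.

(** For long times the Gaussian factor is dropped, and [exp (- la (s - t1)) (exp (be * depth) - 1)]
    is a subsolution in a fixed ball. At distance at least [r / 2] from the centre the squared
    gradient [be ^ 2 q] beats the curvature [be n / r]; closer in, the depth is at least [3 r / 8],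
    [exp (be * depth)] is well above 1 and the decay rate [la] takes over. *)
Lemma pD_lower_long (a x y : 'rV[R]_n) (r kappa t1 t : R) : 0 < r -> 0 < t1 -> t1 <= t -> D y ->
  0 <= kappa -> ball_in a r -> enorm (x - a) < r ->
  (forall z, enorm (z - a) < r -> kappa * depth r a z <= pD t1 z y) ->
  kappa * expR (- (2 * n.+1%:R)) * expR (- (8 * n.+1%:R ^+ 2 / r ^+ 2 * (t - t1))) * depth r a x <= pD t x y.
Proof.
move=> r0 t10 t1t Dy k0 ha hx hk.
pose M : R := n.+1%:R; have M1 : 1 <= M by rewrite ler1n.
pose be := 4 * M / r; pose la := 8 * M ^+ 2 / r ^+ 2.
have be0 : 0 < be by rewrite divr_gt0 // mulr_gt0 // (lt_le_trans ltr01).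
(* As [be * depth <= 2 M], one has [exp (be * depth) - 1 <= be * depth * exp (2 M)]; hence the
   subsolution starts below [kappa * depth]. *)
pose A := kappa * expR (- (2 * M)) / be.
have A0 : 0 <= A by apply: divr_ge0; [rewrite mulr_ge0 ?expR_ge0|exact: ltW].
pose g s z := ball_depth r a 0 s z.
have gE s z : g s z = depth r a z by rewrite /g /ball_depth scaler0 addr0.
pose v s z := A * (expR (- (la * (s - t1))) * (expR (be * g s z) - 1)).
pose w s z := v s z - pD s z y.
pose Om := [set p : R * 'rV[R]_n | 0 < ball_depth r a 0 p.1 p.2].
have inD s z : 0 < g s z -> D z by rewrite gE depth_gt0 //; exact: ha.
have gr s z : g s z <= r / 2.
  rewrite /g /ball_depth ler_pdivrMr ?mulr_gt0 //.
  have -> : r / 2 * (2 * r) = r ^+ 2 by field.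
  by rewrite gerBl dot_ge0.
have jv s z : exists vt G L, has_jet v s z vt G L /\ (0 <= g s z -> vt <= L).
  have jt := jet_scale la (jet_sub (jet_time_fun z (is_derive_id s (1 : R))) (jet_cst t1 s z)).
  have jg := jet_sub (jet_expR (jet_scale be (jet_ball_depth a 0 s z r0))) (jet_cst 1 s z).
  have j := jet_scale A (jet_mul (jet_expR (jet_opp jt)) jg).
  do 3 eexists; split; first exact: j.
  rewrite -/(g s z) => gz.
  have XE : dot (z - a) (z - a) = r ^+ 2 * (1 - 2 * g s z / r).
    by rewrite /g /ball_depth scaler0 addr0; field; rewrite gt_eqF.
  rewrite !subr0 !scaler0 !oppr0 ?scaler0 !addr0 !(dotZl, dotZr, dot0l, dot0r).
  rewrite XE; move: (gz) (gr s z); set G := g s z; set E := expR (be * G); set T := expR (- _) => G0 Gr.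
  apply: ler_wpM2l => //.
  have T0 : 0 <= T by exact: expR_ge0.
  rewrite -subr_ge0; set rhs := (X in 0 <= X).
  have -> : rhs = T * (la * (E - 1) + E * (be ^+ 2 * (1 - 2 * G / r) - be * n%:R / r)).
    by rewrite /rhs; field; rewrite gt_eqF.
  apply: mulr_ge0 => //.
  have E0 : 0 < E by exact: expR_gt0.
  have E1 : 1 <= E by rewrite -expR0 ler_expR mulr_ge0 // ltW.
  have la0 : 0 <= la by apply: divr_ge0; [apply: mulr_ge0 => //|]; exact: sqr_ge0.
  have e1 : be * n%:R / r <= 4 * M ^+ 2 / r ^+ 2.
    rewrite /be; have -> : 4 * M / r * n%:R / r = 4 * M * n%:R / r ^+ 2 by field; rewrite gt_eqF.
    rewrite ler_wpM2r ?invr_ge0 ?sqr_ge0 // expr2 mulrA ler_wpM2l ?mulr_ge0 ?ler0n //.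
    by rewrite ler_nat.
  have q0 : 0 <= 1 - 2 * G / r.
    by rewrite subr_ge0 ler_pdivrMr // mul1r; lra.
  have [h|h] := leP (1 / 4) (1 - 2 * G / r).
    have : 4 * M ^+ 2 / r ^+ 2 <= be ^+ 2 * (1 - 2 * G / r).
      have -> : 4 * M ^+ 2 / r ^+ 2 = be ^+ 2 * (1 / 4) by rewrite /be; field; rewrite gt_eqF.
      by rewrite ler_wpM2l ?sqr_ge0.
    move=> h2; apply: addr_ge0; apply: mulr_ge0 => //; first by lra.
      exact: ltW.
    by lra.
  have G3 : 3 / 8 * r <= G.
    have : 2 * G / r > 3 / 4 by lra.
    by rewrite ltr_pdivlMr //; lra.
  have : 3 / 2 <= be * G.
    apply: (@le_trans _ _ (be * (3 / 8 * r))); last by rewrite ler_wpM2l // ltW.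
    have -> : be * (3 / 8 * r) = 3 / 2 * M by rewrite /be; field; rewrite gt_eqF.
    by lra.
  have := @expR_ge1Dx R (be * G); rewrite -/E => hE1 hE2.
  have E2 : E / 2 <= E - 1 by lra.
  have h3 : la * (E / 2) <= la * (E - 1) by rewrite ler_wpM2l.
  have h4 : la * (E / 2) = E * (4 * M ^+ 2 / r ^+ 2) by rewrite /la; field; rewrite gt_eqF.
  have h5 : 0 <= E * (4 * M ^+ 2 / r ^+ 2 - be * n%:R / r) by rewrite mulr_ge0 ?(ltW E0) // subr_ge0.
  have h6 : 0 <= E * (be ^+ 2 * (1 - 2 * G / r)) by rewrite mulr_ge0 ?(ltW E0) // mulr_ge0 // sqr_ge0.
  by rewrite mulrBr; move: h5; rewrite mulrBr; lra.
suff main : forall s z, t1 <= s <= t -> Om (s, z) -> w s z <= 0.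
  have hdx : 0 < g t x by rewrite gE depth_gt0.
  have := main t x; rewrite t1t lexx => /(_ isT hdx); rewrite /w subr_le0; apply: le_trans.
  rewrite /v -(gE t x); set G := g t x in hdx *.
  have h : be * G <= expR (be * G) - 1 by have := @expR_ge1Dx R (be * G); lra.
  have -> : kappa * expR (- (2 * M)) * expR (- (la * (t - t1))) * G = A * (expR (- (la * (t - t1))) * (be * G)).
    by rewrite /A; field; rewrite gt_eqF.
  by apply: ler_wpM2l => //; apply: ler_wpM2l => //; exact: expR_ge0.
apply: max_principle; first exact: open_moving_ball.
- move=> e e0.
  pose K1 := [set p : R * 'rV[R]_n | t1 <= p.1 <= t /\ 0 <= ball_depth r a 0 p.1 p.2] `&` [set p | e <= v p.1 p.2].
  have cK1 : compact K1.
    apply: compact_superlevel; first exact: compact_moving_ball.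
    by move=> -[s z] _; have [? [? [? [j _]]]] := jv s z; exact: jet_continuous_at j.
  have K1Om p : K1 p -> [/\ t1 <= p.1 <= t, Om p & D p.2].
    move=> [[hs hd] hv]; have hd' : 0 < ball_depth r a 0 p.1 p.2.
      rewrite lt_neqAle hd andbT; apply/eqP => h; move: hv.
      by rewrite /= /v /g -h mulr0 expR0 subrr !mulr0; move/(lt_le_trans e0); rewrite ltxx.
    by split => //; exact: inD hd'.
  rewrite (_ : mkset _ = K1 `&` [set p | e <= w p.1 p.2]).
    apply: compact_superlevel => // -[s z] /K1Om [/= /andP [hs _] _ Dz].
    have s0 : 0 < s by exact: lt_le_trans hs.
    have [? [? [? [j _]]]] := jv s z; have [? [? jp]] := jet_pD oD hpD s0 Dz Dy.
    exact: jet_continuous_at (jet_sub j jp).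
  apply/seteqP; split => -[s z] /=; last by move=> [/K1Om [h3 h4 _] h2].
  move=> [hs hO hw]; split => //; split; first by split => //; exact: ltW.
  apply: (le_trans hw); rewrite /w gerBl; apply: (pD_ge0 hpD) => //; last exact: inD hO.
  by case/andP: hs => h _; exact: lt_le_trans h.
- move=> z hz; rewrite subr_le0; have hz' : enorm (z - a) < r by rewrite -depth_gt0 // -(gE t1).
  apply: le_trans (hk z hz'); rewrite /v subrr mulr0 oppr0 expR0 mul1r gE -(gE t1).
  move: (gr t1 z) (hz); rewrite /Om /= -/(g t1 z); set G := g t1 z => Gr G0.
  have h : expR (be * G) - 1 <= be * G * expR (2 * M).
    have h1 : be * G <= 2 * M.
      apply: (@le_trans _ _ (be * (r / 2))); first by rewrite ler_wpM2l // ltW.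
      by rewrite le_eqVlt; apply/orP; left; apply/eqP; rewrite /be; field; rewrite gt_eqF.
    have h2 : expR (be * G) - 1 <= be * G * expR (be * G).
      have := expRN_ge (be * G); rewrite expRN.
      set E := expR (be * G); have E0 : 0 < E by exact: expR_gt0.
      move=> h; have : (1 - be * G) * E <= E^-1 * E by rewrite ler_wpM2r // ltW.
      by rewrite mulVf ?gt_eqF //; lra.
    apply: (le_trans h2); apply: ler_wpM2l; first by rewrite mulr_ge0 // ltW.
    by rewrite ler_expR.
  have -> : kappa * G = A * (be * G * expR (2 * M)).
    rewrite /A expRN; field; rewrite !gt_eqF ?expR_gt0 //.
  exact: ler_wpM2l.
- move=> s z /andP [hs _] hO _.
  have s0 : 0 < s by exact: lt_le_trans hs.
  have [? [? [? [j hj]]]] := jv s z; have [? [? jp]] := jet_pD oD hpD s0 (inD _ _ hO) Dy.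
  do 3 eexists; split; first exact: (jet_sub j jp).
  by rewrite lerD2r hj // ltW.
Qed.

End LowerBounds.

(** * Strictly convex C11 domains *)

Section Boundary.
Context {R : realType} {n : nat}.
Implicit Types (D : set 'rV[R]_n) (x y z w nu : 'rV[R]_n).

Lemma closure_enormP D x : closure D x <-> forall r, 0 < r -> exists2 z, D z & enorm (z - x) < r.
Proof.
split=> [h r r0|h B /nbhs_enormP [r r0 hr]].
  have [|z [Dz zr]] := h [set z | enorm (z - x) < r]; last by exists z.
  by apply/nbhs_enormP; exists r.
by have [z Dz zr] := h r r0; exists z; split => //; exact: hr.
Qed.

Lemma open_enormP D x : open D -> D x -> exists2 r, 0 < r & forall z, enorm (z - x) < r -> D z.
Proof. by move=> oD Dx; apply/nbhs_enormP; exact: open_nbhs_nbhs. Qed.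

Lemma boundary_openP D w : open D -> boundary D w <-> closure D w /\ ~ D w.
Proof. by move=> oD; rewrite /boundary (iffLR (interior_id _) oD). Qed.

Lemma closed_boundary D : closed (boundary D).
Proof.
rewrite /boundary setDE; apply: closedI; first exact: closed_closure.
by apply: open_closedC; exact: open_interior.
Qed.

Lemma segment_crosses_boundary D x z : open D -> D x -> ~ D z ->
  exists2 s, 0 < s <= 1 & boundary D (x + s *: (z - x)).
Proof.
move=> oD Dx nDz; pose g s := x + s *: (z - x).
pose A := [set s : R | 0 <= s <= 1 /\ ~ D (g s)].
have A1 : A 1 by split; rewrite ?ler01 ?lexx // /g scale1r addrC subrK.
have lA : has_lbound A by exists 0 => s [/andP []].
have hA : has_inf A by split => //; exists 1.
pose s0 := inf A.
have s00 : 0 <= s0 by apply: lb_le_inf; [exists 1|move=> s [/andP []]].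
have s01 : s0 <= 1 by exact: ge_inf.
pose c := enorm (z - x) + 1; have c0 : 0 < c by rewrite ltr_wpDl ?enorm_ge0.
have gd s s' : enorm (g s - g s') <= `|s - s'| * c.
  have -> : g s - g s' = (s - s') *: (z - x) by apply/rowP => i; rewrite !mxE; ring.
  by rewrite enormZ ler_wpM2l // lerDl.
have nD0 : ~ D (g s0).
  move=> Ds0; have [r r0 hr] := open_enormP oD Ds0.
  have [a Aa ha] := inf_adherent (divr_gt0 r0 c0) hA.
  have s0a : s0 <= a by exact: ge_inf.
  have [_ nDa] := Aa; apply: nDa; apply: hr.
  apply: (le_lt_trans (gd _ _)); rewrite -ltr_pdivlMr // ger0_norm ?subr_ge0 //.
  by rewrite ltrBlDl.
have s0p : 0 < s0.
  rewrite lt_neqAle s00 andbT; apply/eqP => h; apply: nD0.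
  by rewrite -h /g scale0r addr0.
exists s0; first by rewrite s0p s01.
apply/boundary_openP => //; split => //; apply/closure_enormP => r r0.
pose s := Num.max 0 (s0 - r / (2 * c)).
have rc : 0 < r / (2 * c) by rewrite divr_gt0 // mulr_gt0.
have ss0 : s < s0 by rewrite gt_max s0p gtrBl.
have s_ge : 0 <= s by rewrite le_max lexx.
exists (g s).
  apply: contrapT => nDs; have : s0 <= s.
    by apply: ge_inf => //; split => //; rewrite s_ge (le_trans (ltW ss0)).
  by rewrite leNgt ss0.
apply: (le_lt_trans (gd _ _)); rewrite -ltr_pdivlMr // distrC gtr0_norm ?subr_gt0 //.
have : s0 - r / (2 * c) <= s by rewrite le_max lexx orbT.
have : r / (2 * c) < r / c by rewrite ltr_pM2l // ltf_pV2 ?posrE ?mulr_gt0 // ltr_pMl // ltr1n.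
lra.
Qed.

Lemma bdist_le D x z : boundary D z -> bdist D x <= enorm (x - z).
Proof.
move=> bz; apply: ge_inf; last by exists z.
by exists 0 => _ [w _ <-]; exact: enorm_ge0.
Qed.

Lemma bdist_attained D x w0 : boundary D w0 ->
  exists2 w, boundary D w & bdist D x = enorm (x - w).
Proof.
move=> b0; pose K := boundary D `&` [set z | - enorm (x - w0) <= - enorm (z - x)].
have cK : compact K.
  apply: (@bounded_enorm_compact _ _ _ (enorm x + enorm (x - w0))).
    apply: closedI; first exact: closed_boundary.
    apply: compact_closed; first exact: norm_hausdorff.
    rewrite (_ : mkset _ = [set z | enorm z <= enorm x + enorm (x - w0)] `&` [set z | - enorm (x - w0) <= - enorm (z - x)]).
      apply: compact_superlevel; first exact: compact_enorm_le.
      move=> y _; apply: enorm_continuous_at => d d0; exists d => // z zr.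
      apply: le_lt_trans zr; rewrite opprK ler_norml (enorm_distC z y); apply/andP; split.
        by have := enorm_triangle y z x; rewrite (enorm_distC z y); lra.
      by have := enorm_triangle z y x; lra.
    apply/seteqP; split => z /=; last by case.
    by rewrite lerN2 => h; split => //; have := enormD (z - x) x; rewrite subrK; lra.
  move=> z [_ /=]; rewrite lerN2 => h; have := enormD (z - x) x; rewrite subrK; lra.
have [||w] := @EVT_min_rV R n (fun z => enorm (z - x)) K _ cK.
- by exists w0; split => //=; rewrite lerN2 enorm_distC.
- apply: continuous_in_subspaceT => y _; apply: enorm_continuous_at => d d0; exists d => // z zr.
  apply: le_lt_trans zr; rewrite ler_norml (enorm_distC z y); apply/andP; split.
    by have := enorm_triangle z y x; lra.
  by have := enorm_triangle y z x; rewrite (enorm_distC z y); lra.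
rewrite inE => -[bw /=]; rewrite lerN2 => hw hmin; exists w => //.
apply/eqP; rewrite eq_le bdist_le //=; apply: lb_le_inf.
  by exists (enorm (x - w0)), w0.
move=> _ [z bz <-]; rewrite !(enorm_distC x).
have [h|h] := leP (enorm (z - x)) (enorm (x - w0)).
  by apply: hmin; rewrite inE; split => //=; rewrite lerN2.
by apply: le_trans hw (ltW h).
Qed.

Lemma bdist_ge0 D x w0 : boundary D w0 -> 0 <= bdist D x.
Proof. by move=> b0; have [w _ ->] := bdist_attained x b0; exact: enorm_ge0. Qed.

Lemma bdist_lipschitz D x y w0 : boundary D w0 -> bdist D x <= bdist D y + enorm (x - y).
Proof.
move=> b0; have [w bw ->] := bdist_attained y b0.
by apply: (le_trans (bdist_le x bw)); have := enorm_triangle y x w; lra.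
Qed.

Lemma ball_bdist D x : open D -> D x -> ball_in D x (bdist D x).
Proof.
move=> oD Dx z hz; apply: contrapT => nDz.
have [s /andP [s0 s1] bs] := segment_crosses_boundary oD Dx nDz.
have := bdist_le x bs; rewrite opprD addrA subrr sub0r enormN enormZ gtr0_norm // => h.
have : s * enorm (z - x) <= enorm (z - x) by rewrite ler_piMl ?enorm_ge0.
lra.
Qed.

Lemma le_bdist D a rho w0 : open D -> boundary D w0 -> ball_in D a rho -> rho <= bdist D a.
Proof.
move=> oD b0 ha; have [w bw ->] := bdist_attained a b0; rewrite leNgt; apply/negP => h.
by have [_] := (boundary_openP w oD).1 bw; apply; apply: ha; rewrite enorm_distC.
Qed.

Lemma bdist_gt0 D x w0 : open D -> D x -> boundary D w0 -> 0 < bdist D x.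
Proof.
move=> oD Dx b0; have [r r0 hr] := open_enormP oD Dx.
exact: lt_le_trans r0 (le_bdist oD b0 hr).
Qed.

End Boundary.

(** * Supporting hyperplanes and tangent balls *)

Section Convex.
Context {R : realType} {n : nat} (D : set 'rV[R]_n).
Hypotheses (oD : open D) (sD : strictly_convex D).
Implicit Types (x y z w nu : 'rV[R]_n) (l r : R).

Lemma strict_comb x y l : closure D x -> closure D y -> x <> y -> 0 < l -> l < 1 ->
  D (l *: x + (1 - l) *: y).
Proof. by move=> cx cy xy l0 l1; apply: interior_subset; exact: sD. Qed.

Lemma closure_comb x y l : closure D x -> D y -> 0 <= l -> l < 1 -> D (l *: x + (1 - l) *: y).
Proof.
move=> cx Dy; rewrite le_eqVlt => /orP [/eqP <-|l0] l1; first by rewrite scale0r add0r subr0 scale1r.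
have [->|xy] := pselect (x = y); first by rewrite -scalerDl addrC subrK scale1r.
by apply: strict_comb => //; exact: subset_closure.
Qed.

Lemma convex_comb x y l : D x -> D y -> 0 <= l <= 1 -> D (l *: x + (1 - l) *: y).
Proof.
move=> Dx Dy /andP [l0]; rewrite le_eqVlt => /orP [/eqP ->|l1].
  by rewrite subrr scale0r addr0 scale1r.
by apply: closure_comb => //; exact: subset_closure.
Qed.

Lemma closure_convex x y l : closure D x -> closure D y -> 0 <= l <= 1 ->
  closure D (l *: x + (1 - l) *: y).
Proof.
move=> cx cy /andP [l0 l1]; apply/closure_enormP => r r0.
have [x' Dx' hx] := (closure_enormP D x).1 cx r r0.
have [y' Dy' hy] := (closure_enormP D y).1 cy r r0.
exists (l *: x' + (1 - l) *: y'); first by apply: convex_comb; rewrite ?l0.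
have -> : l *: x' + (1 - l) *: y' - (l *: x + (1 - l) *: y) = l *: (x' - x) + (1 - l) *: (y' - y).
  by apply/rowP => i; rewrite !mxE; ring.
apply: (le_lt_trans (enormD _ _)); rewrite !enormZ (ger0_norm l0) (ger0_norm (x := 1 - l)) ?subr_ge0 //.
move: l0; rewrite le_eqVlt => /orP [/eqP <-|l0]; first by rewrite mul0r add0r subr0 mul1r.
have h1 : l * enorm (x' - x) < l * r by rewrite ltr_pM2l.
have h2 : (1 - l) * enorm (y' - y) <= (1 - l) * r by rewrite ler_wpM2l ?subr_ge0 // ltW.
lra.
Qed.

(** The homothety of centre [w] and ratio [l] maps the ball of radius [bdist D p] around [p] into
    [D]. *)
Lemma bdist_comb w p l w0 : boundary D w0 -> closure D w -> D p -> 0 < l -> l <= 1 ->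
  l * bdist D p <= bdist D ((1 - l) *: w + l *: p).
Proof.
move=> b0 cw Dp l0 l1; apply: (le_bdist oD b0) => z hz.
pose Z := l^-1 *: (z - ((1 - l) *: w + l *: p)).
have -> : z = (1 - l) *: w + (1 - (1 - l)) *: (p + Z).
  apply/rowP => i; rewrite !mxE; field; rewrite gt_eqF //.
apply: closure_comb => //; rewrite ?subr_ge0 ?gtrBl //.
apply: (ball_bdist oD Dp); rewrite addrC addKr enormZ gtr0_norm ?invr_gt0 //.
by rewrite mulrC ltr_pdivrMr // mulrC.
Qed.

(* nu is the inner unit normal at w. *)
Definition two_balls w nu r := [/\ enorm nu = 1, ball_in D (w + r *: nu) r &
  forall z, enorm (z - (w - r *: nu)) < r -> ~ D z].

Lemma enorm1_dot nu : enorm nu = 1 -> dot nu nu = 1.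
Proof. by move=> h; rewrite -enorm_sqr h expr1n. Qed.

Lemma dot_sub_normal w nu x (a : R) : enorm nu = 1 ->
  dot (x - a *: nu - w) nu = dot (x - w) nu - a.
Proof. by move=> n1; rewrite addrAC (dotBl (x - w)) (dotZl a) (enorm1_dot n1) mulr1. Qed.

Lemma two_balls_le w nu r r' : 0 < r' -> r' <= r -> two_balls w nu r -> two_balls w nu r'.
Proof.
move=> r'0 rr [n1 h1 h2]; split => // z hz.
- apply: h1; apply: (le_lt_trans (enorm_triangle (w + r' *: nu) _ _)).
  have -> : w + r' *: nu - (w + r *: nu) = (r' - r) *: nu by apply/rowP => i; rewrite !mxE; ring.
  by rewrite enormZ n1 mulr1 ler0_norm ?subr_le0 //; lra.
- apply: h2; apply: (le_lt_trans (enorm_triangle (w - r' *: nu) _ _)).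
  have -> : w - r' *: nu - (w - r *: nu) = (r - r') *: nu by apply/rowP => i; rewrite !mxE; ring.
  rewrite enormZ n1 mulr1 ger0_norm ?subr_ge0 //; lra.
Qed.

(** If a point of [D] were strictly below the tangent hyperplane, the segment from [w] to it would
    enter the exterior ball near [w]. A point on the hyperplane could be pushed below it within the
    open set [D]. *)
Lemma supporting w nu r x : 0 < r -> boundary D w -> two_balls w nu r -> D x -> 0 < dot (x - w) nu.
Proof.
move=> r0 bw [n1 _ hext] Dx; have nn := enorm1_dot n1.
have [cw nDw] := (boundary_openP w oD).1 bw.
have key x' : D x' -> dot (x' - w) nu < 0 -> False.
  move=> Dx' hd; pose v := x' - w.
  have v0 : 0 < dot v v.
    rewrite lt_neqAle dot_ge0 andbT eq_sym; apply/eqP => /dot_eq0 e.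
    by move: hd; rewrite -/v e dot0l ltxx.
  pose s := Num.min (1 / 2) (- (r * dot v nu) / dot v v).
  have rd : 0 < - (r * dot v nu) by rewrite oppr_gt0 pmulr_rlt0.
  have s0 : 0 < s by rewrite lt_min !divr_gt0.
  have s1 : s <= 1 / 2 by rewrite ge_min lexx.
  have s2 : s * dot v v <= - (r * dot v nu) by rewrite -ler_pdivlMr // ge_min lexx orbT.
  have Ds : D (w + s *: v).
    have -> : w + s *: v = (1 - s) *: w + (1 - (1 - s)) *: x' by rewrite /v; apply/rowP => i; rewrite !mxE; ring.
    by apply: closure_comb => //; lra.
  apply: hext Ds; rewrite -(@ltr_pXn2r _ 2) ?nnegrE ?enorm_ge0 ?(ltW r0) // enorm_sqr.
  have -> : w + s *: v - (w - r *: nu) = s *: v + r *: nu by apply/rowP => i; rewrite !mxE; ring.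
  clearbody v; rewrite !dotE nn (dotC nu v); nra.
rewrite ltNge; apply/negP => hd.
have [e e0 he] := open_enormP oD Dx.
apply: (key (x - (e / 2) *: nu)).
  by apply: he; rewrite addrAC subrr add0r enormN enormZ n1 mulr1 gtr0_norm; lra.
by rewrite addrAC dotBl dotZl nn; lra.
Qed.

Lemma supporting_closure w nu r x : 0 < r -> boundary D w -> two_balls w nu r ->
  closure D x -> x <> w -> 0 < dot (x - w) nu.
Proof.
move=> r0 bw tw cx xw; have [cw _] := (boundary_openP w oD).1 bw.
have := supporting r0 bw tw (strict_comb cx cw xw (_ : 0 < 2^-1) _).
have -> : 2^-1 *: x + (1 - 2^-1) *: w - w = 2^-1 *: (x - w) by apply/rowP => i; rewrite !mxE; field.
by rewrite dotZl pmulr_rgt0 ?invr_gt0 //; apply; lra.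
Qed.

Lemma supporting_closure_ge0 w nu r x : 0 < r -> boundary D w -> two_balls w nu r ->
  closure D x -> 0 <= dot (x - w) nu.
Proof.
move=> r0 bw tw cx; have [->|xw] := pselect (x = w); first by rewrite subrr dot0l.
exact: ltW (supporting_closure r0 bw tw cx xw).
Qed.

(** The expanded form of [enorm (z - w - r *: nu) >= r]: a boundary point is outside the interior
    ball. *)
Lemma boundary_quadratic w nu r z : 0 < r -> two_balls w nu r -> boundary D z ->
  dot (z - w) nu <= dot (z - w) (z - w) / (2 * r).
Proof.
move=> r0 [n1 hin _] bz; rewrite ler_pdivlMr ?mulr_gt0 // leNgt; apply/negP => h.
have [_] := (boundary_openP z oD).1 bz; apply; apply: hin.
rewrite -(@ltr_pXn2r _ 2) ?nnegrE ?enorm_ge0 ?(ltW r0) // enorm_sqr opprD addrA.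
by move: (z - w) h => v; rewrite !dotE (enorm1_dot n1) (dotC nu v); lra.
Qed.

Lemma tangent_half_spaceP w nu r : 0 < r -> boundary D w -> two_balls w nu r ->
  tangent_half_space D w [set x | 0 < dot (x - w) nu].
Proof.
move=> r0 bw tw; have [n1 _ _] := tw; exists nu; split => //; last first.
  by move=> x Dx /=; apply: (supporting r0 bw tw).
split => //; apply/cvgrPdist_lt => e e0; rewrite near_withinE.
apply/nbhs_ballP; exists (r * e / n.+1%:R); first by rewrite /= !divr_gt0 ?mulr_gt0.
move=> z /= hz zw bz; rewrite sub0r normrN.
have zw' : z <> w by apply/eqP.
have en0 : 0 < enorm (z - w) by rewrite enorm_gt0 // subr_eq0.
have d0 : 0 <= dot (z - w) nu by apply: (supporting_closure_ge0 r0 bw tw); case: bz.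
rewrite ger0_norm ?divr_ge0 ?normr_ge0 ?enorm_ge0 // ger0_norm // ltr_pdivrMr //.
apply: (le_lt_trans (boundary_quadratic r0 tw bz)); rewrite -enorm_sqr expr2 ltr_pdivrMr ?mulr_gt0 //.
rewrite mulrAC ltr_pM2r //; move: hz; rewrite -ball_normE /= distrC ltr_pdivlMr ?ltr0n // mulrC => hz.
have := enorm_le_norm (z - w); have : n%:R * `|z - w| <= n.+1%:R * `|z - w| by rewrite ler_wpM2r // ler_nat.
have : 0 < r * e by rewrite mulr_gt0.
lra.
Qed.

(** A half-space bounded by a hyperplane through [w] and containing the interior ball at [w] has the
    normal of that ball: testing with points of the ball close to [w + r *: nu - r *: mu] gives
    [dot nu mu >= 1]. *)
Lemma tangent_half_space_unique w nu r H : 0 < r -> two_balls w nu r ->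
  tangent_half_space D w H -> H = [set x | 0 < dot (x - w) nu].
Proof.
move=> r0 [n1 hin _] [mu [[m1 _] -> hsub]].
suff -> : mu = nu by [].
have h e : 0 < e -> e < 1 -> 1 - e < dot nu mu.
  move=> e0 e1; have := hsub (w + r *: nu - ((1 - e) * r) *: mu).
  rewrite /= (_ : w + r *: nu - ((1 - e) * r) *: mu - w = r *: (nu - (1 - e) *: mu)); last first.
    by apply/rowP => i; rewrite !mxE; ring.
  rewrite dotZl pmulr_rgt0 // dotBl dotZl (enorm1_dot m1) mulr1 subr_gt0; apply; apply: hin.
  rewrite addrAC subrr add0r enormN enormZ m1 mulr1 gtr0_norm ?mulr_gt0 ?subr_gt0 //.
  by rewrite gtr_pMl //; lra.
have h1 : 1 <= dot nu mu.
  rewrite leNgt; apply/negP => h1.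
  have [h2|h2] := leP (dot nu mu) 0; first by have := h (1 / 2); lra.
  have := h (1 - dot nu mu); lra.
apply/eqP; rewrite -subr_eq0; apply/eqP/dot_eq0/eqP; rewrite eq_le dot_ge0 andbT.
rewrite !dotE (enorm1_dot m1) (enorm1_dot n1) (dotC mu nu); lra.
Qed.

Lemma bdist_half_space w nu x : enorm nu = 1 -> 0 <= dot (x - w) nu ->
  bdist [set x | 0 < dot (x - w) nu] x = dot (x - w) nu.
Proof.
move=> n1 hx; have nn := enorm1_dot n1; set H := [set x | _].
have oH : open H.
  rewrite openE => y /= hy; apply/nbhs_enormP; exists (dot (y - w) nu) => // z hz.
  rewrite /H /= (_ : z - w = (z - y) + (y - w)); last by rewrite addrA subrK.
  rewrite dotDl; have := normr_dot_le (z - y) nu; rewrite n1 mulr1 ler_norml; lra.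
have bH z : boundary H z <-> dot (z - w) nu = 0.
  split=> [/(boundary_openP z oH) [cz /negP]|hz].
    rewrite -leNgt => h; apply/eqP; rewrite eq_le h /= leNgt; apply/negP => h'.
    have [y hy] := (closure_enormP H z).1 cz (- dot (z - w) nu) ltac:(lra).
    move: hy; rewrite /H /= (_ : y - w = (y - z) + (z - w)); last by rewrite addrA subrK.
    by rewrite dotDl; have := dot_le_enorm (y - z) nu; rewrite n1 mulr1; lra.
  apply/boundary_openP => //; split; last by rewrite /H /= hz ltxx.
  apply/closure_enormP => r r0; exists (z + (r / 2) *: nu).
    by rewrite /H /= addrAC dotDl hz dotZl nn; lra.
  by rewrite addrC addKr enormZ n1 mulr1 gtr0_norm; lra.
apply/eqP; rewrite eq_le; apply/andP; split.
  have hb : boundary H (x - dot (x - w) nu *: nu).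
    by apply/bH; rewrite dot_sub_normal // subrr.
  by apply: (le_trans (bdist_le x hb)); rewrite opprB addrC subrK enormZ n1 mulr1 ger0_norm.
apply: lb_le_inf; first by exists (enorm (x - w)), w => //; apply/bH; rewrite subrr dot0l.
move=> _ [z /bH hz <-]; rewrite (_ : x - w = (x - z) + (z - w)); last by rewrite addrA subrK.
by rewrite dotDl hz addr0; have := dot_le_enorm (x - z) nu; rewrite n1 mulr1.
Qed.

Lemma bdist_le_supporting w nu r x : 0 < r -> boundary D w -> two_balls w nu r -> D x ->
  bdist D x <= dot (x - w) nu.
Proof.
move=> r0 bw tw Dx; have [n1 _ _] := tw; rewrite leNgt; apply/negP => h.
have := supporting r0 bw tw (ball_bdist oD Dx (z := x - dot (x - w) nu *: nu) _).
move=> h'; move: (h'); rewrite dot_sub_normal // subrr ltxx => h''; suff: false by []; apply: h''.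
rewrite addrAC subrr add0r enormN enormZ n1 mulr1 ger0_norm //.
exact: ltW (supporting r0 bw tw Dx).
Qed.

(** With [d = bdist D x = enorm (x - w)], the squared length of [x - w - d *: nu] is
    [2 d (d - dot (x - w) nu)], nonpositive by [bdist_le_supporting]. *)
Lemma nearest_normal w nu r x : 0 < r -> boundary D w -> two_balls w nu r -> D x ->
  bdist D x = enorm (x - w) -> x = w + bdist D x *: nu.
Proof.
move=> r0 bw tw Dx hd; have [n1 _ _] := tw.
have h := bdist_le_supporting r0 bw tw Dx.
apply/eqP; rewrite -subr_eq0 opprD addrA; apply/eqP/dot_eq0/eqP; rewrite eq_le dot_ge0 andbT.
have e : bdist D x ^+ 2 = dot (x - w) (x - w) by rewrite hd enorm_sqr.
have d0 : 0 <= bdist D x by exact: bdist_ge0 bw.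
move: (x - w) e h => v e h; rewrite !dotE (enorm1_dot n1) (dotC nu v) -e; nra.
Qed.

Lemma bdist_normal w nu r l : 0 < l -> l <= r -> boundary D w -> two_balls w nu r ->
  bdist D (w + l *: nu) = l.
Proof.
move=> l0 lr bw tw; have [n1 h1 _] := two_balls_le l0 lr tw.
apply/eqP; rewrite eq_le; apply/andP; split; last exact: le_bdist bw h1.
by apply: (le_trans (bdist_le _ bw)); rewrite addrAC subrr add0r enormZ n1 mulr1 gtr0_norm.
Qed.

(** A deep point is the centre of its own ball. A point at distance [d < rho] from the boundary lies
    on the normal at its nearest boundary point, and in the ball tangent there it has depth
    [d (2 rho - d) / (2 rho) >= d / 2]. *)
Lemma inscribed_ball x r rho w0 : (forall w, boundary D w -> exists nu, two_balls w nu r) ->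
  boundary D w0 -> 0 < rho -> rho <= r -> D x ->
  exists a, [/\ ball_in D a rho, enorm (x - a) < rho & Num.min (bdist D x) rho / 2 <= depth rho a x].
Proof.
move=> hr b0 rho0 rhor Dx; have r0 := lt_le_trans rho0 rhor.
have d0 := bdist_gt0 oD Dx b0.
have [h|h] := leP rho (bdist D x).
  exists x; split; rewrite ?subrr ?enorm0 //.
    by move=> z hz; apply: (ball_bdist oD Dx); exact: lt_le_trans h.
  rewrite /depth subrr dot0l subr0.
  by rewrite le_eqVlt; apply/orP; left; apply/eqP; field; rewrite gt_eqF.
have [w bw hw] := bdist_attained x b0; have [nu tw] := hr w bw.
have xw := nearest_normal r0 bw tw Dx hw; have [n1 h1 _] := two_balls_le rho0 rhor tw.
have xa : x - (w + rho *: nu) = (bdist D x - rho) *: nu.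
  by rewrite {1}xw; apply/rowP => i; rewrite !mxE; ring.
exists (w + rho *: nu); split => //.
  by rewrite xa enormZ n1 mulr1 ltr0_norm; lra.
rewrite /depth xa dotZl dotZr (enorm1_dot n1) mulr1 ler_pdivlMr ?mulr_gt0 //.
move: (bdist D x) d0 h => d d0 h; nra.
Qed.

End Convex.

(** * Interior and exterior balls of a C11 boundary *)

Section Smoothness.
Context {R : realType} {n : nat}.
Implicit Types (phi : 'rV[R]_n -> R) (x h : 'rV[R]_n).

Lemma C11_taylor phi : C11_function phi ->
  exists2 M, 0 < M & forall x, exists G, forall h,
    `|phi (x + h) - phi x - dot h G| <= M * enorm h ^+ 2.
Proof.
move=> [dphi lphi].
have [M [M0 hM]] : exists M : R, 0 < M /\ forall i x y,
    `|'D_(basis_vec R i) phi x - 'D_(basis_vec R i) phi y| <= M * `|x - y|.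
  have h : \forall M \near +oo, forall i : 'I_n,
      M.-lipschitz_on ('D_(basis_vec R i) phi) (globally (setT `*` setT)).
    by apply: filter_forall => i; exact: lphi.
  have h' : \forall M \near +oo, 0 < M :> R by exact: nbhs_pinfty_gt.
  have [M [M0 h1]] := filter_ex (filterI h' h).
  exists M; split => // i x y; exact: (h1 i (x, y)).
exists (n.+1%:R * M); first by rewrite mulr_gt0.
move=> x; exists (\row_i 'D_(basis_vec R i) phi x) => h.
have dE y : 'D_h phi y = \sum_i h 0 i * 'D_(basis_vec R i) phi y.
  rewrite deriveE // [in LHS](row_sum_delta h) linear_sum; apply: eq_bigr => i _.
  by rewrite linearZ /= deriveE.
have der s : is_derive s (1 : R) (fun s => phi (x + s *: h)) ('D_h phi (x + s *: h)).
  by apply: is_derive_along; exact: diff_derivable.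
have [|c] := @MVT R (fun s => phi (x + s *: h)) (fun s => 'D_h phi (x + s *: h)) 0 1 ltr01
  (fun s _ => der s).
  apply: continuous_subspaceT => s; exact: is_derive1_continuous (der s).
rewrite in_itv /= => /andP [c0 c1]; rewrite scale1r scale0r addr0 subr0 mulr1 dE => ->.
rewrite /dot -sumrB; apply: (le_trans (ler_norm_sum _ _ _)).
apply: (@le_trans _ _ (\sum_(i < n) M * enorm h ^+ 2)).
  apply: ler_sum => i _; rewrite mxE -mulrBr normrM expr2 mulrCA.
  apply: ler_pM => //; first exact: coord_le_enorm.
  apply: (le_trans (hM i _ _)); apply: ler_wpM2l; first exact: ltW.
  rewrite addrAC subrr add0r; apply: (le_trans (norm_le_enorm _)).
  by rewrite enormZ gtr0_norm // ler_piMl ?enorm_ge0 // ltW.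
rewrite sumr_const card_ord -[X in X <= _]mulr_natl mulrA.
by apply: ler_wpM2r; rewrite ?sqr_ge0 // ler_wpM2r ?ler_nat // ltW.
Qed.

End Smoothness.

Section Balls.
Context {R : realType} {n : nat} (D : set 'rV[R]_n).
Hypotheses (oD : open D).
Implicit Types (x y z w nu e : 'rV[R]_n).

Let proj e x := x - dot x e *: e.

(** [F] is a defining function of [D] with derivative [- dot v N] at [w] and Taylor error
    [M |v| ^ 2], and [dot N e = 1] gives [enorm N >= 1]. A point [w + v] of the interior ball
    satisfies [|v| ^ 2 < 2 r dot v nu], so that for [2 r M <= 1] the linear term decides the sign of
    [F]; the exterior ball is the same with [- nu]. *)
Lemma C11_two_balls z : C11_set D -> boundary D z -> exists r delta : R,
  [/\ 0 < r, 0 < delta & forall w, boundary D w -> enorm (w - z) < delta -> exists nu, two_balls D w nu r].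
Proof.
move=> cD bz; have [e [phi [e1 cphi /nbhs_enormP [eta eta0 hD]]]] := cD z bz.
have [M M0 hM] := C11_taylor cphi; have ee := enorm1_dot e1.
pose F x := phi (proj e x) - dot x e.
have hF x : enorm (x - z) < eta -> D x <-> F x < 0 by move=> hx; rewrite subr_lt0; exact: hD.
pose r := Num.min (2 * M)^-1 (eta / 8).
have r0 : 0 < r by rewrite lt_min invr_gt0 !mulr_gt0.
have r1 : 2 * r * M <= 1.
  have : r <= (2 * M)^-1 by rewrite ge_min lexx.
  by rewrite -(ler_pM2r (x := 2 * M)) ?mulr_gt0 // mulVf ?gt_eqF ?mulr_gt0 //; lra.
have r2 : r <= eta / 8 by rewrite ge_min lexx orbT.
exists r, (eta / 2); split => //; first by lra.
move=> w bw wz; have [cw nDw] := (boundary_openP w oD).1 bw.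
have [G hG] := hM (proj e w).
pose N := e - proj e G.
have Ne : dot N e = 1.
  have gen A : dot (e - (A - dot A e *: e)) e = 1 by rewrite !dotE ee; ring.
  exact: gen.
have Ft v : `|F (w + v) - F w + dot v N| <= M * dot v v.
  have pv : proj e (w + v) = proj e w + proj e v.
    by rewrite /proj dotDl; apply/rowP => i; rewrite !mxE; ring.
  have h := hG (proj e v).
  have -> : F (w + v) - F w + dot v N = phi (proj e w + proj e v) - phi (proj e w) - dot (proj e v) G.
    have gen A B : dot A (e - (B - dot B e *: e)) = dot A e - dot (A - dot A e *: e) B.
      by rewrite !dotE (dotC e B); ring.
    by rewrite /F pv /N gen -/(proj e v) dotDl; ring.
  apply: (le_trans h); apply: ler_wpM2l; first exact: ltW.
  rewrite enorm_sqr.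
  have gen A : dot (A - dot A e *: e) (A - dot A e *: e) <= dot A A.
    by rewrite !dotE ee (dotC e A); have := sqr_ge0 (dot A e); lra.
  exact: gen.
have Nn : 1 <= enorm N by have := dot_le_enorm N e; rewrite Ne e1 mulr1.
have Fw : F w = 0.
  apply/eqP; rewrite eq_le; apply/andP; split; last first.
    by rewrite leNgt; apply/negP => h; apply: nDw; apply/hF => //; lra.
  rewrite leNgt; apply/negP => Fp.
  have K0 : 0 < enorm N + M by lra.
  have d0 : 0 < Num.min (Num.min 1 (eta / 2)) (F w / (enorm N + M)) by rewrite !lt_min ltr01 !divr_gt0.
  have [x Dx] := (closure_enormP D w).1 cw _ d0.
  rewrite !lt_min => /andP [/andP [x1 x2]]; rewrite ltr_pdivlMr // => x3.
  have xz : enorm (x - z) < eta by have := enorm_triangle w x z; lra.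
  have := (hF x xz).1 Dx; have := Ft (x - w); rewrite (addrC w) subrK -enorm_sqr.
  have := dot_le_enorm (x - w) N; move: (enorm_ge0 (x - w)) x1 x3.
  move: (enorm (x - w)) (enorm N) (dot (x - w) N) K0 Nn => a b c K0 Nn a0 a1 a2 hc.
  rewrite ler_norml => /andP [h1 h2] h3.
  have : M * a ^+ 2 <= M * a by apply: ler_wpM2l; [exact: ltW|rewrite expr2; apply: ler_piMr => //; exact: ltW].
  lra.
pose nu := (enorm N)^-1 *: N.
have N0 : 0 < enorm N by lra.
have nu1 : enorm nu = 1 by rewrite enormZ gtr0_norm ?invr_gt0 // mulVf ?gt_eqF.
have dN v : dot v N = enorm N * dot v nu by rewrite /nu dotZr mulrA mulfV ?gt_eqF // mul1r.
have vsq (v : 'rV[R]_n) (s : R) : s ^+ 2 = 1 -> enorm (v - (s * r) *: nu) < r -> dot v v < 2 * r * (s * dot v nu).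
  move=> s1; rewrite -(@ltr_pXn2r _ 2) ?nnegrE ?enorm_ge0 ?(ltW r0) // enorm_sqr.
  have gen (B : 'rV[R]_n) : dot B B = 1 -> dot (v - (s * r) *: B) (v - (s * r) *: B) = dot v v - 2 * r * (s * dot v B) + s ^+ 2 * r ^+ 2.
    by move=> hB; rewrite !dotE hB (dotC B v); ring.
  by rewrite gen ?(enorm1_dot nu1) // s1; lra.
have vz (v : 'rV[R]_n) (s : R) : s ^+ 2 = 1 -> enorm (v - (s * r) *: nu) < r -> enorm (w + v - z) < eta.
  move=> s1 h; have h1 : enorm ((s * r) *: nu) = r.
    rewrite enormZ nu1 mulr1 normrM (gtr0_norm r0) -(sqrtr_sqr s) s1 sqrtr1 mul1r //.
  have := enormD (v - (s * r) *: nu) ((s * r) *: nu); rewrite subrK h1 => h2.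
  have := enormD v (w - z); rewrite addrA (addrC v) => h3; lra.
exists nu; split => // p hp.
- have hv : enorm (p - w - (1 * r) *: nu) < r by rewrite mul1r -addrA -opprD.
  have s1 : (1 : R) ^+ 2 = 1 by rewrite expr1n.
  have := vz _ _ s1 hv; have := vsq _ _ s1 hv; have := Ft (p - w); rewrite (addrC w) subrK Fw subr0 dN.
  move: (dot_ge0 (p - w)) => ? h1 h2 /hF ->; move: h1; rewrite ler_norml => /andP [_ h1].
  have q0 : 0 < dot (p - w) nu.
    rewrite ltNge; apply/negP => hh; have : 2 * r * dot (p - w) nu <= 0 by apply: mulr_ge0_le0 => //; lra.
    lra.
  have h3 : M * dot (p - w) (p - w) < M * (2 * r * (1 * dot (p - w) nu)) by rewrite ltr_pM2l.
  have h4 : (2 * r * M) * dot (p - w) nu <= 1 * dot (p - w) nu by apply: ler_wpM2r => //; exact: ltW.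
  have h5 : 1 * dot (p - w) nu <= enorm N * dot (p - w) nu by apply: ler_wpM2r => //; exact: ltW.
  lra.
- have hv : enorm (p - w - (-1 * r) *: nu) < r.
    by rewrite mulN1r scaleNr opprK -addrA (_ : - w + _ = - (w - r *: nu)) // opprB addrC.
  have s1 : (-1 : R) ^+ 2 = 1 by rewrite sqrrN expr1n.
  have := vz _ _ s1 hv; have := vsq _ _ s1 hv; have := Ft (p - w); rewrite (addrC w) subrK Fw subr0 dN.
  move: (dot_ge0 (p - w)) => ? h1 h2 /hF ->; move: h1; rewrite ler_norml => /andP [h1 _].
  have q0 : 0 < - dot (p - w) nu.
    rewrite ltNge; apply/negP => hh; have : 2 * r * - dot (p - w) nu <= 0 by apply: mulr_ge0_le0 => //; lra.
    lra.
  have h3 : M * dot (p - w) (p - w) < M * (2 * r * (-1 * dot (p - w) nu)) by rewrite ltr_pM2l.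
  have h4 : (2 * r * M) * - dot (p - w) nu <= 1 * - dot (p - w) nu by apply: ler_wpM2r => //; exact: ltW.
  have h5 : 1 * - dot (p - w) nu <= enorm N * - dot (p - w) nu by apply: ler_wpM2r => //; exact: ltW.
  lra.
Qed.

(** Compactness of the boundary turns local radii into a uniform one; by [two_balls_le] the property
    passes to all smaller radii, so it holds for small [i > 0] near each boundary point. *)
Lemma uniform_two_balls (K : R) : C11_set D -> (forall w, boundary D w -> enorm w <= K) ->
  exists2 r, 0 < r & forall w, boundary D w -> exists nu, two_balls D w nu r.
Proof.
move=> cD hK; have cB : compact (boundary D).
  by apply: bounded_enorm_compact hK; exact: closed_boundary.
pose P (r : R) w := boundary D w -> exists nu, two_balls D w nu r.
have hP : forall w, boundary D w -> \forall w' \near w & i \near (0^'+ : set_system R), P i w'.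
  move=> z bz; have [r [d [r0 d0 h]]] := C11_two_balls cD bz.
  exists ([set w | enorm (w - z) < d], [set i | 0 < i <= r]).
    split; first by apply/nbhs_enormP; exists d.
    near=> i => /=; apply/andP; split; near: i; first exact: nbhs_right_gt.
    exact: nbhs_right_le.
  move=> [w i] /= [wd /andP [i0 ir]] bw; have [nu tw] := h w bw wd.
  by exists nu; exact: two_balls_le tw.
have h1 := (compact_near_coveringP _).1 cB R _ P (at_right_proper_filter 0) hP.
have h2 : \forall i \near (0^'+ : set_system R), 0 < i by exact: nbhs_right_gt.
have [r [h hr]] := @filter_ex _ _ (at_right_proper_filter 0) _ (filterI h1 h2).
by exists r => // w bw; exact: h.
Unshelve. all: end_near. Qed.

End Balls.

(** * The quotient Q_D *)

Section Recession.
Context {R : realType} {n : nat} (D : set 'rV[R]_n).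
Hypotheses (oD : open D) (sD : strictly_convex D).
Implicit Types (x y z w nu e : 'rV[R]_n).

(** Otherwise each direction has a neighbourhood avoided by all sufficiently far points of [A], and
    compactness of the sphere leaves no direction for them. *)
Lemma asymptotic_direction (A : set 'rV[R]_n) w :
  (forall N : R, exists2 z, A z & N < enorm (z - w)) ->
  exists2 e, enorm e = 1 & forall N eps : R, 0 < eps ->
    exists z, [/\ A z, N < enorm (z - w) & enorm ((enorm (z - w))^-1 *: (z - w) - e) < eps].
Proof.
move=> hA; pose S := [set e : 'rV[R]_n | enorm e = 1].
have cS : compact S.
  apply: (@bounded_enorm_compact _ _ _ 1) => [|x /= ->//].
  rewrite (_ : S = @enorm R n @^-1` [set 1]) //.
  by apply: closed_comp; [move=> x _; exact: enorm_continuous|exact: closed_eq].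
apply: contrapT => hN.
pose P (N : R) e := forall z, A z -> N < enorm (z - w) -> (enorm (z - w))^-1 *: (z - w) <> e.
have hP e : S e -> \forall e' \near e & N \near (+oo : set_system R), P N e'.
  move=> Se; have [N [eps [eps0 h]]] : exists N eps : R, 0 < eps /\ forall z, A z -> N < enorm (z - w) ->
     ~ (enorm ((enorm (z - w))^-1 *: (z - w) - e) < eps).
    apply: contrapT => h; apply: hN; exists e => // N eps eps0.
    apply: contrapT => h'; apply: h; exists N, eps; split => // z Az Nz zd.
    by apply: h'; exists z.
  exists ([set e' | enorm (e' - e) < eps], [set M | N < M]).
    split; first by apply/nbhs_enormP; exists eps.
    by apply: nbhs_pinfty_gt; exact: num_real.
  move=> [e' M] /= [h1 h2] z Az Mz ze; apply: (h z Az (lt_trans h2 Mz)); by rewrite ze.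
have h1 := (compact_near_coveringP _).1 cS R _ P proper_pinfty_nbhs hP.
have h2 : \forall N \near (+oo : set_system R), 0 < N by exact: nbhs_pinfty_gt.
have [N [h N0]] := @filter_ex _ _ proper_pinfty_nbhs _ (filterI h1 h2).
have [z Az Nz] := hA N; have z0 := lt_trans N0 Nz.
apply: (h ((enorm (z - w))^-1 *: (z - w)) _ z Az Nz erefl).
by rewrite /S /= enormZ gtr0_norm ?invr_gt0 // mulVf // gt_eqF.
Qed.

(** As [z] runs to infinity, the point at ratio [s / enorm (z - w)] on the segment from [p] to [z]
    tends to [p + s *: e]. *)
Lemma recession w e p (s : R) : (forall N eps : R, 0 < eps ->
    exists z, [/\ closure D z, N < enorm (z - w) & enorm ((enorm (z - w))^-1 *: (z - w) - e) < eps]) ->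
  closure D p -> 0 <= s -> closure D (p + s *: e).
Proof.
move=> he cp s0; apply: (closed_closure (A := D)) => /=.
have [->|sn] := eqVneq s 0; first by rewrite scale0r addr0; exact: subset_closure.
have sp : 0 < s by rewrite lt_neqAle eq_sym sn.
apply/closure_enormP => r r0.
pose N := s + s * enorm (w - p) / (r / 2).
have N0 : 0 <= s * enorm (w - p) / (r / 2) by rewrite divr_ge0 ?mulr_ge0 ?enorm_ge0 //; lra.
have [z [cz Nz hz]] := he N (r / 2 / s) ltac:(by rewrite !divr_gt0).
set L := enorm (z - w) in Nz hz; have L0 : 0 < L by rewrite /N in Nz; lra.
exists (s / L *: z + (1 - s / L) *: p).
  apply: (closure_convex sD cz cp); rewrite divr_ge0 ?(ltW L0) //= ler_pdivrMr // mul1r.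
  by rewrite /N in Nz; lra.
have -> : s / L *: z + (1 - s / L) *: p - (p + s *: e) = s *: (L^-1 *: (z - w) - e) + (s / L) *: (w - p).
  by apply/rowP => i; rewrite !mxE; ring.
apply: (le_lt_trans (enormD _ _)); rewrite !enormZ !gtr0_norm ?divr_gt0 //.
rewrite ltr_pdivlMr // mulrC in hz.
have : s / L * enorm (w - p) <= r / 2.
  rewrite mulrAC ler_pdivrMr // [r / 2 * L]mulrC -ler_pdivrMr; last by lra.
  by rewrite /N in Nz; lra.
lra.
Qed.

(** Used to show that the boundary of an unbounded [D] is unbounded. If the ray from
    [p = z0 + s *: e] in direction [g = w0 - z0] stayed in [D], then [w0 + g] would be in the
    closure and [w0], its midpoint with [z0], in [D] by strict convexity. The ray therefore leaves
    [D], and [dot e g >= 0] keeps the exit point at distance at least [s] from [z0]. *)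
Lemma far_boundary w0 z0 e (s : R) : boundary D w0 -> boundary D z0 -> w0 <> z0 ->
  (forall p s, closure D p -> 0 <= s -> closure D (p + s *: e)) -> enorm e = 1 ->
  0 <= dot e (w0 - z0) -> 0 < s -> exists2 z, boundary D z & s <= enorm (z - z0).
Proof.
move=> bw bz wz he e1 eg s0; pose g := w0 - z0.
have [cw nDw] := (boundary_openP w0 oD).1 bw; have [cz nDz] := (boundary_openP z0 oD).1 bz.
have e0 : e <> 0 by move=> h; move: e1; rewrite h enorm0 => /esym /eqP; rewrite oner_eq0.
pose p := z0 + s *: e.
have Dp : D p.
  have -> : p = 2^-1 *: z0 + (1 - 2^-1) *: (z0 + (2 * s) *: e).
    by apply/rowP => i; rewrite /p !mxE; field.
  apply: (strict_comb sD); [by []|by apply: he => //; lra| |lra|lra].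
  move=> /eqP; rewrite eq_sym -subr_eq0 addrAC subrr add0r scaler_eq0 => /orP [|/eqP //].
  by rewrite mulf_eq0 => /orP [|/eqP]; [rewrite pnatr_eq0|lra].
have [tau tau0 ht] : exists2 tau : R, 0 < tau & ~ D (p + tau *: g).
  apply: contrapT => h.
  have hg tau : 0 < tau -> D (p + tau *: g).
    by move=> h0; apply: contrapT => h'; apply: h; exists tau.
  have cg : closure D (w0 + g).
    apply/closure_enormP => r r0.
    pose tau := 1 + enorm (p - w0) / (r / 2).
    have tau1 : 0 <= enorm (p - w0) / (r / 2) by rewrite divr_ge0 ?enorm_ge0 //; lra.
    have tau0 : 0 < tau by rewrite /tau; lra.
    have it1 : tau^-1 <= 1 by rewrite invf_le1 // /tau; lra.
    exists (tau^-1 *: (p + (2 * tau) *: g - tau *: g) + (1 - tau^-1) *: w0).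
      rewrite (_ : p + (2 * tau) *: g - tau *: g = p + tau *: g); last first.
        by apply/rowP => i; rewrite !mxE; ring.
      move: it1; rewrite le_eqVlt => /orP [/eqP ->|it1].
        by rewrite scale1r subrr scale0r addr0; exact: hg.
      rewrite addrC -[X in _ + X *: _](subKr 1).
      apply: (closure_comb sD) => //; [exact: hg|lra|].
      by rewrite gtrBl invr_gt0.
    have -> : tau^-1 *: (p + (2 * tau) *: g - tau *: g) + (1 - tau^-1) *: w0 - (w0 + g) = tau^-1 *: (p - w0).
      by apply/rowP => i; rewrite !mxE; field; rewrite gt_eqF.
    rewrite enormZ gtr0_norm ?invr_gt0 // mulrC ltr_pdivrMr //.
    have : r * (enorm (p - w0) / (r / 2)) = 2 * enorm (p - w0) by field; rewrite gt_eqF.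
    rewrite /tau; have := enorm_ge0 (p - w0); lra.
  apply: nDw; have -> : w0 = 2^-1 *: z0 + (1 - 2^-1) *: (w0 + g).
    by apply/rowP => i; rewrite /g !mxE; field.
  apply: (strict_comb sD); [by []|by []| |lra|lra].
  move=> h'; apply: wz; apply/rowP => i; have := congr1 (fun v : 'rV[R]_n => v 0 i) h'.
  by rewrite /g !mxE; lra.
have [sg /andP [sg0 _] bs] := segment_crosses_boundary oD Dp ht.
exists (p + sg *: (p + tau *: g - p)) => //.
have -> : p + sg *: (p + tau *: g - p) - z0 = s *: e + (sg * tau) *: g.
  by apply/rowP => i; rewrite /p !mxE; ring.
have sgt : 0 <= sg * tau by rewrite mulr_ge0 // ltW.
rewrite -(@ler_pXn2r _ 2) ?nnegrE ?enorm_ge0 ?(ltW s0) // enorm_sqr.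
rewrite -/g in eg; move: (sg * tau) sgt => a a0.
clearbody g; rewrite !dotE (enorm1_dot e1) (dotC g e).
have h1 : 0 <= 2 * (s * (a * dot e g)) by rewrite !mulr_ge0 // ltW.
have h2 : 0 <= a * (a * dot g g) by rewrite !mulr_ge0 // dot_ge0.
by rewrite expr2; lra.
Qed.

End Recession.

(** * Geometric consequences of a positive quotient *)

Section Quotient.
Context {R : realType} {n : nat} (D : set 'rV[R]_n).
Hypotheses (oD : open D) (sD : strictly_convex D) (cD : C11_set D).
Implicit Types (x y z w nu e : 'rV[R]_n).

Lemma normal_exists w : boundary D w -> exists nu, exists2 r, 0 < r & two_balls D w nu r.
Proof.
move=> bw; have [r [d [r0 d0 h]]] := C11_two_balls oD cD bw.
by have [|nu tw] := h w bw; rewrite ?subrr ?enorm0 //; exists nu, r.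
Qed.

Lemma midpointE x y : midpoint x y = 2^-1 *: x + (1 - 2^-1) *: y.
Proof. by apply/rowP => i; rewrite /midpoint !mxE; field. Qed.

Lemma midpoint_boundary w z : boundary D w -> boundary D z -> w <> z -> D (midpoint w z).
Proof.
move=> bw bz wz; rewrite midpointE; apply: (strict_comb sD); [by case: bw|by case: bz|by []|lra|lra].
Qed.

Lemma dot_midpoint_l w z nu : dot (midpoint w z - w) nu = dot (z - w) nu / 2.
Proof.
have -> : midpoint w z - w = 2^-1 *: (z - w) by apply/rowP => i; rewrite /midpoint !mxE; field.
by rewrite dotZl mulrC.
Qed.

Lemma midpointC x y : midpoint x y = midpoint y x.
Proof. by rewrite /midpoint addrC. Qed.

Lemma tangent_quotient w z nu r H : 0 < r -> two_balls D w nu r -> boundary D w -> boundary D z ->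
  w <> z -> tangent_half_space D w H -> bdist H (midpoint w z) = dot (z - w) nu / 2.
Proof.
move=> r0 tw bw bz wz tH; rewrite (tangent_half_space_unique r0 tw tH).
have [n1 _ _] := tw; rewrite bdist_half_space // dot_midpoint_l //.
apply: divr_ge0 => //; apply: (supporting_closure_ge0 oD sD r0 bw tw); by case: bz.
Qed.

Lemma QD_le w z nu r : 0 < r -> two_balls D w nu r -> boundary D w -> boundary D z -> w <> z ->
  QD D * (dot (z - w) nu / 2) <= bdist D (midpoint w z).
Proof.
move=> r0 tw bw bz wz.
have tH := tangent_half_spaceP oD sD r0 bw tw.
have p0 : 0 < dot (z - w) nu / 2.
  by apply: divr_gt0 => //; apply: (supporting_closure oD sD r0 bw tw); [case: bz|move=> h; apply: wz].
rewrite -ler_pdivlMr //; apply: ge_inf; last first.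
  exists w, z, [set x | 0 < dot (x - w) nu]; split => //.
  by rewrite (tangent_quotient r0 tw bw bz wz tH).
exists 0 => _ [w' [z' [H' [bw' bz' wz' tH' ->]]]].
have [nu' [r' r'0 tw']] := normal_exists bw'.
rewrite (tangent_quotient r'0 tw' bw' bz' wz' tH').
apply: divr_ge0; first exact: bdist_ge0 bw.
apply: divr_ge0 => //; apply: (supporting_closure_ge0 oD sD r'0 bw' tw'); by case: bz'.
Qed.

(* An unbounded D has a recession direction e, reached along boundary points z.  The normals
   satisfy dot e nu_z >= 0, while QD > 0 makes dot (z - w) nu_w at most a multiple of
   dot (w - z) nu_z; in the limit dot e nu_w <= 0, against strict convexity at w. *)
Lemma QD_bounded w0 z0 : boundary D w0 -> boundary D z0 -> w0 <> z0 -> 0 < QD D ->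
  exists K : R, forall x, D x -> enorm x <= K.
Proof.
move=> bw bz wz Q0; apply: contrapT => hK.
have cw : closure D w0 by case: bw.
have unb N : exists2 z, D z & N < enorm (z - w0).
  apply: contrapT => h; apply: hK; exists (N + enorm w0) => x Dx.
  rewrite leNgt; apply/negP => h'; apply: h; exists x => //.
  by have := enormD (x - w0) w0; rewrite subrK; lra.
have [e e1 he] := asymptotic_direction unb.
have rec p s : closure D p -> 0 <= s -> closure D (p + s *: e).
  apply: (recession sD (w := w0)) => N eps eps0; have [z [Dz h1 h2]] := he N eps eps0.
  by exists z; split => //; exact: subset_closure.
have unb2 (N : R) : exists2 z, boundary D z & N < enorm (z - w0).
  pose s := `|N| + enorm (w0 - z0) + 1.
  have s0 : 0 < s by rewrite /s; have := normr_ge0 N; have := enorm_ge0 (w0 - z0); lra.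
  have Ns := ler_norm N.
  (* The sign decides which of the two boundary points plays the part of [z0] in [far_boundary]. *)
  have [eg|eg] := leP 0 (dot e (w0 - z0)).
    have [z bz' hz] := far_boundary oD sD bw bz wz rec e1 eg s0; exists z => //.
    by have := enorm_triangle w0 z z0; rewrite /s in hz; lra.
  have eg' : 0 <= dot e (z0 - w0) by rewrite -opprB dotNr; lra.
  have [z bz' hz] := far_boundary oD sD bz bw (fun h => wz (esym h)) rec e1 eg' s0; exists z => //.
  by rewrite /s in hz; have := enorm_ge0 (w0 - z0); lra.
have [d d1 hd] := asymptotic_direction unb2.
have recd p s : closure D p -> 0 <= s -> closure D (p + s *: d).
  apply: (recession sD (w := w0)) => N eps eps0; have [z [[cz _] h1 h2]] := hd N eps eps0.
  by exists z.
have [nu [r r0 tw]] := normal_exists bw.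
have k0 : 0 < dot d nu.
  have := supporting_closure oD sD r0 bw tw (recd w0 1 cw ler01).
  rewrite scale1r addrAC subrr add0r; apply => /eqP; rewrite -subr_eq0 addrAC subrr add0r => /eqP h.
  by move: d1; rewrite h enorm0 => /esym /eqP; rewrite oner_eq0.
(* Half the value at which [QD * (dot d nu - eps)] equals [eps]: for [v] within [eps] of [d], the
   bound [QD * dot v nu <= - dot v mu < eps] is then impossible. *)
pose eps := QD D * dot d nu / (2 * (1 + QD D)).
have eps0 : 0 < eps by rewrite /eps divr_gt0 ?mulr_gt0 //; lra.
have [z [bz' z1 hz]] := hd 0 eps eps0.
have zw : w0 <> z by move=> h; move: z1; rewrite h subrr enorm0 ltxx.
have [mu [r' r'0 tz]] := normal_exists bz'; have [m1 _ _] := tz; have [n1 _ _] := tw.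
have m0 : 0 <= dot d mu.
  have cz : closure D z by case: bz'.
  have := supporting_closure_ge0 oD sD r'0 bz' tz (recd z 1 cz ler01).
  by rewrite scale1r addrAC subrr add0r.
have h1 := QD_le r0 tw bw bz' zw.
have h2 := bdist_le_supporting oD sD r'0 bz' tz (midpoint_boundary bw bz' zw).
rewrite midpointC dot_midpoint_l in h2; rewrite midpointC in h1.
set L := enorm (z - w0) in z1 hz; set v := L^-1 *: (z - w0) in hz.
have zv : z - w0 = L *: v by rewrite /v scalerA mulfV ?scale1r // gt_eqF.
rewrite -opprB zv dotNl dotZl in h2; rewrite zv dotZl in h1.
have h3 : QD D * dot v nu <= - dot v mu.
  rewrite -(ler_pM2l z1); lra.
have h4 := normr_dot_le (v - d) nu; have h5 := normr_dot_le (v - d) mu.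
rewrite n1 mulr1 dotBl ler_norml in h4; rewrite m1 mulr1 dotBl ler_norml in h5.
have h6 : QD D * (dot d nu - eps) <= QD D * dot v nu by apply: ler_wpM2l; lra.
have h7 : eps * (2 * (1 + QD D)) = QD D * dot d nu by rewrite /eps mulfVK // gt_eqF //; lra.
have : 0 < QD D * dot d nu by rewrite mulr_gt0.
lra.
Qed.

(** The ray from [w] through [y] leaves the bounded set [D] at a boundary point [z]. A homothety of
    centre [w] takes the midpoint of [w] and [z] to that of [w] and [y], and by [bdist_comb] the
    estimate of [QD_le] scales with its ratio. *)
Lemma QD_le_interior w0 z0 w y nu r : boundary D w0 -> boundary D z0 -> w0 <> z0 -> 0 < QD D ->
  0 < r -> two_balls D w nu r -> boundary D w -> D y ->
  QD D / 2 * dot (y - w) nu <= bdist D (midpoint w y).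
Proof.
move=> bw0 bz0 wz0 Q0 r0 tw bw Dy.
have [K hK] := QD_bounded bw0 bz0 wz0 Q0.
have [cw nDw] := (boundary_openP w oD).1 bw.
have yw : 0 < enorm (y - w).
  by rewrite enorm_gt0 // subr_eq0; apply/eqP => h; apply: nDw; rewrite -h.
pose S := (K + enorm y + 1) / enorm (y - w).
have S0 : 0 < S by rewrite divr_gt0 //; have := hK y Dy; have := enorm_ge0 y; lra.
have nD : ~ D (y + S *: (y - w)).
  move=> /hK h; have := enormD (y + S *: (y - w)) (- y); rewrite addrAC subrr add0r enormZ gtr0_norm // enormN.
  by rewrite /S mulfVK ?gt_eqF //; lra.
have [s /andP [s0 _] bz] := segment_crosses_boundary oD Dy nD.
rewrite addrAC subrr add0r scalerA in bz; set a := s * S in bz.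
have a0 : 0 < a by rewrite mulr_gt0.
set z := y + _ in bz; pose l := (1 + a)^-1.
have l0 : 0 < l by rewrite invr_gt0; lra.
have l1 : l <= 1 by rewrite invf_le1; lra.
have a1 : 1 + a != 0 by rewrite gt_eqF //; lra.
have zw : z - w = (1 + a) *: (y - w) by apply/rowP => i; rewrite /z !mxE; ring.
have wz : w <> z.
  move=> h; move: zw; rewrite -h subrr => /esym /eqP; rewrite scaler_eq0 (negbTE a1) /= => /eqP h'.
  by move: yw; rewrite h' enorm0 ltxx.
have h1 := QD_le r0 tw bw bz wz.
have h2 := bdist_comb oD sD bw cw (midpoint_boundary bw bz wz) l0 l1.
have e : (1 - l) *: w + l *: midpoint w z = midpoint w y.
  by apply/rowP => i; rewrite /l /midpoint /z !mxE; field.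
rewrite e in h2; apply: le_trans h2.
have h3 : l * (QD D * (dot (z - w) nu / 2)) <= l * bdist D (midpoint w z) by apply: ler_wpM2l h1; exact: ltW.
apply: le_trans h3; rewrite zw dotZl le_eqVlt; apply/orP; left; apply/eqP.
by rewrite /l; field.
Qed.

Lemma half_bdist_midpoint w0 x y : boundary D w0 -> D x -> D y -> bdist D x / 2 <= bdist D (midpoint x y).
Proof.
move=> bw0 Dx Dy; have := bdist_comb oD sD bw0 (subset_closure Dy) Dx (_ : 0 < 2^-1) _.
rewrite (_ : (1 - 2^-1) *: y + 2^-1 *: x = midpoint x y); last by rewrite midpointE addrC.
by rewrite mulrC; apply; rewrite ?invr_gt0 // invf_le1 // ler1n.
Qed.

(** Replacing [x] by its nearest boundary point moves the midpoint by half of [bdist D x], which is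
    at most the boundary distance of the midpoint; this doubles the constant [2 / QD D] of
    [QD_le_interior]. *)
Lemma support_le_midpoint w0 z0 w x y nu r : boundary D w0 -> boundary D z0 -> w0 <> z0 -> 0 < QD D ->
  0 < r -> two_balls D w nu r -> boundary D w -> D x -> D y -> bdist D x = enorm (x - w) ->
  dot (y - w) nu <= 4 / QD D * bdist D (midpoint x y).
Proof.
move=> bw0 bz0 wz0 Q0 r0 tw bw Dx Dy hx.
have h1 := QD_le_interior bw0 bz0 wz0 Q0 r0 tw bw Dy.
have h2 : bdist D (midpoint w y) <= bdist D (midpoint x y) + bdist D x / 2.
  apply: (le_trans (bdist_lipschitz _ (midpoint x y) bw)).
  have -> : midpoint w y - midpoint x y = - (2^-1 *: (x - w)).
    by apply/rowP => i; rewrite /midpoint !mxE; field.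
  by rewrite enormN enormZ -hx gtr0_norm ?invr_gt0 // mulrC.
have h3 := half_bdist_midpoint bw Dx Dy.
rewrite mulrAC ler_pdivlMr // mulrC; lra.
Qed.

End Quotient.

(** * Upper bounds *)

Section Barrier.
Context {R : realType} {n : nat} (D : set 'rV[R]_n) (pD : R -> 'rV[R]_n -> 'rV[R]_n -> R) (K : R).
Hypotheses (oD : open D) (hpD : dirichlet_heat_kernel D pD) (hK : forall x, D x -> enorm x <= K).
Implicit Types (x y z w nu v : 'rV[R]_n).

(** A cluster point in [D] is settled by continuity; one on the boundary is excluded, since the
    kernel tends to 0 there. *)
Lemma compact_pD_superlevel (a b e : R) y : 0 < a -> 0 < e -> D y ->
  compact [set p : R * 'rV[R]_n | [/\ a <= p.1 <= b, D p.2 & e <= pD p.1 p.2 y]].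
Proof.
move=> a0 e0 Dy; set S := mkset _ => F PF FS.
have cB := compact_slab (s1 := a) (s2 := b) (@compact_enorm_le R n K).
have FB : F [set p : R * 'rV[R]_n | a <= p.1 <= b /\ enorm p.2 <= K].
  by apply: filterS FS => p [h1 h2 _]; split => //; exact: hK.
have [[s x] [/= [/andP [as_ sb] xK] clp]] := cB F PF FB.
have s0 : 0 < s by exact: lt_le_trans as_.
have cx : closure D x.
  move=> B hB; have hn : nbhs (s, x) [set q : R * 'rV[R]_n | B q.2] by exact: (cvg_snd hB).
  by have [q [[_ Dq _] /= Bq]] := clp _ _ FS hn; exists q.2.
have [Dx|nDx] := pselect (D x).
  exists (s, x); split => //=; split => //=; first by rewrite as_ sb.
  rewrite leNgt; apply/negP => ue.
  have [G [L j]] := jet_pD oD hpD s0 Dx Dy.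
  have hn : nbhs (s, x) [set q | pD q.1 q.2 y < e] by exact: (jet_continuous_at j (lt_nbhsl ue)).
  by have [q [[_ _ h1] /= h2]] := clp _ _ FS hn; move: (le_lt_trans h1 h2); rewrite ltxx.
have bx : boundary D x by apply/boundary_openP.
have [_ _ _ h4 _] := hpD; have := h4 s x y s0 bx Dy.
move=> /cvgrPdist_lt /(_ e e0); rewrite near_withinE => hn.
have [q [[_ Dq h1] /= h2]] := clp _ _ FS hn.
by have := h2 Dq; rewrite sub0r normrN => /ltr_normlW h3; move: (le_lt_trans h1 h3); rewrite ltxx.
Qed.

(** Comparison on the slice [dot z v < c] of [D]; the choice [v = 0], [c = 1] gives all of [D]. On
    the boundary of [D] the kernel vanishes, so that [0 <= V] is enough, and on the flat face the
    comparison is a hypothesis. *)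
Lemma pD_le_barrier (V : R -> 'rV[R]_n -> R) y v (c a b : R) : 0 < a -> D y ->
  (forall s z, a <= s <= b -> D z -> dot z v <= c ->
     0 <= V s z /\ exists wt G L, has_jet V s z wt G L /\ (dot z v < c -> L <= wt)) ->
  (forall z, D z -> dot z v < c -> pD a z y <= V a z) ->
  (forall s z, a <= s <= b -> D z -> dot z v = c -> pD s z y <= V s z) ->
  forall s z, a <= s <= b -> D z -> dot z v < c -> pD s z y <= V s z.
Proof.
move=> a0 Dy hV hi hc.
pose w s z := pD s z y - V s z.
suff h s z : a <= s <= b -> (D z /\ dot z v < c) -> w s z <= 0.
  by move=> s z hs Dz hz; rewrite -subr_le0; exact: h.
have pos s0 : a <= s0 <= b -> 0 < s0 by case/andP => h _; exact: lt_le_trans h.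
have jw s' z' : a <= s' <= b -> D z' -> dot z' v <= c ->
   exists wt G L, has_jet w s' z' wt G L /\ (dot z' v < c -> wt <= L).
  move=> hs Dz hz; have [_ [wt [G [L [j h]]]]] := hV s' z' hs Dz hz.
  have [Gp [Lp jp]] := jet_pD oD hpD (pos _ hs) Dz Dy.
  do 3 eexists; split; first exact: jet_sub jp j.
  by move=> hz'; rewrite lerD2l lerN2; exact: h.
pose Om := [set p : R * 'rV[R]_n | D p.2 /\ dot p.2 v < c].
apply: (@max_principle R n Om w a b).
- rewrite openE => -[s' z'] /= [Dz hz].
  have hn : nbhs z' (D `&` [set z | dot z v < c]).
    apply: filterI; first by apply: open_nbhs_nbhs.
    have cz : {for z', continuous (fun z : 'rV[R]_n => dot z v)} by exact: dot_continuous.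
    exact: (cz _ (lt_nbhsl hz)).
  exact: (cvg_snd hn).
- move=> e e0.
  pose K1 := [set p : R * 'rV[R]_n | [/\ a <= p.1 <= b, D p.2 & e <= pD p.1 p.2 y]] `&`
    [set p | - c <= - dot p.2 v].
  have cK1 : compact K1.
    apply: compact_superlevel; first exact: compact_pD_superlevel.
    move=> [s' z'] _; apply: continuousN.
    exact: (jet_continuous_at (jet_dot v s' z')).
  rewrite (_ : [set p | [/\ a <= p.1 <= b, Om p & e <= w p.1 p.2]] = K1 `&` [set p | e <= w p.1 p.2]).
    apply: compact_superlevel => // -[s' z'] [/= [hs Dz _]]; rewrite /= lerN2 => hz.
    by have [wt [G [L [j _]]]] := jw s' z' hs Dz hz; exact: jet_continuous_at j.
  apply/seteqP; split => -[s' z'] /=.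
    move=> [hs [Dz hz] hw]; split => //; split; last by rewrite /= lerN2 ltW.
    split => //=; apply: (le_trans hw); rewrite gerBl.
    by have [] := hV s' z' hs Dz (ltW hz).
  move=> [[/= [hs Dz _]]]; rewrite /= lerN2 le_eqVlt => /orP [/eqP hz hw|hz hw]; split => //.
  by have := hc s' z' hs Dz hz; rewrite -subr_le0 -/(w s' z') => h; move: (lt_le_trans e0 (le_trans hw h)); rewrite ltxx.
- by move=> z' [Dz hz]; rewrite subr_le0; exact: hi.
- move=> s' z' hs [Dz hz] _; have [wt [G [L [j h]]]] := jw s' z' hs Dz (ltW hz).
  by exists wt, G, L; split => //; exact: h.
Qed.

Lemma gauss_reflect (t : R) x y w nu : enorm nu = 1 -> 0 < t ->
  gauss t x (y - (2 * dot (y - w) nu) *: nu) = gauss t x y * expR (- (dot (x - w) nu * dot (y - w) nu / t)).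
Proof.
move=> n1 t0; rewrite /gauss -expRD; congr expR.
rewrite -addrA; congr (_ + _).
have gen (A B : 'rV[R]_n) : dot (A - (B - (2 * dot B nu) *: nu)) (A - (B - (2 * dot B nu) *: nu)) =
   dot (A - B) (A - B) + 4 * (dot A nu * dot B nu).
  by rewrite !dotE (enorm1_dot n1) (dotC nu A) (dotC nu B) (dotC B A); ring.
have -> : x - (y - (2 * dot (y - w) nu) *: nu) = (x - w) - ((y - w) - (2 * dot (y - w) nu) *: nu).
  by apply/rowP => i; rewrite !mxE; ring.
rewrite gen (_ : x - w - (y - w) = x - y); last by apply/rowP => i; rewrite !mxE; ring.
by field; rewrite gt_eqF.
Qed.

(** The right-hand side is the half-space kernel, the Gaussian minus its mirror image. At time [s0]
    only [pD <= gauss] is known, so the image term must be compensated: [D] is at distance at least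
    [l] from the image [y'], and on it the image term is at most [e1] times the Gaussian of twice
    the time, which is added to the barrier. *)
Lemma pD_le_half_space (t : R) x y w nu : enorm nu = 1 -> (forall z, D z -> 0 < dot (z - w) nu) ->
  0 < t -> D x -> D y ->
  pD t x y <= gauss t x y * (1 - expR (- (dot (x - w) nu * dot (y - w) nu / t))).
Proof.
move=> n1 hH t0 Dx Dy.
set y' := y - (2 * dot (y - w) nu) *: nu.
have ly := hH y Dy; set l := dot (y - w) nu in ly y'.
rewrite mulrBr mulr1 -gauss_reflect // -/l -/y'.
have dy' z : D z -> l ^+ 2 <= dot (z - y') (z - y').
  move=> Dz; have lz := hH z Dz.
  have := normr_dot_le (z - y') nu; rewrite n1 mulr1 => h.
  have e : dot (z - y') nu = dot (z - w) nu + l.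
    rewrite (_ : z - y' = (z - w) - (y - w) + (2 * l) *: nu); last by apply/rowP => i; rewrite !mxE; ring.
    by rewrite dotDl dotBl dotZl (enorm1_dot n1) -/l; ring.
  rewrite -enorm_sqr ler_pXn2r ?nnegrE ?enorm_ge0 ?(ltW ly) //.
  by move: h; rewrite e ger0_norm; lra.
pose c0 : R := expR (- (n%:R / 2) * ln (2^-1)); have c00 : 0 < c0 by exact: expR_gt0.
apply/ler_addgt0Pr => e e0.

have pk0 : 0 < @peak R n t + 1 by have := @peak_gt0 R n t; lra.
pose e1 := e / (@peak R n t + 1); have e10 : 0 < e1 by exact: divr_gt0.
(* Chosen so that [c0 <= e1 * q] for [q = l ^ 2 / (8 s0)]; together with [q <= exp q] this gives the
   comparison [init]. *)
pose s0 := Num.min t (e1 * l ^+ 2 / (8 * c0)).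
have l20 : 0 < l ^+ 2 by exact: exprn_gt0.
have s00 : 0 < s0.
  by rewrite lt_min t0 /=; apply: divr_gt0; apply: mulr_gt0.
have s0t : s0 <= t by rewrite ge_min lexx.
have s0e : s0 * (8 * c0) <= e1 * l ^+ 2 by rewrite -ler_pdivlMr ?mulr_gt0 // ge_min lexx orbT.
have init z : D z -> gauss s0 z y' <= e1 * gauss (s0 + s0) z y'.
  move=> Dz; rewrite !gaussE (_ : s0 = 2^-1 * (s0 + s0)); last by field.
  rewrite peakM ?addr_gt0 // -/c0 (_ : 2^-1 * (s0 + s0) = s0); last by field.

  set d := dot (z - y') (z - y').
  have hd : l ^+ 2 <= d by exact: dy'.
  have gen (S : R) : 0 < S -> - (d * (4 * S)^-1) = - (d * (4 * (S + S))^-1) - d / (8 * S).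
    by move=> S0; rewrite (_ : 4 * (S + S) = 8 * S); [field; rewrite gt_eqF|ring].
  rewrite (gen _ s00).
  rewrite expRD [e1 * _]mulrCA -mulrA [c0 * _]mulrCA; apply: ler_wpM2l; first exact: ltW (peak_gt0 _).
  rewrite mulrCA [e1 * _]mulrC; apply: ler_wpM2l; first exact: expR_ge0.
  have q0 : 0 < d / (8 * s0) by rewrite divr_gt0 ?mulr_gt0 //; exact: lt_le_trans hd.
  rewrite expRN -ler_pdivlMr ?invr_gt0 ?expR_gt0 // invrK -ler_pdivrMl // mulrC.
  have h1 : d / (8 * s0) <= expR (d / (8 * s0)) by have := expR_ge1Dx (d / (8 * s0)); lra.
  apply: le_trans h1; rewrite ler_pdivrMr // mulrC mulrA ler_pdivlMr ?mulr_gt0 //.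
  have : e1 * l ^+ 2 <= e1 * d by rewrite ler_pM2l.
  lra.
pose V s z := gauss s z y - gauss s z y' + e1 * gauss (s + s0) z y'.
have := @pD_le_barrier V y 0 1 s0 t s00 Dy _ _ _ t x.
rewrite s0t lexx !dot0r ltr01 /V => H.
have {}H : pD t x y <= gauss t x y - gauss t x y' + e1 * gauss (t + s0) x y'.
  apply: H => //.
  - move=> s z /andP [hs _] Dz _; have sp : 0 < s by exact: lt_le_trans hs.
    split.
      apply: addr_ge0; last by apply: mulr_ge0; [exact: ltW|exact: ltW (gauss_gt0 _ _ _)].
      rewrite subr_ge0 gauss_reflect // -[leRHS]mulr1; apply: ler_wpM2l; first exact: ltW (gauss_gt0 _ _ _).
      by rewrite -expR0 ler_expR oppr_le0 divr_ge0 ?mulr_ge0 ?(ltW sp) // ltW // hH.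
    have ss : 0 < s + s0 by exact: addr_gt0.
    do 3 eexists; split.
      exact: (jet_add (jet_sub (jet_gauss z y sp) (jet_gauss z y' sp)) (jet_scale e1 (jet_shift (jet_gauss z y' ss)))).
    by rewrite lexx.
  - move=> z Dz _; have := init z Dz; have := pD_le_gauss hpD s00 Dz Dy; lra.
  - by move=> s z _ _; rewrite dot0r => h; move: (@ltr01 R); rewrite -h ltxx.
apply: (le_trans H); rewrite lerD2l.
have h1 : gauss (t + s0) x y' <= @peak R n t.
  apply: (le_trans (gauss_le_peak x y' (addr_gt0 t0 s00))); apply: le_peak => //; lra.
have h2 : e1 * gauss (t + s0) x y' <= e1 * (@peak R n t + 1) by apply: ler_wpM2l; [exact: ltW|lra].
by apply: (le_trans h2); rewrite /e1 divfK // gt_eqF.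
Qed.

(** [l ^ 2 / L + L] is a smooth substitute for [2 l] that stays at least [L], hence can absorb its
    own constant Laplacian [2 / L]. *)
Lemma double_le_profile (L l : R) : 0 < L -> 2 * l <= l ^+ 2 / L + L.
Proof.
move=> L0; rewrite -(ler_pM2r L0) [(_ + L) * L]mulrDl divfK ?gt_eqF //.
by have := sqr_ge0 (l - L); rewrite sqrrB !expr2; lra.
Qed.

(** The rate [6 / t] is that of the factor [exp (6 (s - t / 2) / t)] of the barrier. A share [2 / t]
    pays for the Laplacian, because [t <= L ^ 2], and [4 / t] for the drift term in [ly], because
    [ly <= 2 L] and [s >= t / 2]. *)
Lemma profile_drift (L t s l ly : R) : 0 < L -> 0 < t -> t / 2 <= s -> t <= L ^+ 2 ->
  0 <= l -> 0 <= ly -> ly <= 2 * L ->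
  0 <= (l ^+ 2 / L + L) * (6 / t) - 2 / L + (2 * l / L) * ((l - ly) / s).
Proof.
move=> L0 t0 ts tL l0 ly0 lyL.
have s0 : 0 < s by lra.
have h1 := double_le_profile l L0.
have h2 : 2 / L <= (l ^+ 2 / L + L) * (2 / t).
  have : 2 / L <= L * (2 / t).
    rewrite ler_pdivrMr // mulrAC -expr2 mulrA ler_pdivlMr //; rewrite expr2 in tL *; lra.
  have : 0 <= l ^+ 2 / L * (2 / t) by rewrite !mulr_ge0 ?sqr_ge0 ?invr_ge0 ?(ltW L0) ?(ltW t0).
  rewrite mulrDl; lra.
have h3 : ly / s <= 4 * L / t.
  rewrite ler_pdivrMr // mulrAC ler_pdivlMr //.
  have : ly * t <= 2 * L * t by rewrite ler_pM2r.
  have : 4 * L * (t / 2) <= 4 * L * s by rewrite ler_pM2l ?mulr_gt0.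
  lra.
have h4 : (2 * l / L) * (ly / s) <= (2 * l / L) * (4 * L / t).
  by apply: ler_wpM2l h3; rewrite divr_ge0 ?mulr_ge0 // ltW.
have e4 : (2 * l / L) * (4 * L / t) = 2 * l * (4 / t) by field; rewrite !gt_eqF.
have h5 : 2 * l * (4 / t) <= (l ^+ 2 / L + L) * (4 / t) by rewrite ler_pM2r // divr_gt0.
have h6 : 0 <= (2 * l / L) * (l / s) by rewrite !mulr_ge0 ?invr_ge0 // ltW.
have e7 (g : R) : g * (6 / t) = g * (2 / t) + g * (4 / t) by field; rewrite gt_eqF.
rewrite e7 mulrBl mulrBr; lra.
Qed.

Lemma jet_support (t : R) x w nu : has_jet (fun _ z => dot (z - w) nu) t x 0 nu 0.
Proof.
have h := jet_sub (jet_dot nu t x) (jet_cst (dot w nu) t x).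
apply: jet_eq (jet_fun_eq h _) _ _ _; rewrite ?subr0 //.
by apply/funext => s; apply/funext => z; rewrite dotBl.
Qed.

Lemma is_derive_expR_line (a c u : R) : is_derive u (1 : R) (fun u => expR (c + u * a)) (expR (c + u * a) * a).
Proof. by apply: is_derive_eq (is_derive1_comp (is_derive_expR _) (is_derive_line c a u)) _. Qed.

Lemma jet_profile (t0 t L : R) x w nu : L != 0 -> t != 0 -> enorm nu = 1 ->
  exists wt G Lp, [/\ has_jet (fun s z => (dot (z - w) nu ^+ 2 / L + L) * expR (6 * (s - t / 2) / t)) t0 x wt G Lp,
    wt = (dot (x - w) nu ^+ 2 / L + L) * expR (6 * (t0 - t / 2) / t) * (6 / t),
    G = (2 * dot (x - w) nu / L * expR (6 * (t0 - t / 2) / t)) *: nu &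
    Lp = 2 / L * expR (6 * (t0 - t / 2) / t)].
Proof.
move=> L0 tn0 n1.
have j1 := jet_support t0 x w nu.
have j2 := jet_add (jet_scale L^-1 (jet_mul j1 j1)) (jet_cst L t0 x).
have j3 := jet_time_fun x (is_derive_expR_line (6 / t) (- 3) t0).
have eE s : 6 * (s - t / 2) / t = - 3 + s * (6 / t) by field.
have := jet_mul j2 j3; set wt := (X in has_jet _ _ _ X); set G := (X in has_jet _ _ _ _ X _).
set Lp := (X in has_jet _ _ _ _ _ X) => j; exists wt, G, Lp; split.
- apply: (jet_fun_eq j); apply/funext => s; apply/funext => z.
  by rewrite eE expr2 (mulrC _ L^-1).
- by rewrite /wt eE expr2; ring.
- by apply/rowP => i; rewrite /G eE !mxE; ring.
- by rewrite /Lp eE !dotE (enorm1_dot n1); ring.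
Qed.

Lemma jet_linear_exp (t0 t b : R) x w nu : enorm nu = 1 ->
  has_jet (fun s z => 1 - expR (- (2 * b * dot (z - w) nu)) + 2 * b ^+ 2 * expR (- 2) * (t - s)) t0 x
   (- (2 * b ^+ 2 * expR (- 2))) (2 * b * expR (- (2 * b * dot (x - w) nu)) *: nu)
   (- (4 * b ^+ 2) * expR (- (2 * b * dot (x - w) nu))).
Proof.
move=> n1; have j1 := jet_scale (- (2 * b)) (jet_support t0 x w nu).
have hE : \forall u \near (- (2 * b) * dot (x - w) nu), is_derive u (1 : R) expR (expR u).
  by near=> u; exact: is_derive_expR.
have j2 := jet_comp hE (is_derive_expR _) j1.
have j3 := jet_time_fun x (is_derive_line (2 * b ^+ 2 * expR (- 2) * t) (- (2 * b ^+ 2 * expR (- 2))) t0).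
have j := jet_add (jet_sub (jet_cst 1 t0 x) j2) j3.
apply: jet_eq (jet_fun_eq j _) _ _ _.
- by apply/funext => s; apply/funext => z; rewrite mulNr; ring.
- by ring.
- by apply/rowP => i; rewrite !mxE mulNr; ring.
- by rewrite !dotE (enorm1_dot n1) mulNr; ring.
Unshelve. all: end_near. Qed.

(* The second factor of the supersolution decays fast enough to absorb the mixed gradient
   term, because [b] exceeds [2 ly / t] by [2 / sg]. *)
Lemma boundary_layer_drift (b sg s L l1 ly l2 g es rho : R) : 0 < sg -> 0 <= ly ->
  b = 2 * (ly + sg) / sg ^+ 2 -> sg ^+ 2 / 2 <= s -> sg <= L -> 0 <= l1 -> 0 <= l2 -> 2 * l2 <= g ->
  expR (- 2) <= es -> rho <= 1 ->
  0 <= g * (- (2 * b ^+ 2 * expR (- 2)) + 4 * b ^+ 2 * es + 2 * b * es * ((l1 - ly) / s)) -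
    2 * ((2 * l2 / L) * (2 * b * es) * rho).
Proof.
move=> sg0 ly0 bE hs hL l10 l20 hg hes hrho.
have L0 : 0 < L by lra.
have es0 : 0 < es by apply: lt_le_trans hes; exact: expR_gt0.
have sg2 : 0 < sg ^+ 2 by exact: exprn_gt0.
have s0 : 0 < s by lra.
have b0 : 0 < b by rewrite bE divr_gt0 // mulr_gt0 //; lra.
have h1 : - (b - 2 / sg) <= (l1 - ly) / s.
  have e : b - 2 / sg = ly / (sg ^+ 2 / 2) by rewrite bE; field; rewrite gt_eqF.
  have : ly / s <= ly / (sg ^+ 2 / 2) by apply: ler_wpM2l => //; rewrite lef_pV2 ?posrE //; lra.
  have : 0 <= l1 / s by rewrite divr_ge0 // ltW.
  rewrite e mulrBl; lra.
have be : 0 < 2 * b * es by rewrite !mulr_gt0.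
have h2 : 2 * b * es * - (b - 2 / sg) <= 2 * b * es * ((l1 - ly) / s) by rewrite ler_pM2l.
have h3 : 2 * b ^+ 2 * expR (- 2) <= 2 * b ^+ 2 * es by rewrite ler_pM2l // mulr_gt0 // exprn_gt0.
set X := (X in g * X).
have hX : es * (4 * b / sg) <= X.
  have e2 : 2 * b * es * - (b - 2 / sg) = - (2 * b ^+ 2 * es) + es * (4 * b / sg) by field; rewrite gt_eqF.
  rewrite /X; lra.
have q0 : 0 <= es * (4 * b / sg) by rewrite !mulr_ge0 ?invr_ge0 // ltW.
have h4 : 2 * l2 * (es * (4 * b / sg)) <= g * X by apply: ler_pM => //; exact: mulr_ge0.
have h5 : (2 * l2 / L) * (2 * b * es) * rho <= (2 * l2 / L) * (2 * b * es).
  by apply: ler_piMr hrho; rewrite mulr_ge0 ?(ltW be) // divr_ge0 ?mulr_ge0 // ltW.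
have h6 : (2 * l2 / L) * (2 * b * es) <= (2 * l2 / sg) * (2 * b * es).
  rewrite ler_pM2r //; apply: ler_wpM2l; first by rewrite mulr_ge0.
  by rewrite lef_pV2 ?posrE.
have e3 : 2 * l2 * (es * (4 * b / sg)) = 2 * ((2 * l2 / sg) * (2 * b * es)) by field; rewrite gt_eqF.
lra.
Qed.

(** * The upper barrier between two supporting hyperplanes *)

Section TwoSupports.
Variables (w1 nu1 w2 nu2 : 'rV[R]_n).
Hypotheses (n1 : enorm nu1 = 1) (n2 : enorm nu2 = 1)
  (H1 : forall z, D z -> 0 < dot (z - w1) nu1) (H2 : forall z, D z -> 0 < dot (z - w2) nu2).
Let l1 z := dot (z - w1) nu1.
Let l2 z := dot (z - w2) nu2.

(** The barrier lives on the slice [l1 < 1 / b] during [[t / 2, t]]. At time [t / 2] and on the face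
    [l1 = 1 / b] its factor [phi] is at least [exp (- 2)], and comparison reduces to the half-space
    bound for [l2]. At time [t] the term in [t - s] has vanished, which leaves [1 - exp (- 2 b l1)],
    small near the first hyperplane. *)
Lemma pD_le_boundary_layer (sg : R) x y (L := (l2 x + l2 y) / 2 + sg)
   (b := 2 * (l1 y + sg) / sg ^+ 2) : 0 < sg -> D x -> D y -> l1 x * b < 1 ->
  pD (sg ^+ 2) x y <= gauss (sg ^+ 2) x y * (expR 2 * (l2 y / sg ^+ 2 * (((l2 x ^+ 2 / L + L) * expR 3) *
    (1 - expR (- (2 * b * l1 x)))))).
Proof.
move=> sg0 Dx Dy hx.
set t := sg ^+ 2; have t0 : 0 < t by exact: exprn_gt0.
have l1x := H1 Dx; have l1y := H1 Dy; have l2x := H2 Dx; have l2y := H2 Dy.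
rewrite -/(l1 x) -/(l1 y) -/(l2 x) -/(l2 y) in l1x l1y l2x l2y.
have L0 : 0 < L by rewrite /L; lra.
have b0 : 0 < b by rewrite /b; apply: divr_gt0 => //; apply: mulr_gt0 => //; lra.
pose P s z := (l2 z ^+ 2 / L + L) * expR (6 * (s - t / 2) / t).
pose phi s z := 1 - expR (- (2 * b * l1 z)) + 2 * b ^+ 2 * expR (- 2) * (t - s).
pose V s z := expR 2 * (l2 y / t) * (gauss s z y * (P s z * phi s z)).
(* At time [t / 2] the term of [phi] in [t - s] equals [exp (- 2) * b ^ 2 * t], which this bounds
   below. *)
have b2t : 4 <= b ^+ 2 * t.
  have e : b ^+ 2 * t = 4 * (l1 y / sg + 1) ^+ 2 by rewrite /b /t; field; rewrite gt_eqF.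
  have h : 0 <= l1 y / sg by rewrite divr_ge0 // ltW.
  have : 1 * 1 <= (l1 y / sg + 1) * (l1 y / sg + 1) by apply: ler_pM => //; lra.
  rewrite e expr2; lra.
have k0 := @expR_gt0 R (- 2).
have k1 : expR 2 * expR (- 2) = 1 :> R by rewrite -expRD subrr expR0.
have e21 : expR (- 2) <= 2^-1 :> R.
  rewrite expRN lef_pV2 ?posrE ?expR_gt0 //; have := @expR_ge1Dx R 2; lra.
have g0 l : 0 <= l ^+ 2 / L + L.
  by apply: addr_ge0; last exact: ltW; apply: divr_ge0; [exact: sqr_ge0|exact: ltW].
have P0 s z : 0 <= P s z by apply: mulr_ge0; [exact: g0|exact: expR_ge0].
have phi_ge s z : s <= t -> D z -> 0 <= 1 - expR (- (2 * b * l1 z)) /\ 0 <= 2 * b ^+ 2 * expR (- 2) * (t - s).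
  move=> st Dz; split.
    rewrite subr_ge0 -expR0 ler_expR oppr_le0; apply: mulr_ge0; last exact: ltW (H1 Dz).
    by apply: mulr_ge0 => //; exact: ltW.
  by rewrite mulr_ge0 ?subr_ge0 // mulr_ge0 ?(ltW k0) // mulr_ge0 ?sqr_ge0.
have c0 : 0 <= expR 2 * (l2 y / t) by rewrite mulr_ge0 ?expR_ge0 // divr_ge0 // ltW.
have dom s z : t / 2 <= s <= t -> D z -> 1 <= expR 2 * phi s z -> pD s z y <= V s z.
  move=> /andP [ts st] Dz hphi; have s0 : 0 < s by lra.
  apply: (le_trans (pD_le_half_space n2 H2 s0 Dz Dy)).
  rewrite /V [leRHS]mulrCA; apply: ler_wpM2l; first exact: ltW (gauss_gt0 _ _ _).
  have h1 : 1 - expR (- (l2 z * l2 y / s)) <= l2 z * l2 y / s.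
    by have := expR_ge1Dx (- (l2 z * l2 y / s)); lra.
  apply: (le_trans h1).
  have lz := H2 Dz; rewrite -/(l2 z) in lz.
  have h2 : l2 z * l2 y / s <= l2 y / t * (2 * l2 z).
    rewrite (_ : l2 y / t * (2 * l2 z) = l2 z * l2 y / (t / 2)); last by field; rewrite gt_eqF.
    apply: ler_wpM2l; first by rewrite mulr_ge0 // ltW.
    by rewrite lef_pV2 ?posrE //; lra.
  apply: (le_trans h2).
  have h3 : 2 * l2 z <= P s z.
    apply: (le_trans (double_le_profile (l2 z) L0)); apply: ler_peMr; first exact: g0.
    rewrite -[X in X <= _]expR0 ler_expR.
    by apply: divr_ge0; [apply: mulr_ge0; lra|exact: ltW].
  have h4 : P s z <= P s z * (expR 2 * phi s z) by apply: ler_peMr.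
  have q0 : 0 <= l2 y / t by rewrite divr_ge0 // ltW.
  have := ler_wpM2l q0 (le_trans h3 h4).
  by rewrite (_ : expR 2 * (l2 y / t) * (P s z * phi s z) = l2 y / t * (P s z * (expR 2 * phi s z))) //; ring.
have hdot z : dot z nu1 = l1 z + dot w1 nu1 by rewrite /l1 dotBl subrK.
have key := @pD_le_barrier V y nu1 (b^-1 + dot w1 nu1) (t / 2) t _ Dy.
have -> : gauss t x y * (expR 2 * (l2 y / t * ((l2 x ^+ 2 / L + L) * expR 3 * (1 - expR (- (2 * b * l1 x)))))) = V t x.
  rewrite /V /P /phi subrr mulr0 addr0 (_ : 6 * (t - t / 2) / t = 3); last by field; rewrite gt_eqF.
  ring.
apply: key; first by lra.
- move=> s z /andP [ts st] Dz; rewrite hdot lerD2r => hz; have s0 : 0 < s by lra.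
  have lz := H1 Dz; rewrite -/(l1 z) in lz; have l2z := H2 Dz; rewrite -/(l2 z) in l2z.
  have [p1 p2] := phi_ge s z st Dz.
  split.
    apply: mulr_ge0 => //; apply: mulr_ge0; first exact: ltW (gauss_gt0 _ _ _).
    by apply: mulr_ge0 => //; exact: addr_ge0.
  have [Pt [GP [LP [jP PtE GPE LPE]]]] := jet_profile s z w2 (lt0r_neq0 L0) (lt0r_neq0 t0) n2.
  have jphi := jet_linear_exp s t b z w1 n1.
  have [wt [G' [L' [j hj]]]] := jet_gauss_mul y s0 (jet_mul jP jphi).
  do 3 eexists; split; first exact: (jet_scale (expR 2 * (l2 y / t)) j).
  move=> _; apply: ler_wpM2l => //; rewrite -subr_ge0 hj; apply: mulr_ge0; first exact: ltW (gauss_gt0 _ _ _).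
  rewrite -/(l2 z) -/(l1 z) in PtE GPE LPE *.
  rewrite -/(phi s z) -/(P s z).
  set E := expR (6 * (s - t / 2) / t) in PtE GPE LPE *; have E0 : 0 < E by exact: expR_gt0.
  set es := expR (- (2 * b * l1 z)); set g := l2 z ^+ 2 / L + L in PtE *.
  have PE : P s z = g * E by [].
  have d1 := profile_drift L0 t0 ts (l := l2 z) (ly := l2 y) _ (ltW l2z) (ltW l2y) _.
  have d2 := boundary_layer_drift (es := es) (rho := dot nu2 nu1) sg0 (ltW l1y) (erefl b) ts _ (ltW lz) (ltW l2z) (double_le_profile (l2 z) L0).
  have dz2 : dot (z - y) nu2 = l2 z - l2 y by rewrite /l2 -dotBl; congr dot; apply/rowP => i; rewrite !mxE; ring.
  have dz1 : dot (z - y) nu1 = l1 z - l1 y by rewrite /l1 -dotBl; congr dot; apply/rowP => i; rewrite !mxE; ring.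
  have {}d1 : 0 <= E * phi s z * (g * (6 / t) - 2 / L + (2 * l2 z / L) * ((l2 z - l2 y) / s)).
    apply: mulr_ge0; first by apply: mulr_ge0; [exact: ltW|exact: addr_ge0].
    apply: d1; last by rewrite /L; lra.
    by rewrite /t ler_pXn2r ?nnegrE ?(ltW sg0) ?(ltW L0) // /L; lra.
  have {}d2 : 0 <= E * (g * (- (2 * b ^+ 2 * expR (- 2)) + 4 * b ^+ 2 * es + 2 * b * es * ((l1 z - l1 y) / s)) -
    2 * ((2 * l2 z / L) * (2 * b * es) * dot nu2 nu1)).
    apply: mulr_ge0; first exact: ltW.
    apply: d2; first by rewrite /L; lra.
      rewrite ler_expR lerN2; have : b * l1 z <= 1 by rewrite mulrC -ler_pdivlMr // mul1r.
      lra.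
    by have := dot_le_enorm nu2 nu1; rewrite n1 n2 mulr1.
  (* The product rule splits the drift expression into the one of [profile_drift] times [phi], and
     the one of [boundary_layer_drift], which carries the mixed gradient term. *)
  have eq : Pt * phi s z + P s z * - (2 * b ^+ 2 * expR (- 2)) -
     (LP * phi s z + 2 * dot GP ((2 * b * es) *: nu1) + P s z * (- (4 * b ^+ 2) * es)) +
     dot (z - y) (phi s z *: GP + P s z *: ((2 * b * es) *: nu1)) / s =
     E * phi s z * (g * (6 / t) - 2 / L + (2 * l2 z / L) * ((l2 z - l2 y) / s)) +
     E * (g * (- (2 * b ^+ 2 * expR (- 2)) + 4 * b ^+ 2 * es + 2 * b * es * ((l1 z - l1 y) / s)) -
    2 * ((2 * l2 z / L) * (2 * b * es) * dot nu2 nu1)).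
    rewrite PtE GPE LPE PE dotDr !dotZr dotZl dz1 dz2; ring.
  by rewrite eq; apply: addr_ge0.
- move=> z Dz _; apply: dom => //; first by apply/andP; split; lra.
  have h : t / 2 <= t by lra.
  have [p1 _] := phi_ge (t / 2) z h Dz.
  rewrite /phi mulrDr (_ : expR 2 * (2 * b ^+ 2 * expR (- 2) * (t - t / 2)) = (expR 2 * expR (- 2)) * (b ^+ 2 * t)); last by field.
  rewrite k1; have : 0 <= expR 2 * (1 - expR (- (2 * b * l1 z))) by apply: mulr_ge0 => //; exact: expR_ge0.
  lra.
- move=> s z hs Dz; rewrite hdot => /addIr hz; apply: dom => //.
  have [_ st] := andP hs; have [_ p2] := phi_ge s z st Dz.
  rewrite /phi hz -mulrA mulfV ?gt_eqF // mulr1.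
  have e2 := @expR_ge1Dx R 2.
  have : 2 * 2^-1 <= expR 2 * (1 - expR (- 2) + 2 * b ^+ 2 * expR (- 2) * (t - s)) :> R by apply: ler_pM => //; lra.
  lra.
- by apply/andP; split; lra.
- exact: Dx.
- by rewrite hdot ltrD2r -(ltr_pM2r b0) mulVf // gt_eqF.
Qed.

(** When [A1 >= 1 / 2] or [A2 >= 1], that factor is bounded below and the half-space bound for the
    other hyperplane suffices. Otherwise [b * l1 x = 2 A1 < 1] and the boundary layer applies;
    [20 exp 5] collects the bound [5 L] for the profile, [exp 2], [exp 3], and 4 from
    [2 b l1 x = 4 A1]. *)
Lemma pD_le_two_supports (sg : R) x y : 0 < sg -> D x -> D y ->
  pD (sg ^+ 2) x y <= 20 * expR 5 * (Num.min 1 (l1 x * (l1 y + sg) / sg ^+ 2) *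
    Num.min 1 (l2 y * ((l2 x + l2 y) / 2 + sg) / sg ^+ 2)) * gauss (sg ^+ 2) x y.
Proof.
move=> sg0 Dx Dy.
set t := sg ^+ 2; have t0 : 0 < t by exact: exprn_gt0.
have l1x := H1 Dx; have l1y := H1 Dy; have l2x := H2 Dx; have l2y := H2 Dy.
rewrite -/(l1 x) -/(l1 y) -/(l2 x) -/(l2 y) in l1x l1y l2x l2y.
set L := (l2 x + l2 y) / 2 + sg; have L0 : 0 < L by rewrite /L; lra.
set A1 := l1 x * (l1 y + sg) / t; set A2 := l2 y * L / t.
have A10 : 0 < A1 by apply: divr_gt0 => //; apply: mulr_gt0 => //; lra.
have A20 : 0 < A2 by apply: divr_gt0 => //; apply: mulr_gt0.
have [G G0 GE] : exists2 G, 0 < G & gauss t x y = G by exists (gauss t x y) => //; exact: gauss_gt0.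
have hU : pD t x y <= G by rewrite -GE; exact: (pD_le_gauss hpD).
have lin a : 1 - expR (- a) <= a :> R by have := expR_ge1Dx (- a); lra.
have ht : 0 <= t^-1 by rewrite invr_ge0 ltW.
have hU1 : pD t x y <= G * A1.
  apply: (le_trans (pD_le_half_space n1 H1 t0 Dx Dy)); rewrite GE ler_pM2l //.
  apply: (le_trans (lin _)); rewrite /A1 -/(l1 x) -/(l1 y); apply: ler_wpM2r => //.
  by apply: ler_wpM2l; [exact: ltW|lra].
have hU2 : pD t x y <= G * (2 * A2).
  apply: (le_trans (pD_le_half_space n2 H2 t0 Dx Dy)); rewrite GE ler_pM2l //.
  apply: (le_trans (lin _)); rewrite -/(l2 x) -/(l2 y) (_ : 2 * A2 = 2 * L * l2 y / t); last first.
    by rewrite /A2; ring.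
  apply: ler_wpM2r => //; apply: ler_wpM2r; [exact: ltW|rewrite /L; lra].
have C20 : 20 <= 20 * expR 5 :> R.
  by have := @expR_ge1Dx R 5; lra.
set C := 20 * expR 5 in C20 *; rewrite [leRHS]mulrC GE.
have [h1|h1] := leP 2^-1 A1.
  have m1 : 2^-1 <= Num.min 1 A1 by rewrite le_min h1 andbT; lra.
  have hm : pD t x y <= G * (2 * Num.min 1 A2).
    by rewrite minr_pMr ?ler0n // mulr1 minr_pMr ?(ltW G0) // le_min hU2 andbT; lra.
  apply: (le_trans hm); rewrite ler_pM2l // mulrA; apply: ler_wpM2r; first by rewrite le_min ler01 ltW.
  have : 20 * 2^-1 <= C * Num.min 1 A1 by apply: ler_pM => //; lra.
  lra.
have m1 : Num.min 1 A1 = A1 by apply/min_idPr; lra.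
rewrite m1; have [h2|h2] := leP 1 A2.

  apply: (le_trans hU1); rewrite ler_pM2l // mulr1; apply: ler_peMl; [exact: ltW|lra].

have hb : l1 x * (2 * (l1 y + sg) / t) < 1.
  by rewrite (_ : l1 x * _ = 2 * A1); [lra|rewrite /A1; ring].
apply: (le_trans (pD_le_boundary_layer sg0 Dx Dy hb)); rewrite GE ler_pM2l // -/L -/t.
have h3 : l2 x ^+ 2 / L + L <= 5 * L.
  have : l2 x ^+ 2 / L <= 4 * L.
    rewrite ler_pdivrMr // -mulrA expr2.
    have : l2 x * l2 x <= (2 * L) * (2 * L) by apply: ler_pM; rewrite ?(ltW l2x) // /L; lra.
    lra.
  lra.
have h4 := lin (2 * (2 * (l1 y + sg) / t) * l1 x).
set F := 1 - expR _ in h4 *.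
have F0 : 0 <= F.
  rewrite subr_ge0 -[leRHS]expR0 ler_expR oppr_le0; apply: mulr_ge0; last exact: ltW.
  by apply: mulr_ge0 => //; apply: divr_ge0; [apply: mulr_ge0 => //|exact: ltW]; lra.
have h5 : (l2 x ^+ 2 / L + L) * expR 3 * F <= 5 * L * expR 3 * (2 * (2 * (l1 y + sg) / t) * l1 x).
  apply: ler_pM => //; last by apply: ler_wpM2r => //; exact: expR_ge0.
  apply: mulr_ge0; last exact: expR_ge0.
  by apply: addr_ge0; last exact: ltW; apply: divr_ge0; [exact: sqr_ge0|exact: ltW].
have h6 : expR 2 * (l2 y / t * ((l2 x ^+ 2 / L + L) * expR 3 * F)) <=
   expR 2 * (l2 y / t * (5 * L * expR 3 * (2 * (2 * (l1 y + sg) / t) * l1 x))).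
  apply: ler_wpM2l; first exact: expR_ge0.
  by apply: ler_wpM2l => //; apply: divr_ge0; exact: ltW.
apply: (le_trans h6); rewrite /C (_ : 5 = 2 + 3 :> R) ?expRD; last by ring.
by rewrite le_eqVlt; apply/orP; left; apply/eqP; rewrite /A1 /A2; ring.
Qed.

End TwoSupports.

End Barrier.

(** * The two-sided estimate *)

Section MinOne.
Context {R : realType}.
Implicit Types a b c k X Y M s : R.

Lemma min1_ge0 a : 0 <= a -> 0 <= Num.min 1 a.
Proof. by move=> a0; rewrite le_min ler01. Qed.

Lemma min1_scale k a : 1 <= k -> 0 <= a -> Num.min 1 (k * a) <= k * Num.min 1 a.
Proof.
move=> k1 a0; have k0 : 0 <= k by lra.
by rewrite minr_pMr // mulr1 le_min ge_min k1 /= ge_min lexx orbT.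
Qed.

Lemma min1_shrink k a : 0 <= k -> k <= 1 -> k * Num.min 1 a <= Num.min 1 (k * a).
Proof.
move=> k0 k1; rewrite minr_pMr // mulr1 le_min ge_min k1 /=.
by rewrite ge_min lexx orbT.
Qed.

Lemma min1_mul a b : 0 <= a -> 0 <= b -> Num.min 1 a * Num.min 1 b <= Num.min 1 (a * b).
Proof.
move=> a0 b0; rewrite le_min; apply/andP; split.
  rewrite -[leRHS]mulr1; apply: ler_pM; rewrite ?min1_ge0 //; first by rewrite ge_min lexx.
  by rewrite ge_min lexx.
by apply: ler_pM; rewrite ?min1_ge0 // ge_min lexx orbT.
Qed.

Lemma min1_le a b : a <= b -> Num.min 1 a <= Num.min 1 b.
Proof. by move=> ab; rewrite le_min !ge_min lexx ab orbT. Qed.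

(** The two terms of [hfun] are the two regimes here: for [s <= M] the sum [M + s] is comparable to
    [M], and for [M < s] to [s], in which case the two minima combine into the one with [X * Y]. *)
Lemma min1_product_le X Y M s : 0 <= X -> 0 <= Y -> 0 <= M -> 0 < s ->
  Num.min 1 (X * (M + s) / s ^+ 2) * Num.min 1 (Y * (M + s) / s ^+ 2) <=
  4 * (Num.min 1 (X * Y / s ^+ 2) + Num.min 1 (X * M / s ^+ 2) * Num.min 1 (Y * M / s ^+ 2)).
Proof.
move=> X0 Y0 M0 s0; have s20 : 0 < s ^+ 2 by exact: exprn_gt0.
have is0 : 0 <= (s ^+ 2)^-1 by rewrite invr_ge0 ltW.
have p1 : 0 <= X * Y / s ^+ 2 by rewrite !mulr_ge0.
have p2 Z : 0 <= Z -> 0 <= Z * M / s ^+ 2 by move=> Z0; rewrite !mulr_ge0.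
have [h|h] := leP s M.
  have hZ Z : 0 <= Z -> Num.min 1 (Z * (M + s) / s ^+ 2) <= 2 * Num.min 1 (Z * M / s ^+ 2).
    move=> Z0; apply: le_trans (min1_scale _ (p2 _ Z0)); last by lra.
    apply: min1_le; rewrite mulrA; apply: ler_wpM2r => //.
    by rewrite mulrCA; apply: ler_wpM2l => //; lra.
  have q Z : 0 <= Z -> 0 <= Num.min 1 (Z * (M + s) / s ^+ 2).
    by move=> Z0; apply: min1_ge0; apply: mulr_ge0 => //; apply: mulr_ge0 => //; lra.
  have := ler_pM (q _ X0) (q _ Y0) (hZ _ X0) (hZ _ Y0); have := min1_ge0 p1; lra.
have hZ Z : 0 <= Z -> Num.min 1 (Z * (M + s) / s ^+ 2) <= 2 * Num.min 1 (Z / s).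
  move=> Z0; apply: le_trans (min1_scale _ _); [|by lra|by rewrite divr_ge0 // ltW].
  apply: min1_le; rewrite ler_pdivrMr // (_ : 2 * (Z / s) * s ^+ 2 = Z * (2 * s)); last by field; rewrite gt_eqF.
  by apply: ler_wpM2l => //; lra.
have q Z : 0 <= Z -> 0 <= Num.min 1 (Z * (M + s) / s ^+ 2).
  by move=> Z0; apply: min1_ge0; apply: mulr_ge0 => //; apply: mulr_ge0 => //; lra.
have h1 := ler_pM (q _ X0) (q _ Y0) (hZ _ X0) (hZ _ Y0).
have h2 : Num.min 1 (X / s) * Num.min 1 (Y / s) <= Num.min 1 (X * Y / s ^+ 2).
  rewrite (_ : X * Y / s ^+ 2 = (X / s) * (Y / s)); last by field; rewrite gt_eqF.
  by apply: min1_mul; rewrite divr_ge0 // ltW.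
have h3 := mulr_ge0 (min1_ge0 (p2 _ X0)) (min1_ge0 (p2 _ Y0)); lra.
Qed.

End MinOne.

(** * Two-sided bounds for a positive quotient *)

Section TwoSided.
Context {R : realType} {n : nat} (D : set 'rV[R]_n) (pD : R -> 'rV[R]_n -> 'rV[R]_n -> R).
Hypotheses (oD : open D) (sD : strictly_convex D) (cD : C11_set D).
Hypothesis hpD : dirichlet_heat_kernel D pD.
Variables (w0 z0 : 'rV[R]_n).
Hypotheses (bw0 : boundary D w0) (bz0 : boundary D z0) (wz0 : w0 <> z0) (Q0 : 0 < QD D).
Implicit Types (x y z w nu : 'rV[R]_n) (t : R).

Lemma D_midpoint x y : D x -> D y -> D (midpoint x y).
Proof. by move=> Dx Dy; rewrite midpointE; apply: (convex_comb sD) => //; apply/andP; split; lra. Qed.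

(** With the supporting hyperplanes at the boundary points nearest to [x] and [y], the near
    distances are [bdist D x] and [bdist D y], and the crossed ones are controlled by the midpoint
    through [support_le_midpoint]. The factor 80 is 20 from [pD_le_two_supports] times 4 from
    [min1_product_le]. *)
Lemma pD_upper t x y : 0 < t -> D x -> D y ->
  pD t x y <= 80 * expR 5 * (1 + 4 / QD D) ^+ 2 * hfun D t x y * gauss t x y.
Proof.
move=> t0 Dx Dy; pose sg := Num.sqrt t; have sg0 : 0 < sg by rewrite sqrtr_gt0.
have tE : sg ^+ 2 = t by rewrite sqr_sqrtr // ltW.
have [K hK] := QD_bounded oD sD cD bw0 bz0 wz0 Q0.
have [w1 bw1 hw1] := bdist_attained x bw0; have [w2 bw2 hw2] := bdist_attained y bw0.
have [nu1 [r1 r10 tw1]] := normal_exists oD cD bw1.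
have [nu2 [r2 r20 tw2]] := normal_exists oD cD bw2.
have [n1 _ _] := tw1; have [n2 _ _] := tw2.
have H1 z (Dz : D z) := supporting oD sD r10 bw1 tw1 Dz.
have H2 z (Dz : D z) := supporting oD sD r20 bw2 tw2 Dz.
have e1 : dot (x - w1) nu1 = bdist D x.
  by rewrite {1}(nearest_normal oD sD r10 bw1 tw1 Dx hw1) addrAC subrr add0r dotZl (enorm1_dot n1) mulr1.
have e2 : dot (y - w2) nu2 = bdist D y.
  by rewrite {1}(nearest_normal oD sD r20 bw2 tw2 Dy hw2) addrAC subrr add0r dotZl (enorm1_dot n2) mulr1.
have h := pD_le_two_supports oD hpD hK n1 n2 H1 H2 sg0 Dx Dy.
rewrite e1 e2 tE in h; apply: (le_trans h).
have l1 := support_le_midpoint oD sD cD bw0 bz0 wz0 Q0 r10 tw1 bw1 Dx Dy hw1.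
have l2 := support_le_midpoint oD sD cD bw0 bz0 wz0 Q0 r20 tw2 bw2 Dy Dx hw2.
rewrite midpointC in l2.
have m2 := half_bdist_midpoint oD sD bw0 Dy Dx; rewrite midpointC in m2.
have X0 := bdist_gt0 oD Dx bw0; have Y0 := bdist_gt0 oD Dy bw0.
have M0 := bdist_gt0 oD (D_midpoint Dx Dy) bw0.
rewrite /hfun; set M := bdist D (midpoint x y) in l1 l2 m2 M0 *.
set X := bdist D x in X0 *; set Y := bdist D y in Y0 m2 *.
set k := 4 / QD D in l1 l2 *; have k0 : 0 < k by rewrite divr_gt0.
have kM : 0 < k * M by rewrite mulr_gt0.
have ksg : 0 < k * sg by rewrite mulr_gt0.
rewrite [leLHS]mulrC [leRHS]mulrC; apply: ler_wpM2l; first exact: ltW (gauss_gt0 _ _ _).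
have it0 : 0 <= t^-1 by rewrite invr_ge0 ltW.
have b1 : Num.min 1 (X * (dot (y - w1) nu1 + sg) / t) <= (1 + k) * Num.min 1 (X * (M + sg) / t).
  apply: le_trans (min1_scale _ _); [|by rewrite lerDl ltW|].
    apply: min1_le; rewrite mulrA; apply: ler_wpM2r => //.
    by rewrite mulrCA; apply: ler_wpM2l; [exact: ltW|lra].
  by apply: mulr_ge0 => //; apply: mulr_ge0; [|apply: addr_ge0]; exact: ltW.
have b2 : Num.min 1 (Y * ((dot (x - w2) nu2 + Y) / 2 + sg) / t) <= (1 + k) * Num.min 1 (Y * (M + sg) / t).
  apply: le_trans (min1_scale _ _); [|by rewrite lerDl ltW|].
    apply: min1_le; rewrite mulrA; apply: ler_wpM2r => //.
    by rewrite mulrCA; apply: ler_wpM2l; [exact: ltW|lra].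
  by apply: mulr_ge0 => //; apply: mulr_ge0; [|apply: addr_ge0]; exact: ltW.
have hl := H1 _ Dy; have hl2 := H2 _ Dx.
have b3 := ler_pM _ _ b1 b2.
have b4 := min1_product_le (ltW X0) (ltW Y0) (ltW M0) sg0; rewrite tE in b4.
set S := Num.min 1 (X * Y / t) + _ in b4 *.
have b5 : Num.min 1 (X * (dot (y - w1) nu1 + sg) / t) * Num.min 1 (Y * ((dot (x - w2) nu2 + Y) / 2 + sg) / t)
   <= (1 + k) ^+ 2 * (4 * S).
  apply: (le_trans (b3 _ _)).
  - by apply: min1_ge0; apply: mulr_ge0 => //; apply: mulr_ge0; [|apply: addr_ge0]; exact: ltW.
  - apply: min1_ge0; apply: mulr_ge0 => //; apply: mulr_ge0; first exact: ltW.
    by apply: addr_ge0; [apply: divr_ge0 => //; apply: addr_ge0|]; exact: ltW.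
  - rewrite mulrACA -expr2; apply: ler_wpM2l b4; exact: sqr_ge0.
have := ler_wpM2l (ltW (_ : 0 < 20 * expR 5 :> R)) b5.
rewrite (_ : 80 * expR 5 * (1 + k) ^+ 2 * S = 20 * expR 5 * ((1 + k) ^+ 2 * (4 * S))); last by ring.
by apply; rewrite mulr_gt0 ?expR_gt0.
Qed.

Lemma depth_le_bdist x a rho : 0 < rho -> ball_in D a rho -> enorm (x - a) < rho -> depth rho a x <= bdist D x.
Proof.
move=> rho0 ha hx; apply: (@le_trans _ _ (rho - enorm (x - a))).
  rewrite /depth ler_pdivrMr ?mulr_gt0 // -enorm_sqr; have := enorm_ge0 (x - a).
  move: (enorm (x - a)) hx => d dr d0; have := mulr_ge0 (_ : 0 <= rho - d) (_ : 0 <= rho - d); rewrite !expr2; lra.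
apply: (le_bdist oD bw0) => z hz; apply: ha.
by have := enorm_triangle x z a; lra.
Qed.

(** * Lower bounds from uniform interior balls *)

Section Lower.
Variables (r Del : R).
Hypotheses (r0 : 0 < r) (Del0 : 0 < Del) (hDel : forall x, D x -> bdist D x <= Del).
Hypothesis hr : forall w, boundary D w -> exists nu, two_balls D w nu r.
(** As boundary distances in [D] are at most [Del], capping them at the ball radius [r] costs only
    the factor [th]. In [c0], the part [exp (- 2) / 4] comes from [pD_lower_ball] and [th ^ 2 / 4]
    from the depths of the two endpoints. *)
Let th := Num.min 1 (r / Del).
Let c0 : R := expR (- 2) / 4 * (th ^+ 2 / 4).

Let th_gt0 : 0 < th.
Proof. by rewrite /th lt_min ltr01 divr_gt0. Qed.

Let th_le1 : th <= 1.
Proof. by rewrite /th ge_min lexx. Qed.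

Lemma th_bdist_le x : D x -> th * bdist D x <= Num.min (bdist D x) r.
Proof.
move=> Dx; have d0 := ltW (bdist_gt0 oD Dx bw0); rewrite le_min; apply/andP; split.
  by apply: ler_piMl => //; exact: th_le1.
have h1 : th * bdist D x <= th * Del by apply: ler_wpM2l (hDel Dx); exact: ltW th_gt0.
apply: (le_trans h1); rewrite -ler_pdivlMr //; by rewrite /th ge_min lexx orbT.
Qed.

Let c0_gt0 : 0 < c0.
Proof. by rewrite /c0; apply: mulr_gt0; apply: divr_gt0; rewrite ?expR_gt0 ?exprn_gt0 ?th_gt0. Qed.

Lemma deep_ball x : D x ->
  exists a, [/\ ball_in D a r, enorm (x - a) < r & th * bdist D x / 2 <= depth r a x].
Proof.
move=> Dx; have [a [h1 h2 h3]] := inscribed_ball oD sD hr bw0 r0 (lexx r) Dx.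
by exists a; split => //; have := th_bdist_le Dx; lra.
Qed.

Lemma pD_lower_near t x y : 0 < t -> D x -> D y -> 4 * n.+1%:R * Num.sqrt t <= r ->
  c0 * Num.min 1 (bdist D x * bdist D y / t) * gauss t x y <= pD t x y.
Proof.
move=> t0 Dx Dy ht.
have [a [ha hx da]] := deep_ball Dx; have [b [hb hy db]] := deep_ball Dy.
apply: le_trans (pD_lower_ball oD hpD (convex_comb sD) r0 t0 ha hb hy hx ht).
apply: ler_wpM2r; first exact: ltW (gauss_gt0 _ _ _).
rewrite /c0 -mulrA; apply: ler_wpM2l; first by apply: divr_ge0 => //; exact: expR_ge0.
have X0 := bdist_gt0 oD Dx bw0; have Y0 := bdist_gt0 oD Dy bw0; have h0 := th_gt0; have h1 := th_le1.
have t21 : th ^+ 2 <= 1 by rewrite expr2 mulr_ile1 // ltW.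
apply: le_trans (min1_shrink _ _ _) (min1_le _); [by rewrite divr_ge0 ?sqr_ge0|lra|].
rewrite mulrA; apply: ler_wpM2r; first by rewrite invr_ge0 ltW.
have p1 : 0 <= th * bdist D y / 2 by rewrite divr_ge0 // mulr_ge0 // ltW.
have p2 : 0 <= th * bdist D x / 2 by rewrite divr_ge0 // mulr_ge0 // ltW.
have := ler_pM p1 p2 db da.
by rewrite (_ : th * bdist D y / 2 * (th * bdist D x / 2) = th ^+ 2 / 4 * (bdist D x * bdist D y)) //; field.
Qed.

Lemma phase_const_gt0 : 0 < @phase_const R n.
Proof. by rewrite /phase_const; apply: divr_gt0 => //; apply: mulr_gt0; rewrite ?expR_gt0 // divr_gt0 ?expR_gt0. Qed.

(** During the first half of the time the kernel is bounded below on a ball of radius [th * M / 2]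
    around the midpoint by [pD_lower_near], where boundary distances are at least [M / 2]; the
    second half is one restart towards [x]. The stronger smallness of [sqrt t] is what the restart
    demands of that radius. *)
Lemma pD_lower_interior t x y : 0 < t -> D x -> D y -> 4 * n.+1%:R * Num.sqrt t <= r ->
  16 * n.+1%:R * Num.sqrt t <= th * bdist D (midpoint x y) ->
  @phase_const R n * c0 * (th ^+ 2 / 8) *
    (Num.min 1 (bdist D x * bdist D (midpoint x y) / t) *
     Num.min 1 (bdist D y * bdist D (midpoint x y) / t)) * gauss t x y <= pD t x y.
Proof.
move=> t0 Dx Dy ht htm.
have h0 := th_gt0; have h1 := th_le1.
have Dm := D_midpoint Dx Dy; have X0 := bdist_gt0 oD Dx bw0; have Y0 := bdist_gt0 oD Dy bw0.
have M0 := bdist_gt0 oD Dm bw0; have XM := half_bdist_midpoint oD sD bw0 Dx Dy.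
set m := midpoint x y in Dm M0 XM htm *; set X := bdist D x in X0 XM *; set Y := bdist D y in Y0 *.
set M := bdist D m in M0 XM htm *.
pose rho := th * M / 2; have thM : 0 < th * M by exact: mulr_gt0.
have rho0 : 0 < rho by rewrite /rho; lra.
have rhor : rho <= r.
  by have := th_bdist_le Dm; rewrite le_min -/M /rho => /andP [_]; lra.
have rhoM : rho <= M / 2.
  by have : th * M <= 1 * M by [rewrite ler_pM2r]; rewrite /rho; lra.
have t20 : 0 < t / 2 by lra.
have t2t : t / 2 < t by lra.
have sq : Num.sqrt (t / 2) <= Num.sqrt t by rewrite ler_wsqrtr //; lra.
have N0 : 0 < n.+1%:R :> R by rewrite ltr0n.
have Nsq : n.+1%:R * Num.sqrt (t / 2) <= n.+1%:R * Num.sqrt t by rewrite ler_pM2l.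
have [a [ha hx da]] := inscribed_ball oD sD hr bw0 rho0 rhor Dx.
have hq : ball_in D m rho by move=> z hz; apply: (ball_bdist oD Dm); rewrite -/M; lra.
pose A := c0 * Num.min 1 (Y * M / t).
have it0 : 0 <= t^-1 by rewrite invr_ge0 ltW.
have A0 : 0 <= A.
  apply: mulr_ge0; first exact: ltW c0_gt0.
  by apply: min1_ge0; apply: mulr_ge0 => //; apply: mulr_ge0; exact: ltW.
have hA z : enorm (z - m) < rho -> A * gauss (t / 2) z y <= pD (t / 2) z y.
  move=> hz; have Dz := hq z hz.
  have ht2 : 4 * n.+1%:R * Num.sqrt (t / 2) <= r by lra.
  apply: le_trans (pD_lower_near t20 Dz Dy ht2).
  apply: ler_wpM2r; first exact: ltW (gauss_gt0 _ _ _).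
  apply: ler_wpM2l; first exact: ltW c0_gt0.
  apply: min1_le; rewrite -/Y.
  have Zb : M / 2 <= bdist D z.
    by have := bdist_lipschitz m z bw0; rewrite enorm_distC -/M; lra.
  have h2 : M / 2 * Y <= bdist D z * Y by rewrite ler_pM2r.
  rewrite (_ : Y * M / t = M / 2 * Y / (t / 2)); last by field; rewrite gt_eqF.
  by apply: ler_wpM2r h2; rewrite invr_ge0 ltW.
(* At half time the segment followed by the bridge is at the midpoint. *)
have qE : m = y + (t / 2 / t) *: (x - y).
  by apply/rowP => i; rewrite /m /midpoint !mxE; field; rewrite gt_eqF.
have e2 : t - t / 2 = t / 2 by lra.
have ht8 : 8 * n.+1%:R * Num.sqrt (t - t / 2) <= rho by rewrite e2 /rho; lra.
apply: le_trans (pD_lower_phase oD hpD (convex_comb sD) rho0 t20 t2t Dy A0 hq ha hx qE ht8 hA).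
apply: ler_wpM2r; first exact: ltW (gauss_gt0 _ _ _).
have min_ge : th ^+ 2 / 8 * Num.min 1 (X * M / t) <= Num.min 1 (depth rho a x * rho / (t - t / 2)).
  have t21 : th ^+ 2 <= 1 by rewrite expr2 mulr_ile1 // ltW.
  apply: le_trans (min1_shrink _ _ _) (min1_le _); [by rewrite divr_ge0 ?sqr_ge0|lra|].
  have d1 : th * X / 8 <= depth rho a x.
    apply: le_trans da; have : th * X / 4 <= Num.min X rho; last by lra.
    have q1 : th * X <= X by rewrite ler_piMl // ltW.
    have q2 : th * X <= th * (2 * M) by rewrite ler_pM2l //; lra.
    by rewrite le_min /rho; apply/andP; split; lra.
  have d2 := ler_wpM2r (ltW rho0) d1.
  rewrite e2 (_ : th ^+ 2 / 8 * (X * M / t) = th * X / 8 * rho / (t / 2)); last by rewrite /rho; field; rewrite gt_eqF.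
  by apply: ler_wpM2r d2; rewrite invr_ge0 ltW.
rewrite (_ : _ * (th ^+ 2 / 8) * _ = @phase_const R n * A * (th ^+ 2 / 8 * Num.min 1 (X * M / t))); last first.
  by rewrite /A; ring.
by apply: ler_wpM2l min_ge; apply: mulr_ge0 => //; exact: ltW phase_const_gt0.
Qed.

(** When [sqrt t] is too large for [pD_lower_interior], the midpoint satisfies [M <= C * sqrt t],
    and the product term of [hfun] is at most [C ^ 2] times the first term, already covered by
    [pD_lower_near]. *)
Lemma pD_lower_short : exists c t1, [/\ 0 < c, 0 < t1 & forall t x y, 0 < t -> t <= t1 -> D x -> D y ->
  c * hfun D t x y * gauss t x y <= pD t x y].
Proof.
have N0 : 0 < n.+1%:R :> R by rewrite ltr0n.
have h0 := th_gt0; have h1 := th_le1; have cp := c0_gt0; have pp := phase_const_gt0.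
pose t1 : R := (r / (4 * n.+1%:R)) ^+ 2.
pose C : R := 16 * n.+1%:R / th.
have C1 : 1 <= C.
  rewrite /C ler_pdivlMr // mul1r; have : 1 <= n.+1%:R :> R by rewrite ler1n.
  lra.
have C21 : 1 <= C ^+ 2 by rewrite expr2; have := ler_pM ler01 ler01 C1 C1; rewrite mulr1.
pose c1 := @phase_const R n * c0 * (th ^+ 2 / 8).
have c10 : 0 < c1 by rewrite /c1; apply: mulr_gt0; [exact: mulr_gt0|apply: divr_gt0 => //; exact: exprn_gt0].
(* The two terms of [hfun] are bounded separately, by [1 / c0] and by [C ^ 2 / c0 + 1 / c1] times
   the kernel; the lower constant is the inverse of the sum. *)
pose B := (1 + C ^+ 2) / c0 + c1^-1.
have B0 : 0 < B by rewrite /B; apply: addr_gt0; [apply: divr_gt0 => //; lra|rewrite invr_gt0].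
exists B^-1, t1; split; first by rewrite invr_gt0.
  by rewrite /t1; apply: exprn_gt0; apply: divr_gt0 => //; exact: mulr_gt0.
move=> t x y t0 tt1 Dx Dy.
pose G := gauss t x y; have G0 : 0 < G by exact: gauss_gt0.
have ht : 4 * n.+1%:R * Num.sqrt t <= r.
  rewrite mulrC -ler_pdivlMr ?mulr_gt0 //.
  have -> : r / (4 * n.+1%:R) = Num.sqrt t1.
    by rewrite /t1 sqrtr_sqr ger0_norm // divr_ge0 ?mulr_ge0 // ltW.
  by rewrite ler_wsqrtr.
have Dm := D_midpoint Dx Dy; have X0 := bdist_gt0 oD Dx bw0; have Y0 := bdist_gt0 oD Dy bw0.
have M0 := bdist_gt0 oD Dm bw0.
have hn := pD_lower_near t0 Dx Dy ht; have hi := pD_lower_interior t0 Dx Dy ht.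
rewrite -mulrA mulrC ler_pdivrMr // /hfun.
set m := midpoint x y in M0 hi *; set X := bdist D x in X0 hn hi *; set Y := bdist D y in Y0 hn hi *.
set M := bdist D m in M0 hi *; rewrite -/G in hn hi *.
set S1 := Num.min 1 (X * Y / t) in hn *.
set S2 := Num.min 1 (X * M / t) * Num.min 1 (Y * M / t) in hi *.
have u0 : 0 <= pD t x y by exact: (pD_ge0 hpD).
have it0 : 0 <= t^-1 by rewrite invr_ge0 ltW.
have q1 : 0 <= S1 by apply: min1_ge0; apply: mulr_ge0 => //; apply: mulr_ge0; exact: ltW.
have hS1 : S1 * G <= c0^-1 * pD t x y by rewrite ler_pdivlMl // mulrA.
have hS2 : S2 * G <= (C ^+ 2 / c0 + c1^-1) * pD t x y.
  have [h2|h2] := leP (16 * n.+1%:R * Num.sqrt t) (th * M).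
    have : S2 * G <= c1^-1 * pD t x y by rewrite ler_pdivlMl // mulrA; exact: hi.
    have : 0 <= C ^+ 2 / c0 * pD t x y by rewrite mulr_ge0 // divr_ge0 ?sqr_ge0 // ltW.
    rewrite mulrDl; lra.
  have MC : M <= C * Num.sqrt t.
    by rewrite /C mulrAC ler_pdivlMr // mulrC ltW.
  have sg0 : 0 < Num.sqrt t by rewrite sqrtr_gt0.
  have tE : Num.sqrt t ^+ 2 = t by rewrite sqr_sqrtr // ltW.
  have hZ Z : 0 <= Z -> Num.min 1 (Z * M / t) <= C * Num.min 1 (Z / Num.sqrt t).
    move=> Z0; apply: le_trans (min1_scale _ _) => //; last by rewrite divr_ge0 // ltW.
    apply: min1_le; rewrite -{1}tE ler_pdivrMr ?exprn_gt0 //.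
    rewrite (_ : C * (Z / Num.sqrt t) * Num.sqrt t ^+ 2 = Z * (C * Num.sqrt t)); last by field; rewrite gt_eqF.
    by apply: ler_wpM2l.
  have p Z : 0 < Z -> 0 <= Num.min 1 (Z * M / t).
    by move=> Z0; apply: min1_ge0; apply: mulr_ge0 => //; apply: mulr_ge0; exact: ltW.
  have h3 := ler_pM (p _ X0) (p _ Y0) (hZ _ (ltW X0)) (hZ _ (ltW Y0)).
  have h4 : Num.min 1 (X / Num.sqrt t) * Num.min 1 (Y / Num.sqrt t) <= S1.
    rewrite /S1 -[in X in _ <= X]tE (_ : X * Y / Num.sqrt t ^+ 2 = (X / Num.sqrt t) * (Y / Num.sqrt t)); last by field; rewrite gt_eqF.
    by apply: min1_mul; rewrite divr_ge0 // ltW.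
  have h5 : S2 <= C ^+ 2 * S1.
    apply: (le_trans h3); rewrite mulrACA -expr2; apply: ler_wpM2l h4; exact: sqr_ge0.
  have h6 : S2 * G <= C ^+ 2 * (S1 * G) by rewrite mulrA ler_pM2r.
  have h7 : C ^+ 2 * (S1 * G) <= C ^+ 2 * (c0^-1 * pD t x y) by apply: ler_wpM2l hS1; exact: sqr_ge0.
  have h8 : 0 <= c1^-1 * pD t x y by rewrite mulr_ge0 // invr_ge0 ltW.
  rewrite mulrDl -mulrA; lra.
rewrite (_ : pD t x y * B = c0^-1 * pD t x y + (C ^+ 2 / c0 + c1^-1) * pD t x y); last by rewrite /B; ring.
by rewrite mulrDl; exact: lerD.
Qed.

(** Between [t1] and [T], [hfun] times the Gaussian is at most a constant times
    [bdist D x * bdist D y]. A lower bound of this form holds at time [t1] and is carried on by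
    [pD_lower_long], whose decay brings in the dependence on [T]. *)
Lemma pD_lower_large (K t1 T : R) : (forall x, D x -> enorm x <= K) -> 0 < t1 ->
  4 * n.+1%:R * Num.sqrt t1 <= r ->
  exists2 c, 0 < c & forall t x y, t1 <= t -> t <= T -> D x -> D y ->
    c * hfun D t x y * gauss t x y <= pD t x y.
Proof.
move=> hK t10 ht1; have h0 := th_gt0; have cp := c0_gt0.
pose gmin := @peak R n t1 * expR (- ((2 * K) ^+ 2 / (4 * t1))).
have gmin0 : 0 < gmin by apply: mulr_gt0; [exact: peak_gt0|exact: expR_gt0].
(* Linearises the minimum: both entries of [min 1 (d d' / t1)] are at least [k0 * d * d'] for
   distances [d], [d'] bounded by [Del]. *)
pose k0 := Num.min (Del ^+ 2)^-1 t1^-1.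
have k00 : 0 < k0 by rewrite lt_min !invr_gt0 t10 exprn_gt0.
pose E1 : R := expR (- (2 * n.+1%:R)); have E10 : 0 < E1 by exact: expR_gt0.
pose E2 t : R := expR (- (8 * n.+1%:R ^+ 2 / r ^+ 2 * (t - t1))).
have E20 t : 0 < E2 t by exact: expR_gt0.
pose U := (t1^-1 + Del ^+ 2 / t1 ^+ 2) * @peak R n t1.
have U0 : 0 < U.
  apply: mulr_gt0; last exact: peak_gt0.
  by apply: addr_gt0; [rewrite invr_gt0|apply: divr_gt0; exact: exprn_gt0].
pose C := c0 * k0 * gmin * E1 * E2 T * (th / 2).
have C0 : 0 < C by do 5 (apply: mulr_gt0 => //); exact: divr_gt0.
exists (C / U); first exact: divr_gt0.
move=> t x y t1t tT Dx Dy; have t0 : 0 < t by lra.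
have Dm := D_midpoint Dx Dy; have X0 := bdist_gt0 oD Dx bw0; have Y0 := bdist_gt0 oD Dy bw0.
have M0 := bdist_gt0 oD Dm bw0; have MD := hDel Dm.
have [a [ha hx da]] := deep_ball Dx.
pose kap := c0 * k0 * gmin * bdist D y.
have kap0 : 0 <= kap by apply: ltW; do 3 (apply: mulr_gt0 => //).
have hk z : enorm (z - a) < r -> kap * depth r a z <= pD t1 z y.
  move=> hz; have Dz := ha z hz; have Z0 := bdist_gt0 oD Dz bw0.
  apply: le_trans (pD_lower_near t10 Dz Dy ht1).
  have h1 := ler_wpM2l kap0 (depth_le_bdist r0 ha hz).
  apply: (le_trans h1).
  have h2 : gmin <= gauss t1 z y.
    rewrite gaussE; apply: ler_wpM2l; first exact: ltW (peak_gt0 _).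
    rewrite ler_expR lerN2; apply: ler_wpM2r; first by rewrite invr_ge0 mulr_ge0 // ltW.
    rewrite -enorm_sqr ler_pXn2r ?nnegrE ?enorm_ge0 //; last first.
      by apply: mulr_ge0 => //; apply: le_trans (enorm_ge0 z) (hK z Dz).
    by have := enormD z (- y); rewrite enormN; have := hK z Dz; have := hK y Dy; lra.
  have ZY0 : 0 <= bdist D z * bdist D y by apply: mulr_ge0; exact: ltW.
  have h3 : k0 * (bdist D z * bdist D y) <= Num.min 1 (bdist D z * bdist D y / t1).
    rewrite le_min; apply/andP; split.
      have : bdist D z * bdist D y <= Del * Del by apply: ler_pM; [exact: ltW|exact: ltW|exact: hDel|exact: hDel].
      have : k0 * (bdist D z * bdist D y) <= (Del ^+ 2)^-1 * (bdist D z * bdist D y).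
        by apply: ler_wpM2r => //; rewrite ge_min lexx.
      move=> q1 q2; apply: (le_trans q1); rewrite mulrC ler_pdivrMr ?exprn_gt0 // mul1r expr2 //.
    by rewrite mulrC; apply: ler_wpM2l => //; rewrite ge_min lexx orbT.
  have h4 : 0 <= k0 * (bdist D z * bdist D y) by apply: mulr_ge0 => //; exact: ltW.
  have h5 := ler_pM h4 (ltW gmin0) h3 h2.
  have := ler_wpM2l (ltW cp) h5.
  rewrite (_ : c0 * (k0 * (bdist D z * bdist D y) * gmin) = kap * bdist D z); last by rewrite /kap; ring.
  by move=> h6; rewrite -mulrA.
have hl := pD_lower_long oD hpD r0 t10 t1t Dy kap0 ha hx hk.
apply: le_trans hl; rewrite -/E1 -/(E2 t).
have hE : E2 T <= E2 t.
  rewrite ler_expR lerN2; apply: ler_wpM2l; last by lra.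
  by apply: divr_ge0; [apply: mulr_ge0 => //; exact: sqr_ge0|exact: sqr_ge0].
have hh : hfun D t x y * gauss t x y <= U * (bdist D x * bdist D y).
  have g1 : gauss t x y <= @peak R n t1.
    by apply: (le_trans (gauss_le_peak x y t0)); exact: le_peak.
  rewrite /U mulrAC; apply: ler_pM => //; last 1 first.
  - rewrite /hfun mulrDl; set m := midpoint x y in Dm M0 MD *; set X := bdist D x in X0 *; set Y := bdist D y in Y0 *.
    set M := bdist D m in M0 MD *.
    have XY0 : 0 < X * Y by exact: mulr_gt0.
    have it : t^-1 <= t1^-1 by rewrite lef_pV2 ?posrE.
    have it0 : 0 <= t^-1 by rewrite invr_ge0 ltW.
    have s1 : Num.min 1 (X * Y / t) <= t1^-1 * (X * Y).
      by rewrite ge_min; apply/orP; right; rewrite mulrC; apply: ler_wpM2r => //; exact: ltW.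
    have s2 Z : 0 < Z -> Num.min 1 (Z * M / t) <= Z * (Del / t1).
      move=> Z0; rewrite ge_min; apply/orP; right; rewrite -mulrA; apply: ler_wpM2l; first exact: ltW.
      by apply: ler_pM => //; exact: ltW.
    have p Z : 0 < Z -> 0 <= Num.min 1 (Z * M / t).
      by move=> Z0; apply: min1_ge0; apply: mulr_ge0 => //; apply: mulr_ge0; exact: ltW.
    have s3 := ler_pM (p _ X0) (p _ Y0) (s2 _ X0) (s2 _ Y0).
    apply: lerD => //; apply: (le_trans s3); rewrite le_eqVlt; apply/orP; left; apply/eqP.
    by field; rewrite gt_eqF.
  - apply: addr_ge0; last apply: mulr_ge0; apply: min1_ge0; apply: divr_ge0; rewrite ?(ltW t0) //;
    by apply: mulr_ge0; exact: ltW.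
  - exact: ltW (gauss_gt0 _ _ _).
have hC : 0 <= C / U by apply: divr_ge0; exact: ltW.
rewrite -mulrA; apply: (le_trans (ler_wpM2l hC hh)).
rewrite mulrA divfK ?gt_eqF //.
have -> : C * (bdist D x * bdist D y) = kap * E1 * E2 T * (th * bdist D x / 2).
  by rewrite /C /kap; ring.
have q1 : 0 <= kap * E1 by apply: mulr_ge0 => //; exact: ltW.
apply: ler_pM => //.
- by apply: mulr_ge0 => //; exact: ltW.
- by apply: divr_ge0 => //; apply: mulr_ge0; exact: ltW.
- by apply: ler_wpM2l.
Qed.

End Lower.

Lemma pD_lower (T : R) : exists2 c, 0 < c & forall t x y, 0 < t -> t < T -> D x -> D y ->
  c * hfun D t x y * gauss t x y <= pD t x y.
Proof.
have [K hK] := QD_bounded oD sD cD bw0 bz0 wz0 Q0.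
have cK w : closure D w -> enorm w <= K.
  move=> cw; apply/ler_addgt0Pr => e e0; have [z Dz hz] := (closure_enormP D w).1 cw e e0.
  by have := enormD (w - z) z; rewrite subrK enorm_distC; have := hK z Dz; lra.
have [r r0 hr] := uniform_two_balls oD cD (fun w bw => cK w (bw.1)).
pose Del := K + enorm w0 + 1.
have K0 : 0 <= K by apply: le_trans (enorm_ge0 w0) (cK _ bw0.1).
have Del0 : 0 < Del by rewrite /Del; have := enorm_ge0 w0; lra.
have hDel x : D x -> bdist D x <= Del.
  move=> Dx; apply: (le_trans (bdist_le x bw0)); rewrite /Del.
  by have := enormD x (- w0); rewrite enormN; have := hK x Dx; lra.
have [c [t1 [c0 t10 h1]]] := pD_lower_short r0 Del0 hDel hr.
have N0 : 0 < n.+1%:R :> R by rewrite ltr0n.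
pose t2 := Num.min t1 ((r / (4 * n.+1%:R)) ^+ 2).
have t20 : 0 < t2 by rewrite lt_min t10 exprn_gt0 // divr_gt0 // mulr_gt0.
have ht2 : 4 * n.+1%:R * Num.sqrt t2 <= r.
  rewrite mulrC -ler_pdivlMr ?mulr_gt0 //.
  rewrite -[leRHS]ger0_norm ?divr_ge0 ?mulr_ge0 ?(ltW r0) // -sqrtr_sqr ler_wsqrtr //.
  by rewrite ge_min lexx orbT.
have [c' c'0 h2] := pD_lower_large r0 Del0 hDel hr T hK t20 ht2.
exists (Num.min c c'); first by rewrite lt_min c0.
move=> t x y t0 tT Dx Dy.
have hg k k' : k <= k' -> k' * hfun D t x y * gauss t x y <= pD t x y -> k * hfun D t x y * gauss t x y <= pD t x y.
  move=> kk; apply: le_trans; apply: ler_wpM2r; first exact: ltW (gauss_gt0 _ _ _).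
  apply: ler_wpM2r => //.
  have X0 := bdist_ge0 x bw0; have Y0 := bdist_ge0 y bw0; have M0 := bdist_ge0 (midpoint x y) bw0.
  apply: addr_ge0; last apply: mulr_ge0; apply: min1_ge0; apply: divr_ge0; rewrite ?(ltW t0) //;
  by apply: mulr_ge0.
have [h|h] := leP t t2.
  apply: hg (h1 t x y t0 _ Dx Dy); first by rewrite ge_min lexx.
  by apply: (le_trans h); rewrite ge_min lexx.
by apply: hg (h2 t x y (ltW h) (ltW tT) Dx Dy); rewrite ge_min lexx orbT.
Qed.

End TwoSided.

(** * The converse and the theorem *)

Section Phases.
Context {R : realType} {n : nat} (D : set 'rV[R]_n) (pD : R -> 'rV[R]_n -> 'rV[R]_n -> R).
Hypotheses (oD : open D) (sD : strictly_convex D).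
Hypothesis hpD : dirichlet_heat_kernel D pD.
Implicit Types (w z nu : 'rV[R]_n).

(** Near the start of the chord the height above the tangent hyperplane is linear in [th], while the
    interior ball recedes from the hyperplane only quadratically. With [d = enorm (z - w)] and [l]
    the height of [z], a point at offset [v] has height at least [3 / 4 * th * l], and
    [|v| ^ 2 <= 4 th ^ 2 d ^ 2 <= th r l] keeps it in the interior ball. *)
Lemma chord_ball w nu r z : 0 < r -> boundary D w -> two_balls D w nu r -> closure D z -> z <> w ->
  exists2 th0 : R, 0 < th0 & forall th, 0 < th -> th <= th0 ->
    ball_in D (w + th *: (z - w)) (th * dot (z - w) nu / 4) /\ th * dot (z - w) nu <= r.
Proof.
move=> r0 bw tw cz zw; have [n1 hin _] := tw.
have l0 := supporting_closure oD sD r0 bw tw cz zw.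
have ld := dot_le_enorm (z - w) nu; rewrite n1 mulr1 in ld.
set l := dot (z - w) nu in l0 ld *; set d := enorm (z - w) in ld.
have d0 : 0 < d by lra.
have d2 : 0 < 4 * d ^+ 2 by rewrite mulr_gt0 // exprn_gt0.
exists (r * l / (4 * d ^+ 2)); first by apply: divr_gt0 => //; exact: mulr_gt0.
move=> th h0; rewrite ler_pdivlMr // => h1.
have ll : l * l <= d * d by apply: ler_pM => //; exact: ltW.
split; last first.
  have h2 : th * (4 * (l * l)) <= r * l.
    apply: le_trans h1; apply: ler_wpM2l; [exact: ltW|rewrite expr2; lra].
  have h3 : th * l * 4 * l <= r * l by apply: le_trans h2; rewrite le_eqVlt; apply/orP; left; apply/eqP; ring.
  rewrite ler_pM2r // in h3; have : 0 <= th * l by rewrite mulr_ge0 // ltW.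
  lra.
move=> p hp; apply: hin.
rewrite -(@ltr_pXn2r _ 2) ?nnegrE ?enorm_ge0 ?(ltW r0) // enorm_sqr.
set v := p - w.
have -> : p - (w + r *: nu) = v - r *: nu by rewrite /v opprD addrA.
have ve : v - th *: (z - w) = p - (w + th *: (z - w)) by rewrite /v opprD addrA.
rewrite -ve in hp; set u := v - th *: (z - w) in hp.
have vu : v = u + th *: (z - w) by rewrite /u subrK.
have nv : enorm v <= th * (2 * d).
  rewrite vu; apply: (le_trans (enormD _ _)); rewrite enormZ gtr0_norm // -/d.
  have : th * l <= th * d by rewrite ler_pM2l.
  have : 0 < th * d by exact: mulr_gt0.
  lra.
have dv : 3 / 4 * (th * l) <= dot v nu.
  rewrite vu dotDl dotZl -/l; have := normr_dot_le u nu; rewrite n1 mulr1 ler_norml; lra.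
have v2 : dot v v <= th * (th * (4 * d ^+ 2)).
  rewrite -enorm_sqr; have := ler_pM (enorm_ge0 v) (enorm_ge0 v) nv nv.
  by rewrite -expr2 (_ : th * (2 * d) * (th * (2 * d)) = th * (th * (4 * d ^+ 2))) //; ring.
have v3 : th * (th * (4 * d ^+ 2)) <= th * (r * l) by rewrite ler_pM2l.
have v4 : r * (3 / 4 * (th * l)) <= r * dot v nu by rewrite ler_pM2l.
have v5 : 0 < r * (th * l) by rewrite !mulr_gt0.
have gen (A B : 'rV[R]_n) : dot B B = 1 -> dot (A - r *: B) (A - r *: B) = dot A A - 2 * (r * dot A B) + r ^+ 2.
  by move=> hB; rewrite !dotE hB (dotC B A); ring.
rewrite (gen v nu (enorm1_dot n1)); lra.
Qed.

Lemma tangent_depth w nu r rho (a : R) : two_balls D w nu r -> 0 < a -> a <= rho -> rho <= r ->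
  [/\ ball_in D (w + rho *: nu) rho, enorm (w + a *: nu - (w + rho *: nu)) < rho &
      a / 2 <= depth rho (w + rho *: nu) (w + a *: nu)].
Proof.
move=> tw a0 arho rhor; have rho0 : 0 < rho by lra.
have [n1 h1 _] := two_balls_le rho0 rhor tw.
have e : w + a *: nu - (w + rho *: nu) = (a - rho) *: nu by apply/rowP => i; rewrite !mxE; ring.
split => //; first by rewrite e enormZ n1 mulr1 ler0_norm; lra.
rewrite /depth e dotZl dotZr (enorm1_dot n1) mulr1 ler_pdivlMr ?mulr_gt0 //.
have : a * a <= a * rho by rewrite ler_pM2l.
by rewrite expr2; lra.
Qed.

Lemma depth_center rho (a : 'rV[R]_n) : 0 < rho -> depth rho a a = rho / 2.
Proof. by move=> rho0; rewrite /depth subrr dot0l subr0; field; rewrite gt_eqF. Qed.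

Lemma enorm_normalZ nu (a : R) : enorm nu = 1 -> 0 < a -> enorm (a *: nu) = a.
Proof. by move=> n1 a0; rewrite enormZ n1 mulr1 gtr0_norm. Qed.

Lemma ball_in_shift q p (rr s : R) : ball_in D q rr -> enorm (p - q) <= rr - s -> ball_in D p s.
Proof. by move=> hq hpq v hv; apply: hq; have := enorm_triangle p v q; lra. Qed.

(** The source has depth at least [a / 2] in its tangent ball and [p] has depth [rho / 2] in its
    own; [a * rho <= 4 * t] makes the minimum at least the displayed quotient. *)
Lemma launch_phase z nz rz q (rho a t : R) : two_balls D z nz rz -> 0 < a -> a <= rho -> rho <= rz ->
  ball_in D q (2 * rho) -> 0 < t -> 4 * n.+1%:R * Num.sqrt t <= rho -> a * rho <= 4 * t ->
  forall p, enorm (p - q) < rho ->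
    expR (- 2) / 4 * (a * rho / (4 * t)) * gauss t p (z + a *: nz) <= pD t p (z + a *: nz).
Proof.
move=> tz a0 arho rhor hq t0 ht hat p hp; have rho0 : 0 < rho by lra.
have [hyb hyn hyd] := tangent_depth tz a0 arho rhor.
have hpb : ball_in D p rho by apply: ball_in_shift hq _; lra.
have hpp : enorm (p - p) < rho by rewrite subrr enorm0.
apply: le_trans (pD_lower_ball oD hpD (convex_comb sD) rho0 t0 hpb hyb hyn hpp ht).
apply: ler_wpM2r; first exact: ltW (gauss_gt0 _ _ _).
apply: ler_wpM2l; first by rewrite divr_ge0 ?expR_ge0.
have t40 : 0 < 4 * t by lra.
rewrite le_min ler_pdivrMr // mul1r hat /= depth_center //.
rewrite (_ : a * rho / (4 * t) = a / 2 * (rho / 2) / t); last by field; rewrite gt_eqF.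
apply: ler_wpM2r; first by rewrite invr_ge0 ltW.
by apply: ler_wpM2r hyd; lra.
Qed.

(** As [p] is the centre of a ball whose radius exceeds the diffusion length, the minimum in
    [pD_lower_phase] is 1, and crossing costs only [phase_const]. *)
Lemma cross_phase q1 y p (rho1 rho2 A t1 t2 : R) : 0 < rho2 -> 0 < t1 -> t1 < t2 -> D y -> 0 <= A ->
  ball_in D q1 rho1 -> ball_in D p rho2 -> enorm (y + (t1 / t2) *: (p - y) - q1) <= rho1 - rho2 ->
  8 * n.+1%:R * Num.sqrt (t2 - t1) <= rho2 ->
  (forall v, enorm (v - q1) < rho1 -> A * gauss t1 v y <= pD t1 v y) ->
  @phase_const R n * A * gauss t2 p y <= pD t2 p y.
Proof.
move=> rho20 t10 t12 Dy A0 hq1 hpb hq ht hA.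
have hpp : enorm (p - p) < rho2 by rewrite subrr enorm0.
set q := y + _ in hq; have hqb := ball_in_shift hq1 hq.
have hA' v : enorm (v - q) < rho2 -> A * gauss t1 v y <= pD t1 v y.
  by move=> hv; apply: hA; have := enorm_triangle q v q1; lra.
have := pD_lower_phase oD hpD (convex_comb sD) rho20 t10 t12 Dy A0 hqb hpb hpp (erefl q) ht hA'.
rewrite depth_center // (_ : Num.min 1 _ = 1) ?mulr1 //.
have d0 : 0 < t2 - t1 by lra.
apply/min_idPl; rewrite ler_pdivlMr // mul1r.
have sq0 := sqrtr_ge0 (t2 - t1).
have ht8 : 8 * Num.sqrt (t2 - t1) <= rho2.
  have : 0 <= (n.+1%:R - 1) * Num.sqrt (t2 - t1) by apply: mulr_ge0 => //; rewrite subr_ge0 ler1n.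
  lra.
have := ler_pM (mulr_ge0 (ler0n R 8) sq0) (mulr_ge0 (ler0n R 8) sq0) ht8 ht8.
have := sqr_sqrtr (ltW d0); rewrite expr2; lra.
Qed.

Lemma landing_phase w nw rw q2 y (rho3 rho a A t1 t2 : R) : two_balls D w nw rw ->
  0 < a -> a <= rho -> rho <= rw -> 0 < t1 -> t1 < t2 -> D y -> 0 <= A -> ball_in D q2 rho3 ->
  enorm (y + (t1 / t2) *: (w + a *: nw - y) - q2) <= rho3 - rho ->
  8 * n.+1%:R * Num.sqrt (t2 - t1) <= rho -> a * rho <= 2 * (t2 - t1) ->
  (forall v, enorm (v - q2) < rho3 -> A * gauss t1 v y <= pD t1 v y) ->
  @phase_const R n * A * (a * rho / (2 * (t2 - t1))) * gauss t2 (w + a *: nw) y <= pD t2 (w + a *: nw) y.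
Proof.
move=> tw a0 arho rhor t10 t12 Dy A0 hq2 hq ht hat hA; have rho0 : 0 < rho by lra.
have [hxb hxn hxd] := tangent_depth tw a0 arho rhor.
set q := y + _ in hq; have hqb := ball_in_shift hq2 hq.
have hA' v : enorm (v - q) < rho -> A * gauss t1 v y <= pD t1 v y.
  by move=> hv; apply: hA; have := enorm_triangle q v q2; lra.
apply: le_trans (pD_lower_phase oD hpD (convex_comb sD) rho0 t10 t12 Dy A0 hqb hxb hxn (erefl q) ht hA').
apply: ler_wpM2r; first exact: ltW (gauss_gt0 _ _ _).
apply: ler_wpM2l; first by apply: mulr_ge0 => //; exact: ltW (@phase_const_gt0 R n).
have d0 : 0 < t2 - t1 by lra.
have d20 : 0 < 2 * (t2 - t1) by lra.
rewrite le_min ler_pdivrMr // mul1r hat /=.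
rewrite (_ : a * rho / (2 * (t2 - t1)) = a / 2 * rho / (t2 - t1)); last by field; rewrite gt_eqF.
by apply: ler_wpM2r; [rewrite invr_ge0 ltW|apply: ler_wpM2r hxd; exact: ltW].
Qed.

(** The crossing takes place between times [th * t] and [(1 - th) * t], so it starts at the fraction
    [th / (1 - th)] of the segment from the source to [p]. If [p] is exactly [w + th *: (z - w)] and
    [a = 0], this point is [z + th *: (w - z)]. *)
Lemma cross_point w z nz p (th a : R) : enorm nz = 1 -> 0 < a -> 0 < th -> th <= 1 / 4 ->
  enorm (z + a *: nz + (th / (1 - th)) *: (p - (z + a *: nz)) - (z + th *: (w - z))) <=
    a + 2 * th * enorm (p - (w + th *: (z - w))).
Proof.
move=> nz1 a0 th0 th4; pose lam := th / (1 - th).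
have th1 : 0 < 1 - th by lra.
have lam0 : 0 < lam by exact: divr_gt0.
have lamth : lam <= 2 * th.
  rewrite /lam ler_pdivrMr //; have : 0 <= th * (1 - 2 * th) by apply: mulr_ge0; lra.
  lra.
have lam1 : lam <= 1 by lra.
rewrite (_ : _ - _ = ((1 - lam) * a) *: nz + lam *: (p - (w + th *: (z - w)))); last first.
  by apply/rowP => i; rewrite /lam !mxE; field; rewrite gt_eqF.
apply: (le_trans (enormD _ _)); rewrite !enormZ nz1 mulr1 (gtr0_norm lam0); apply: lerD.
  rewrite ger0_norm; first by apply: ler_piMl; [exact: ltW|rewrite gerBl ltW].
  by apply: mulr_ge0; [rewrite subr_ge0|exact: ltW].
by apply: ler_wpM2r; rewrite ?enorm_ge0.
Qed.

Lemma landing_point w z nw nz (th a : R) : enorm nw = 1 -> enorm nz = 1 -> 0 < a -> 0 < th -> th < 1 ->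
  enorm (z + a *: nz + (1 - th) *: (w + a *: nw - (z + a *: nz)) - (w + th *: (z - w))) <= a.
Proof.
move=> nw1 nz1 a0 th0 th1.
rewrite (_ : _ - _ = (th * a) *: nz + ((1 - th) * a) *: nw); last first.
  by apply/rowP => i; rewrite !mxE; ring.
apply: (le_trans (enormD _ _)); rewrite !enorm_normalZ //; try (apply: mulr_gt0 => //; lra).
by rewrite -mulrDl addrC subrK mul1r.
Qed.

Lemma sqrt_le_of_lt (s t m : R) : 0 < m -> s <= t -> t < (m / (8 * n.+1%:R)) ^+ 2 ->
  8 * n.+1%:R * Num.sqrt s <= m.
Proof.
move=> m0 st ht; have N8 : 0 < 8 * n.+1%:R :> R by rewrite mulr_gt0.
rewrite mulrC -ler_pdivlMr //; rewrite -[leRHS]ger0_norm; last by apply: divr_ge0; exact: ltW.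
by rewrite -sqrtr_sqr; apply: ler_wsqrtr; exact: le_trans (ltW ht).
Qed.

End Phases.

(* The three phases follow the segment from y to x: into a ball of radius comparable to
   [th * lz] near z, across to a ball of radius comparable to [th * lw] near w, then to x. *)
Lemma pD_three_phase (R : realType) (n : nat) (D : set 'rV[R]_n) pD w z nw nz rw rz :
  open D -> strictly_convex D -> dirichlet_heat_kernel D pD -> 0 < rw -> 0 < rz -> boundary D w -> boundary D z -> w <> z ->
  two_balls D w nw rw -> two_balls D z nz rz ->
  exists2 t0, 0 < t0 & forall t, 0 < t -> t < t0 -> exists2 a0 : R, 0 < a0 & forall a, 0 < a -> a < a0 ->
    @phase_const R n ^+ 2 * (expR (- 2) / 4) * (a * dot (w - z) nz / (32 * t)) * (a * dot (z - w) nw / (32 * t)) *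
      gauss t (w + a *: nw) (z + a *: nz) <= pD t (w + a *: nw) (z + a *: nz).
Proof.
move=> oD sD hpD rw0 rz0 bw bz wz tw tz.
have [cw _] := (boundary_openP w oD).1 bw; have [cz _] := (boundary_openP z oD).1 bz.
have zw : z <> w by move=> h; apply: wz.
have [thw thw0 hw] := chord_ball oD sD rw0 bw tw cz zw.
have [thz thz0 hz] := chord_ball oD sD rz0 bz tz cw wz.
have lw0 := supporting_closure oD sD rw0 bw tw cz zw.
have lz0 := supporting_closure oD sD rz0 bz tz cw wz.
have [nw1 _ _] := tw; have [nz1 _ _] := tz.
set lw := dot (z - w) nw in hw lw0 *; set lz := dot (w - z) nz in hz lz0 *.
have [th [th0 th4 thw_ thz_ thl]] : exists th : R, [/\ 0 < th, th <= 1 / 4, th <= thw, th <= thz & th * lw <= lz / 8].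
  (* The ratio [lz / lw] enters so that the ball of radius [rho3] near [w], contracted towards [z]
     by the fraction [th / (1 - th)], fits well inside the ball of radius [rho1] near [z], however
     different the two heights are. *)
  exists (Num.min (Num.min (1 / 4) (lz / 8 / lw)) (Num.min thw thz)); split.
  - by rewrite !lt_min thw0 thz0 !divr_gt0.
  - by rewrite !ge_min lexx.
  - by rewrite !ge_min lexx !orbT.
  - by rewrite !ge_min lexx !orbT.
  - by rewrite -ler_pdivlMr // !ge_min lexx !orbT.
have [hbw rwl] := hw th th0 thw_; have [hbz rzl] := hz th th0 thz_.
have [rho1 rho10 lzE] : exists2 rho1, 0 < rho1 & th * lz = 8 * rho1.
  by exists (th * lz / 8); [rewrite divr_gt0 // mulr_gt0|field].
have [rho3 rho30 lwE] : exists2 rho3, 0 < rho3 & th * lw = 8 * rho3.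
  by exists (th * lw / 8); [rewrite divr_gt0 // mulr_gt0|field].
have thr : 2 * th * rho3 <= rho1 / 4.
  have : th * (th * lw) <= th * (lz / 8) by rewrite ler_pM2l.
  have -> : rho3 = th * lw / 8 by rewrite lwE; field.
  have -> : rho1 = th * lz / 8 by rewrite lzE; field.
  clear -rho10; lra.
rewrite lwE in hbw rwl; rewrite lzE in hbz rzl.
pose rho2 := Num.min (rho1 / 4) rho3; pose rho4 := rho3 / 2.
have rho20 : 0 < rho2 by rewrite lt_min rho30 andbT divr_gt0.
have rho40 : 0 < rho4 by rewrite divr_gt0.
have rho21 : rho2 <= rho1 / 4 by rewrite ge_min lexx.
have rho23 : rho2 <= rho3 by rewrite ge_min lexx orbT.
have m0 : 0 < Num.min rho2 rho4 by rewrite lt_min rho20.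
have hbz1 : ball_in D (z + th *: (w - z)) (2 * rho1).
  by apply: ball_in_shift hbz _; rewrite subrr enorm0; clear -rho10; lra.
have hbz2 : ball_in D (z + th *: (w - z)) rho1.
  by apply: ball_in_shift hbz _; rewrite subrr enorm0; clear -rho10; lra.
have hbw1 : ball_in D (w + th *: (z - w)) (2 * rho3).
  by apply: ball_in_shift hbw _; rewrite subrr enorm0; clear -rho10; lra.
have hbw2 : ball_in D (w + th *: (z - w)) rho3.
  by apply: ball_in_shift hbw _; rewrite subrr enorm0; clear -rho30; lra.
exists ((Num.min rho2 rho4 / (8 * n.+1%:R)) ^+ 2).
  by apply: exprn_gt0; apply: divr_gt0 => //; exact: mulr_gt0.
move=> t tp tt0.
have hsq s rho : s <= t -> Num.min rho2 rho4 <= rho -> 8 * n.+1%:R * Num.sqrt s <= rho.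
  by move=> st; apply: le_trans; exact: sqrt_le_of_lt tt0.
(* Below [32 t / lz] and [32 t / lw] the boundary factors of launch and landing are at most 1. The
   number 32 is 4 times 8 at launch, where [rho1 = th * lz / 8], and 2 times 16 at landing, where
   [rho4 = th * lw / 16]. *)
exists (Num.min (Num.min (rho1 / 4) (rho3 / 4)) (Num.min (32 * t / lz) (32 * t / lw))).
  by rewrite !lt_min !divr_gt0 // ?mulr_gt0.
move=> a ap; rewrite !lt_min => /andP [/andP [a1 a3] /andP [az aw]].
rewrite ltr_pdivlMr // in az; rewrite ltr_pdivlMr // in aw.
have tht : 0 < th * t by exact: mulr_gt0.
have tht2 : th * t <= 1 / 4 * t by rewrite ler_pM2r.
have [t1 t10 t1E] : exists2 t1, 0 < t1 & t1 = (1 - th) * t.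
  by exists ((1 - th) * t) => //; apply: mulr_gt0 => //; clear -th4; lra.
have t12 : th * t < t1 by clear -t1E tht2 tp; lra.
have t1t : t1 < t by clear -t1E tht; lra.
have arho1 : a <= rho1 by clear -a1 rho10; lra.
have arho4 : a <= rho4 by rewrite /rho4; clear -a3 rho30; lra.
have rho1r : rho1 <= rz by clear -rzl rho10; lra.
have rho4r : rho4 <= rw by rewrite /rho4; clear -rwl rho30; lra.
have min1 : Num.min rho2 rho4 <= rho1.
  by rewrite ge_min; apply/orP; left; clear -rho21 rho10; lra.
have hat1 : a * rho1 <= 4 * (th * t).
  have : th * (a * lz) <= th * (32 * t) by rewrite ler_pM2l // ltW.
  have -> : rho1 = th * lz / 8 by rewrite lzE; field.
  by clear -rho10; lra.
have hat2 : a * rho4 <= 2 * (t - t1).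
  have : th * (a * lw) <= th * (32 * t) by rewrite ler_pM2l // ltW.
  have -> : rho4 = th * lw / 16 by rewrite lwE /rho4; field.
  by rewrite t1E; clear -rho10; lra.
have hrt : 4 * n.+1%:R * Num.sqrt (th * t) <= rho1.
  have h1 := hsq (th * t) rho1 ltac:(clear -tht2 tp; lra) min1.
  apply: le_trans h1; apply: ler_wpM2r; first exact: sqrtr_ge0.
  by apply: ler_wpM2r => //; rewrite ler_nat.
have h0 := launch_phase oD sD hpD tz ap arho1 rho1r hbz1 tht hrt hat1.
have [Dy _ _] := tangent_depth tz ap arho1 rho1r.
have {}Dy : D (z + a *: nz) by have [h1 h2 _] := tangent_depth tz ap arho1 rho1r; exact: h1.
set A := expR (- 2) / 4 * _ in h0.
have A0 : 0 <= A.
  apply: mulr_ge0; first by rewrite divr_ge0 ?expR_ge0.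
  by apply: divr_ge0; apply: mulr_ge0 => //; exact: ltW.
have h1 p : enorm (p - (w + th *: (z - w))) < rho3 ->
    @phase_const R n * A * gauss t1 p (z + a *: nz) <= pD t1 p (z + a *: nz).
  move=> hp; apply: (cross_phase oD sD hpD rho20 tht t12 Dy A0 hbz2 _ _ _ h0).
  - by apply: ball_in_shift hbw1 _; clear -hp rho23; lra.
  - rewrite t1E -mulf_div divff ?gt_eqF // mulr1.
    apply: (le_trans (cross_point w z p nz1 ap th0 th4)).
    have : 2 * th * enorm (p - (w + th *: (z - w))) <= 2 * th * rho3.
      by apply: ler_wpM2l; [apply: mulr_ge0 => //; exact: ltW|exact: ltW].
    by clear -thr a1 rho21 rho10; lra.
  - by apply: hsq; [clear -tht t1t; lra|rewrite ge_min lexx].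
have PA0 : 0 <= @phase_const R n * A by apply: mulr_ge0 => //; exact: ltW (@phase_const_gt0 R n).
have h2 := @landing_phase _ _ D pD oD sD hpD w nw rw (w + th *: (z - w)) (z + a *: nz) rho3 rho4 a _ t1 t
  tw ap arho4 rho4r t10 t1t Dy PA0 hbw2 _ _ hat2 h1.
have e1 : a * rho1 / (4 * (th * t)) = a * lz / (32 * t).
  have -> : rho1 = th * lz / 8 by rewrite lzE; field.
  by field; rewrite !gt_eqF.
have e2 : a * rho4 / (2 * (t - t1)) = a * lw / (32 * t).
  have -> : rho4 = th * lw / 16 by rewrite lwE /rho4; field.
  have -> : t - t1 = th * t by rewrite t1E; ring.
  by field; rewrite !gt_eqF.
rewrite (_ : _ ^+ 2 * _ * _ * _ = @phase_const R n * (@phase_const R n * A) * (a * rho4 / (2 * (t - t1)))).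
  apply: h2; last by apply: hsq; [clear -t10; lra|rewrite ge_min lexx orbT].
  rewrite t1E -mulrA divff ?gt_eqF // mulr1.
  have th1 : th < 1 by clear -th4; lra.
  apply: (le_trans (landing_point w z nw1 nz1 ap th0 th1)).
  by rewrite /rho4; clear -a3 rho30; lra.
by rewrite /A e1 e2; ring.
Qed.

(** * Positivity of the quotient from the upper bound *)

Section Equivalence.
Context {R : realType} {n : nat} (D : set 'rV[R]_n) (pD : R -> 'rV[R]_n -> 'rV[R]_n -> R).
Hypotheses (oD : open D) (sD : strictly_convex D) (cD : C11_set D).
Hypothesis hpD : dirichlet_heat_kernel D pD.
Implicit Types (w z nu : 'rV[R]_n).

(** Dividing the three-phase bound and the assumed upper bound by the Gaussian and by
    [c2 * (a / t) ^ 2] leaves [S <= t + (d + a) ^ 2], with [1024 = 32 ^ 2]; the limit in [a] and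
    then in [t] gives [S <= d ^ 2]. *)
Lemma quotient_lower T c2 w z nw nz rw rz : 0 < T -> 0 < c2 ->
  (forall t x y, 0 < t -> t < T -> D x -> D y -> pD t x y <= c2 * hfun D t x y * gauss t x y) ->
  0 < rw -> 0 < rz -> boundary D w -> boundary D z -> w <> z ->
  two_balls D w nw rw -> two_balls D z nz rz ->
  @phase_const R n ^+ 2 * (expR (- 2) / 4) / (1024 * c2) * (dot (w - z) nz * dot (z - w) nw) <=
    bdist D (midpoint w z) ^+ 2.
Proof.
move=> T0 c20 hup rw0 rz0 bw bz wz tw tz.
have [t0 t00 ht0] := pD_three_phase oD sD hpD rw0 rz0 bw bz wz tw tz.
have [nw1 _ _] := tw; have [nz1 _ _] := tz.
set C0 := @phase_const R n ^+ 2 * (expR (- 2) / 4); set lz := dot (w - z) nz; set lw := dot (z - w) nw.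
set S := C0 / (1024 * c2) * (lz * lw); set d := bdist D (midpoint w z).
have d0 : 0 <= d by exact: bdist_ge0 bw.
rewrite leNgt; apply/negP => hS.
pose e := S - d ^+ 2; have e0 : 0 < e by rewrite subr_gt0.
(* [t] is fixed before [a], whose range depends on it. Each accounts for at most [e / 4], so that
   [t + (d + a) ^ 2 <= d ^ 2 + e / 2 < S]. *)
pose t := Num.min (Num.min (t0 / 2) (T / 2)) (e / 4).
have tp : 0 < t by rewrite !lt_min !divr_gt0.
have tt0 : t < t0 by apply: (@le_lt_trans _ _ (t0 / 2)); [rewrite !ge_min lexx|lra].
have tT : t < T by apply: (@le_lt_trans _ _ (T / 2)); [rewrite !ge_min lexx !orbT|lra].
have te : t <= e / 4 by rewrite ge_min lexx orbT.
have [a0 a00 ha0] := ht0 t tp tt0.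
pose a := Num.min (Num.min (a0 / 2) (Num.min rw rz)) (Num.min 1 (e / 4 / (2 * d + 1))).
have d21 : 0 < 2 * d + 1 by lra.
have ap : 0 < a by rewrite !lt_min rw0 rz0 ltr01 !divr_gt0.
have aa0 : a < a0 by apply: (@le_lt_trans _ _ (a0 / 2)); [rewrite !ge_min lexx|lra].
have arw : a <= rw by rewrite !ge_min lexx !orbT.
have arz : a <= rz by rewrite !ge_min lexx !orbT.
have al1 : a <= 1 by rewrite !ge_min lexx !orbT.
have ae : a * (2 * d + 1) <= e / 4 by rewrite -ler_pdivlMr // !ge_min lexx !orbT.
have := ha0 a ap aa0; rewrite -/lz -/lw -/C0.
have bx := bdist_normal oD ap arw bw tw; have by_ := bdist_normal oD ap arz bz tz.
have Dx : D (w + a *: nw) by have [h1 h2 _] := tangent_depth tw ap (lexx a) arw; exact: h1.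
have Dy : D (z + a *: nz) by have [h1 h2 _] := tangent_depth tz ap (lexx a) arz; exact: h1.
have hm : bdist D (midpoint (w + a *: nw) (z + a *: nz)) <= d + a.
  apply: (le_trans (bdist_lipschitz _ (midpoint w z) bw)); rewrite lerD2l.
  have -> : midpoint (w + a *: nw) (z + a *: nz) - midpoint w z = (a / 2) *: nw + (a / 2) *: nz.
    by apply/rowP => i; rewrite /midpoint !mxE; field.
  apply: (le_trans (enormD _ _)); have a2 : 0 < a / 2 by exact: divr_gt0.
  by rewrite !enorm_normalZ // -splitr lexx.
have M0 : 0 <= bdist D (midpoint (w + a *: nw) (z + a *: nz)) by exact: bdist_ge0 bw.
move=> h1; have h2 := le_trans h1 (hup _ _ _ tp tT Dx Dy).
rewrite ler_pM2r ?gauss_gt0 // in h2.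
move: h2; rewrite /hfun bx by_; set M := bdist D _ in hm M0 *.
have s1 : Num.min 1 (a * a / t) <= a * a / t by rewrite ge_min lexx orbT.
have s2 : Num.min 1 (a * M / t) <= a * (d + a) / t.
  rewrite ge_min; apply/orP; right; apply: ler_wpM2r; first by rewrite invr_ge0 ltW.
  by apply: ler_wpM2l => //; exact: ltW.
have q0 : 0 <= Num.min 1 (a * M / t).
  by apply: min1_ge0; apply: divr_ge0; [apply: mulr_ge0 => //|]; exact: ltW.
have s3 := ler_pM q0 q0 s2 s2.
have s4 := ler_wpM2l (ltW c20) (lerD s1 s3).
move=> h2; have h3 := le_trans h2 s4.
have e1 : C0 * (a * lz / (32 * t)) * (a * lw / (32 * t)) = c2 * (a / t) ^+ 2 * S.
  by rewrite /S; field; rewrite !gt_eqF.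
have e2 : c2 * (a * a / t + a * (d + a) / t * (a * (d + a) / t)) = c2 * (a / t) ^+ 2 * (t + (d + a) ^+ 2).
  by field; rewrite gt_eqF.
rewrite e1 e2 ler_pM2l in h3; last by rewrite mulr_gt0 // exprn_gt0 // divr_gt0.
have h4 : a * a <= a * 1 by rewrite ler_pM2l.
clear h1 h2 s1 s2 s3 s4 e1 e2 ha0 q0 hm.
by rewrite /e in e0 te ae; rewrite !expr2 in h3 e0 te ae; lra.
Qed.

Lemma QD_gt0 T c2 w0 z0 : 0 < T -> 0 < c2 ->
  (forall t x y, 0 < t -> t < T -> D x -> D y -> pD t x y <= c2 * hfun D t x y * gauss t x y) ->
  boundary D w0 -> boundary D z0 -> w0 <> z0 -> 0 < QD D.
Proof.
move=> T0 c20 hup bw0 bz0 wz0.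
pose k := @phase_const R n ^+ 2 * (expR (- 2) / 4) / (1024 * c2).
have k0 : 0 < k.
  have := @expR_gt0 R (- 2); have := @phase_const_gt0 R n => h1 h2.
  apply: divr_gt0; last by apply: mulr_gt0; [rewrite ltr0n|].
  by apply: mulr_gt0; [exact: exprn_gt0|lra].
(* From [k * lz * lw <= d ^ 2 <= d * lz / 2] follows [d >= 2 * k * lw], and the quotient in [QD]
   divides [d] by [lw / 2]. *)
apply: (@lt_le_trans _ _ (4 * k)); first by lra.
have [nu0 [r0 r00 tw0]] := normal_exists oD cD bw0.
apply: lb_le_inf.
  exists (bdist D (midpoint w0 z0) / bdist [set x | 0 < dot (x - w0) nu0] (midpoint w0 z0)).
  by exists w0, z0, [set x | 0 < dot (x - w0) nu0]; split => //; exact: tangent_half_spaceP tw0.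
move=> _ [w [z [H [bw bz wz tH ->]]]].
have [nw [rw rw0 tw]] := normal_exists oD cD bw; have [nz [rz rz0 tz]] := normal_exists oD cD bz.
rewrite (tangent_quotient oD sD rw0 tw bw bz wz tH).
have [cw _] := (boundary_openP w oD).1 bw; have [cz _] := (boundary_openP z oD).1 bz.
have lw0 := supporting_closure oD sD rw0 bw tw cz (fun h => wz (esym h)).
have lz0 := supporting_closure oD sD rz0 bz tz cw wz.
have h1 := quotient_lower T0 c20 hup rw0 rz0 bw bz wz tw tz; rewrite -/k in h1.
have Dm := midpoint_boundary sD bw bz wz.
have h2 := bdist_le_supporting oD sD rz0 bz tz Dm; rewrite midpointC dot_midpoint_l midpointC in h2.
have d0 := bdist_gt0 oD Dm bw.
rewrite ler_pdivlMr; last by rewrite divr_gt0.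
set lw := dot (z - w) nw in lw0 h1 *; set lz := dot (w - z) nz in lz0 h1 h2; set d := bdist D _ in h1 h2 d0 *.
have h3 : d ^+ 2 <= d * (lz / 2) by rewrite expr2 ler_pM2l.
have h4 : lz * (2 * k * lw) <= lz * d.
  rewrite (_ : lz * (2 * k * lw) = 2 * (k * (lz * lw))); last by ring.
  lra.
rewrite ler_pM2l // in h4; lra.
Qed.

End Equivalence.

Theorem theorem5p4 (R : realType) (n : nat) (T : R) (D : set 'rV[R]_n)
    (pD : R -> 'rV[R]_n -> 'rV[R]_n -> R)
    (hT : 0 < T)
    (hdom : domain D) (hconv : strictly_convex D) (hC11 : C11_set D)
    (hbd : exists w z : 'rV[R]_n, [/\ boundary D w, boundary D z & w <> z])
    (hpD : dirichlet_heat_kernel D pD) :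
  class_SQ D <->
  exists c1 c2 : R,
    [/\ 0 < c1, 0 < c2 &
        forall (t : R) (x y : 'rV[R]_n), D x -> D y -> 0 < t -> t < T ->
          c1 * hfun D t x y * heat_kernel t x y <= pD t x y /\
          pD t x y <= c2 * hfun D t x y * heat_kernel t x y].
Proof.
have [oD _] := hdom; have [w0 [z0 [bw0 bz0 wz0]]] := hbd; split.
  move=> [_ _ _ Q0].
  have [c1 c10 h1] := pD_lower oD hconv hC11 hpD bw0 bz0 wz0 Q0 T.
  exists c1, (80 * expR 5 * (1 + 4 / QD D) ^+ 2); split => //.
    apply: mulr_gt0; first by rewrite mulr_gt0 ?expR_gt0.
    by apply: exprn_gt0; have : 0 < 4 / QD D by [exact: divr_gt0]; lra.
  move=> t x y Dx Dy t0 tT; rewrite heat_kernelE //; split; first exact: h1.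
  exact: (pD_upper oD hconv hC11 hpD bw0 bz0 wz0 Q0).
move=> [c1 [c2 [_ c20 h]]]; split => //.
apply: (QD_gt0 oD hconv hC11 hpD hT c20 _ bw0 bz0 wz0) => t x y t0 tT Dx Dy.
by rewrite -heat_kernelE //; have [] := h t x y Dx Dy t0 tT.
Qed.
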